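(* The smooth Toeplitz algebra $\mathcal{T}^\infty$ is closed under the smooth functional calculus of self-adjoint elements: if $a\in\mathcal{T}^\infty$ is self-adjoint and $f$ is a smooth function on an open neighborhood (in $\mathbb{R}$) of the spectrum $\sigma(a)$ of $a$, then $f(a)\in\mathcal{T}^\infty$.
   Context: $H$ is a separable infinite-dimensional complex Hilbert space with a fixed orthonormal basis $\{E_k\}_{k\ge0}$; $P_{k,l}$ is the operator with $P_{k,l}E_l=E_k$ and $P_{k,l}E_m=0$ for $m\ne l$. $\mathcal{K}^\infty$ is the set of operators $c=\sum_{k,l\ge0}c_{k,l}P_{k,l}$ with rapidly decaying coefficients: $\sup_{k,l}(1+k)^M(1+l)^N|c_{k,l}|<\infty$ for all $M,N\ge0$. $U$ is the unilateral shift $UE_k=E_{k+1}$. For $f\in C^\infty(\mathbb{R}/\mathbb{Z})$ with Fourier series $\sum_nf_ne^{2\pi inx}$, $T(f)=\sum_{n\ge0}f_nU^n+\sum_{n<0}f_n(U^* )^{-n}$. The smooth Toeplitz algebra is $\mathcal{T}^\infty=\{T(f)+c:f\in C^\infty(\mathbb{R}/\mathbb{Z}),\ c\in\mathcal{K}^\infty\}\subset B(H)$. $f(a)$ denotes the continuous functional calculus of the self-adjoint operator $a$. *)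

(* Defs.v *)
From Stdlib Require Import Reals ZArith.
From Coquelicot Require Import Coquelicot.

Open Scope R_scope.

(** * Hilbert spaces and bounded operators *)

(* A complex Hilbert space is a [CompleteNormedModule C_AbsRing] together with
   an inner product, linear in the first variable, inducing its norm; positive
   definiteness is contained in [ip_norm]. *)
Record is_inner_product {H : CompleteNormedModule C_AbsRing}
    (ip : H -> H -> C) : Prop := {
  ip_plus : forall u v w : H, ip (plus u v) w = Cplus (ip u w) (ip v w);
  ip_scal : forall (z : C) (u w : H), ip (scal z u) w = Cmult z (ip u w);
  ip_conj : forall u w : H, ip w u = Cconj (ip u w);
  ip_norm : forall u : H, ip u u = RtoC (norm u ^ 2)
}.

Record is_orthonormal_basis {H : CompleteNormedModule C_AbsRing}
    (ip : H -> H -> C) (E : nat -> H) : Prop := {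
  onb_unit : forall k : nat, ip (E k) (E k) = RtoC 1;
  onb_orth : forall k l : nat, k <> l -> ip (E k) (E l) = RtoC 0;
  onb_expand : forall v : H, is_series (fun k => scal (ip v (E k)) (E k)) v
}.

(* The elements of B(H) are the maps [a : H -> H] satisfying Coquelicot's
   [is_linear], which includes boundedness. *)

Definition is_adjoint {H : CompleteNormedModule C_AbsRing}
    (ip : H -> H -> C) (a b : H -> H) : Prop :=
  forall u v : H, ip (a u) v = ip u (b v).

Definition self_adjoint {H : CompleteNormedModule C_AbsRing}
    (ip : H -> H -> C) (a : H -> H) : Prop := is_adjoint ip a a.

(* Convergence in operator norm. *)
Definition is_op_lim {H : CompleteNormedModule C_AbsRing}
    (S : nat -> H -> H) (a : H -> H) : Prop :=
  forall eps : posreal,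
    eventually (fun n => forall v : H,
      norm (minus (S n v) (a v)) <= eps * norm v).

Definition is_op_series {H : CompleteNormedModule C_AbsRing}
    (A : nat -> H -> H) (a : H -> H) : Prop :=
  is_op_lim (fun N v => sum_n (fun n => A n v) N) a.

Definition spectrum {H : CompleteNormedModule C_AbsRing}
    (a : H -> H) (z : C) : Prop :=
  ~ exists b : H -> H,
      is_linear b /\
      (forall v : H, b (minus (a v) (scal z v)) = v) /\
      (forall v : H, minus (a (b v)) (scal z (b v)) = v).

(** * Continuous functional calculus *)

(* For self-adjoint [a] the spectrum is contained in R. *)
Definition real_spectrum {H : CompleteNormedModule C_AbsRing}
    (a : H -> H) (x : R) : Prop := spectrum a (RtoC x).

Definition continuous_within (D : R -> Prop) (g : R -> C) : Prop :=
  forall x : R, D x ->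
    filterlim g (within D (locally x)) (locally (T := C_UniformSpace) (g x)).

(* [Phi] is the continuous functional calculus [g |-> g(a)] of the self-adjoint
   operator [a]: the norm-decreasing unital *-homomorphism from the continuous
   functions on the spectrum of [a] to B(H) sending the identity function to
   [a].  Elements of C(sigma(a)) are represented by functions on R continuous on
   sigma(a); by [cfc_norm] and linearity, [Phi g] depends only on the values of
   [g] on sigma(a). *)
Record is_continuous_functional_calculus {H : CompleteNormedModule C_AbsRing}
    (ip : H -> H -> C) (a : H -> H) (Phi : (R -> C) -> H -> H) : Prop := {
  cfc_linear : forall g : R -> C,
    continuous_within (real_spectrum a) g -> is_linear (Phi g);
  cfc_plus : forall g h : R -> C,
    continuous_within (real_spectrum a) g ->
    continuous_within (real_spectrum a) h ->
    forall v : H, Phi (fun x => Cplus (g x) (h x)) v = plus (Phi g v) (Phi h v);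
  cfc_scal : forall (z : C) (g : R -> C),
    continuous_within (real_spectrum a) g ->
    forall v : H, Phi (fun x => Cmult z (g x)) v = scal z (Phi g v);
  cfc_mult : forall g h : R -> C,
    continuous_within (real_spectrum a) g ->
    continuous_within (real_spectrum a) h ->
    forall v : H, Phi (fun x => Cmult (g x) (h x)) v = Phi g (Phi h v);
  cfc_conj : forall g : R -> C,
    continuous_within (real_spectrum a) g ->
    is_adjoint ip (Phi g) (Phi (fun x => Cconj (g x)));
  cfc_one : forall v : H, Phi (fun _ => RtoC 1) v = v;
  cfc_id : forall v : H, Phi (fun x => RtoC x) v = a v;
  cfc_norm : forall (g : R -> C) (M : R),
    continuous_within (real_spectrum a) g ->
    (forall x : R, real_spectrum a x -> Cmod (g x) <= M) ->
    forall v : H, norm (Phi g v) <= M * norm v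
}.

(** * Smooth functions and Fourier coefficients *)

(* Intended for open [D]; nothing is asked of [f] outside [D]. *)
Definition smooth_on (D : R -> Prop) (f : R -> C) : Prop :=
  forall (n : nat) (x : R), D x ->
    ex_derive_n (fun t => Re (f t)) n x /\ ex_derive_n (fun t => Im (f t)) n x.

(* C^oo(R/Z), as 1-periodic smooth functions on R. *)
Definition smooth_circle (f : R -> C) : Prop :=
  (forall x : R, f (x + 1) = f x) /\ smooth_on (fun _ => True) f.

(* The integral over [0, 1] of f(x) exp(-2 pi i n x). *)
Definition fourier_coef (f : R -> C) (n : Z) : C :=
  RInt (V := C_R_CompleteNormedModule)
    (fun x => Cmult (f x) (cos (2 * PI * IZR n * x), - sin (2 * PI * IZR n * x)))
    0 1.

(** * The smooth Toeplitz algebra *)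

Definition is_unilateral_shift {H : CompleteNormedModule C_AbsRing}
    (E : nat -> H) (U : H -> H) : Prop :=
  is_linear U /\ forall k : nat, U (E k) = E (S k).

(* [A = T(f)], where [Us] is the adjoint of the shift [U]; the index [n] of the
   second series stands for the Fourier mode -(n+1). *)
Definition is_toeplitz {H : CompleteNormedModule C_AbsRing}
    (U Us : H -> H) (f : R -> C) (A : H -> H) : Prop :=
  exists Ap Am : H -> H,
    is_op_series (fun n v =>
      scal (fourier_coef f (Z.of_nat n)) (Nat.iter n U v)) Ap /\
    is_op_series (fun n v =>
      scal (fourier_coef f (- Z.of_nat (S n))) (Nat.iter (S n) Us v)) Am /\
    forall v : H, A v = plus (Ap v) (Am v).

(* P_{k,l} E_l = E_k and P_{k,l} E_m = 0 for m <> l. *)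
Definition matrix_unit {H : CompleteNormedModule C_AbsRing}
    (ip : H -> H -> C) (E : nat -> H) (k l : nat) (v : H) : H :=
  scal (ip v (E l)) (E k).

Definition rapidly_decaying (c : nat -> nat -> C) : Prop :=
  forall M N : nat, exists B : R, forall k l : nat,
    (1 + INR k) ^ M * (1 + INR l) ^ N * Cmod (c k l) <= B.

(* Membership in K^oo. The double series converges absolutely in operator norm,
   so its sum may be taken along squares. *)
Definition smooth_compact {H : CompleteNormedModule C_AbsRing}
    (ip : H -> H -> C) (E : nat -> H) (a : H -> H) : Prop :=
  exists c : nat -> nat -> C,
    rapidly_decaying c /\
    is_op_lim (fun N v =>
      sum_n (fun k => sum_n (fun l =>
        scal (c k l) (matrix_unit ip E k l v)) N) N) a.

(* Membership in T^oo. *)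
Definition smooth_toeplitz {H : CompleteNormedModule C_AbsRing}
    (ip : H -> H -> C) (E : nat -> H) (U Us : H -> H) (a : H -> H) : Prop :=
  exists (f : R -> C) (A c : H -> H),
    smooth_circle f /\ is_toeplitz U Us f A /\ smooth_compact ip E c /\
    forall v : H, a v = plus (A v) (c v).

(* Main.v *)
(* Expand f on the spectrum of a in Chebyshev polynomials of the second kind,
   f(x) = sum_n s_n V_n(x/r), where r exceeds the norm of a: cut f off to a smooth
   F on the line and take the sine series of F(r cos t) sin t, whose coefficients
   s_n decay rapidly. On [-1, 1] we have |V_n| <= n, so the functional calculus
   gives ||V_n(a/r)|| <= n. If d is a derivation, the recurrence of the V_n yields
     d(V_n(a/r)) = sum_(k <= n) V_(n-k)(a/r) d(2a/r) V_k(a/r),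
   so that iterated derivations of V_n(a/r) grow only polynomially in n. This is
   used for d = [L, .] with L E_k = k E_k, which controls off-diagonal decay, and
   then for d = [U, .]: a bounded operator b whose first column decays rapidly
   lies in the smooth Toeplitz algebra as soon as [U, b] is in K^oo, and [U, a]
   is in K^oo. Summing against s_n gives [U, f(a)] in K^oo. *)
Require Import Defs.
From Stdlib Require Import Reals ZArith Lra Lia Classical.
From Stdlib Require Import FunctionalExtensionality IndefiniteDescription.
From Coquelicot Require Import Coquelicot.
From Stdlib Require Import ssreflect.

Open Scope R_scope.
Open Scope general_if_scope.

(** The second kind is chosen for its generating function G = sum_n V_n z^n = z (1 - 2xz +
    z^2)^(-1): for any derivation d, the rule for inverses gives dG = G d(2x) G, whose coefficients
    are the convolution formula. Two derivations are needed because the factors V_k(a/r) around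
    [U, a] are merely bounded: a row weight (1 + k)^M reaches [U, a] only after being commuted past
    V_(n-k)(a/r), which costs commutators with L. As L is unbounded, it never occurs as an operator:
    [wrel] records its effect on matrix entries, and bounded operators with the weighted entries are
    supplied as witnesses. The first column has to be controlled separately because analytic
    Toeplitz operators commute with U: [U, b] does not see the modes n >= 0 of the symbol. The modes
    n < 0 can be read off from row 0 of [U, b]. Every estimate may lose a power of n, since the s_n
    decay faster than all of them. *)

(** * Differentiability of finite order on an open set *)

(** Derivatives are carried as witness functions rather than through [Derive_n], so that products,
    inverses and compositions are handled by induction on the order. [Cinf_ex_derive_n] translates
    to [ex_derive_n] on open sets. *)
Fixpoint Dn (n : nat) (D : R -> Prop) (g : R -> R) : Prop :=
  match n with
  | O => True
  | S m => exists g' : R -> R,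
      (forall x, D x -> is_derive g x (g' x)) /\ Dn m D g'
  end.

Definition Cinf (D : R -> Prop) (g : R -> R) : Prop := forall n, Dn n D g.

Definition everywhere : R -> Prop := fun _ => True.

Lemma open_everywhere : open everywhere.
Proof. apply open_true. Qed.

Lemma Dn_pred n D g : Dn (S n) D g -> Dn n D g.
Proof.
  revert g; induction n as [|n IH]; intros g; [easy|].
  intros [g' [H1 H2]]; exists g'; split; auto.
Qed.

Lemma Dn_subset n (D D' : R -> Prop) g :
  (forall x, D' x -> D x) -> Dn n D g -> Dn n D' g.
Proof.
  intros HD; revert g; induction n as [|n IH]; intros g; [easy|].
  intros [g' [H1 H2]]; exists g'; split; auto.
Qed.

Lemma Dn_ext n (D : R -> Prop) f g :
  open D -> (forall x, D x -> f x = g x) -> Dn n D f -> Dn n D g.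
Proof.
  intros HD Hfg; destruct n as [|n]; [easy|].
  intros [f' [H1 H2]]; exists f'; split; auto.
  intros x Hx. apply is_derive_ext_loc with (2 := H1 x Hx).
  apply: filter_imp (HD x Hx); auto.
Qed.

Lemma Dn_const n D c : Dn n D (fun _ => c).
Proof.
  revert c; induction n as [|n IH]; intros c; [easy|].
  exists (fun _ => 0); split; auto.
  intros; apply: is_derive_const.
Qed.

Lemma Dn_id n D : Dn n D (fun x => x).
Proof.
  destruct n as [|n]; [easy|].
  exists (fun _ => 1); split; [|apply Dn_const].
  intros; apply: is_derive_id.
Qed.

Lemma Dn_plus n D f g : Dn n D f -> Dn n D g -> Dn n D (fun x => f x + g x).
Proof.
  revert f g; induction n as [|n IH]; intros f g; [easy|].
  intros [f' [Hf1 Hf2]] [g' [Hg1 Hg2]].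
  exists (fun x => f' x + g' x); split; auto.
  intros x Hx; apply: is_derive_plus; auto.
Qed.

Lemma Dn_mult n D f g : Dn n D f -> Dn n D g -> Dn n D (fun x => f x * g x).
Proof.
  revert f g; induction n as [|n IH]; intros f g; [easy|].
  intros Hf Hg.
  (* The derivative of a product contains [f] and [g] themselves, which must therefore be available
     at order [n] too. *)
  pose proof (Dn_pred _ _ _ Hf) as Pf; pose proof (Dn_pred _ _ _ Hg) as Pg.
  destruct Hf as [f' [Hf1 Hf2]], Hg as [g' [Hg1 Hg2]].
  exists (fun x => f' x * g x + f x * g' x); split.
  - intros x Hx; apply: is_derive_mult; auto. intros; apply Rmult_comm.
  - apply Dn_plus; apply IH; auto.
Qed.

Lemma Dn_opp n D f : Dn n D f -> Dn n D (fun x => - f x).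
Proof.
  revert f; induction n as [|n IH]; intros f; [easy|].
  intros [f' [Hf1 Hf2]].
  exists (fun x => - f' x); split; auto.
  intros x Hx; apply: is_derive_opp; auto.
Qed.

Lemma Dn_inv n D f : (forall x, D x -> f x <> 0) -> Dn n D f ->
  Dn n D (fun x => / f x).
Proof.
  intros Hnz; revert f Hnz; induction n as [|n IH]; intros f Hnz; [easy|].
  intros Hf; pose proof (Dn_pred _ _ _ Hf) as Pf.
  destruct Hf as [f' [Hf1 Hf2]].
  exists (fun x => - (f' x * (/ f x * / f x))); split.
  - intros x Hx.
    replace (- (f' x * (/ f x * / f x))) with (- f' x / f x ^ 2)
      by (field; auto).
    apply is_derive_inv; auto.
  - apply Dn_opp, Dn_mult; auto. apply Dn_mult; auto.
Qed.

Lemma Dn_comp n (D D' : R -> Prop) f g : (forall x, D x -> D' (g x)) ->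
  Dn n D' f -> Dn n D g -> Dn n D (fun x => f (g x)).
Proof.
  intros HD; revert f; induction n as [|n IH]; intros f; [easy|].
  intros Hf Hg; pose proof (Dn_pred _ _ _ Hg) as Pg.
  destruct Hf as [f' [Hf1 Hf2]], Hg as [g' [Hg1 Hg2]].
  exists (fun x => g' x * f' (g x)); split.
  - intros x Hx; apply: is_derive_comp; auto.
  - apply Dn_mult; auto.
Qed.

Lemma Dn_sin_cos n D : Dn n D sin /\ Dn n D cos.
Proof.
  induction n as [|n [IH1 IH2]]; [easy|]. split.
  - exists cos; split; auto. intros; apply is_derive_sin.
  - exists (fun x => - sin x); split; [intros; apply is_derive_cos|].
    now apply Dn_opp.
Qed.

Lemma Dn_Derive n D g : open D -> Dn (S n) D g ->
  (forall x, D x -> is_derive g x (Derive g x)) /\ Dn n D (Derive g).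
Proof.
  intros HD [g' [H1 H2]]; split.
  - intros x Hx; apply Derive_correct; exists (g' x); auto.
  - apply Dn_ext with g'; auto.
    intros x Hx; symmetry; apply is_derive_unique; auto.
Qed.

(** The two witnesses need not agree as functions; [Derive g] is a common one. This glues a function
    cut off inside a ball to zero outside. *)
Lemma Dn_union n D1 D2 g : open D1 -> open D2 -> Dn n D1 g -> Dn n D2 g ->
  Dn n (fun x => D1 x \/ D2 x) g.
Proof.
  intros HD1 HD2; revert g; induction n as [|n IH]; intros g; [easy|].
  intros H1 H2; destruct (Dn_Derive _ _ _ HD1 H1), (Dn_Derive _ _ _ HD2 H2).
  exists (Derive g); split; auto. intros x [Hx|Hx]; auto.
Qed.

Lemma Cinf_Derive D g : open D -> Cinf D g ->
  (forall x, D x -> is_derive g x (Derive g x)) /\ Cinf D (Derive g).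
Proof.
  intros HD Hg; split.
  - apply (Dn_Derive 0 D g HD (Hg 1%nat)).
  - intros n; apply (Dn_Derive n D g HD (Hg (S n))).
Qed.

Lemma Cinf_continuous D g : Cinf D g -> forall x, D x -> continuous g x.
Proof.
  intros Hg x Hx; destruct (Hg 1%nat) as [g' [H1 _]].
  apply: ex_derive_continuous; exists (g' x); auto.
Qed.

Lemma Cinf_ex_derive_n D g : open D ->
  Cinf D g <-> (forall n x, D x -> ex_derive_n g n x).
Proof.
  intros HD; split; intros Hg n.
  - destruct n as [|n]; [easy|]. intros x Hx; simpl.
    assert (H : forall k, Cinf D (Derive_n g k)).
    { induction k as [|k IH]; auto. simpl. now apply Cinf_Derive. }
    eexists; apply (Cinf_Derive D _ HD (H n)); auto.
  - assert (H : forall k, Dn n D (Derive_n g k)).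
    { induction n as [|n IH]; intros k; [easy|].
      exists (Derive_n g (S k)); split; auto.
      intros x Hx; apply Derive_correct, (Hg (S k) x Hx). }
    apply (H O).
Qed.

(** * Smooth cutoffs *)

(** The powers of 1/x close the family under differentiation: the derivative of [flat m] combines
    [flat (m + 2)] and [flat (m + 1)], so smoothness follows for all [m] at once by induction on the
    order. *)
Definition flat (m : nat) (x : R) : R :=
  if Rle_dec x 0 then 0 else exp (- / x) * (/ x) ^ m.

(** For k > 0, exp y = exp (y/k)^k >= (y/k)^k. *)
Lemma pow_exp_bound k y : 0 <= y -> exp (- y) * y ^ k <= INR k ^ k.
Proof.
  intros Hy; destruct k as [|k].
  - simpl. rewrite Rmult_1_r -exp_0.
    destruct (Req_dec y 0) as [->|H]; [rewrite Ropp_0; lra|].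
    left; apply exp_increasing; lra.
  - set (n := S k).
    assert (Hn : 0 < INR n) by (apply lt_0_INR; unfold n; lia).
    assert (H : y ^ n <= INR n ^ n * exp y).
    { replace y with (INR n * (y / INR n)) at 1 by (field; lra).
      rewrite Rpow_mult_distr; apply Rmult_le_compat_l; [apply pow_le; lra|].
      replace (exp y) with (exp (y / INR n) ^ n).
      - apply pow_incr; split; [apply Rdiv_le_0_compat; lra|].
        pose proof (exp_ineq1_le (y / INR n)); lra.
      - rewrite -Rpower_pow; [|apply exp_pos].
        unfold Rpower; rewrite ln_exp; f_equal; field; lra. }
    rewrite exp_Ropp. pose proof (exp_pos y).
    apply Rmult_le_reg_l with (exp y); auto.
    rewrite -Rmult_assoc Rinv_r; [|lra]. lra.
Qed.

Lemma flat_pos m x : 0 < x -> flat m x = exp (- / x) * (/ x) ^ m.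
Proof. intros; unfold flat; destruct (Rle_dec x 0); lra. Qed.

Lemma flat_neg m x : x <= 0 -> flat m x = 0.
Proof. intros; unfold flat; destruct (Rle_dec x 0); lra. Qed.

Lemma is_derive_flat m x :
  is_derive (flat m) x (flat (S (S m)) x - INR m * flat (S m) x).
Proof.
  destruct (Rtotal_order x 0) as [Hx|[Hx|Hx]].
  - rewrite !flat_neg; try lra. rewrite Rmult_0_r Rminus_0_r.
    apply is_derive_ext_loc with (fun _ => 0); [|apply: is_derive_const].
    apply: filter_imp (open_lt 0 x Hx); intros t Ht.
    rewrite flat_neg; lra.
  - subst x. rewrite !flat_neg; try lra. rewrite Rmult_0_r Rminus_0_r.
    apply is_derive_Reals. intros eps Heps.
    (* At y = 1/h, [pow_exp_bound] with exponent m + 2 gives [flat m h] / h <= C h, so eps / C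
       serves as delta. *)
    set (C := INR (S (S m)) ^ (S (S m))).
    assert (HC : 0 < C) by (apply pow_lt, lt_0_INR; lia).
    assert (Hd : 0 < eps / C) by (apply Rdiv_lt_0_compat; lra).
    exists (mkposreal _ Hd); simpl; intros h Hh0 Hh.
    rewrite Rplus_0_l (flat_neg m 0); [|lra]. rewrite !Rminus_0_r.
    destruct (Rle_dec h 0) as [H|H].
    { rewrite flat_neg; auto. unfold Rdiv; rewrite Rmult_0_l Rabs_R0; auto. }
    assert (Hp : 0 < h) by lra.
    assert (Hi : 0 < / h) by (apply Rinv_0_lt_compat; lra).
    rewrite Rabs_pos_eq in Hh; [|lra].
    rewrite flat_pos; auto.
    pose proof (pow_exp_bound (S (S m)) (/ h) (Rlt_le _ _ Hi)) as B.
    fold C in B. simpl in B.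
    assert (Hpos : 0 < exp (- / h) * (/ h) ^ m)
      by (apply Rmult_lt_0_compat; [apply exp_pos|apply pow_lt; auto]).
    unfold Rdiv. rewrite Rabs_pos_eq; [|apply Rmult_le_pos; lra].
    apply Rle_lt_trans with (C * h).
    + apply Rmult_le_reg_r with (/ h); auto.
      rewrite (Rmult_assoc C h) Rinv_r; [|lra]. lra.
    + apply Rmult_lt_reg_r with (/ C); [apply Rinv_0_lt_compat; lra|].
      replace (C * h * / C) with h by (field; lra). exact Hh.
  - rewrite !flat_pos; auto.
    apply is_derive_ext_loc with (fun x => exp (- / x) * (/ x) ^ m).
    + apply: filter_imp (open_gt 0 x Hx); intros t Ht.
      rewrite flat_pos; auto.
    + evar_last. { auto_derive; [split; [lra|split; [lra|easy]] || lra|reflexivity]. }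
      destruct m as [|m]; [simpl; field; lra|].
      rewrite S_INR. simpl pred. simpl pow. field; lra.
Qed.

Lemma Cinf_flat m : Cinf everywhere (flat m).
Proof.
  intros n; revert m; induction n as [|n IH]; intros m; [easy|].
  exists (fun x => flat (S (S m)) x + - (INR m * flat (S m) x)); split.
  - intros x _; apply is_derive_flat.
  - apply Dn_plus; auto. apply Dn_opp, Dn_mult; auto. apply Dn_const.
Qed.

(** The transition from 0 to 1 takes place on [0, 1]. The denominator cannot vanish because x and 1
    - x are never both <= 0. *)
Definition step (x : R) : R := flat 0 x * / (flat 0 x + flat 0 (1 - x)).

Lemma flat0_ge x : 0 <= flat 0 x.
Proof.
  unfold flat; destruct (Rle_dec x 0); [lra|].
  simpl; rewrite Rmult_1_r; left; apply exp_pos.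
Qed.

Lemma flat0_gt x : 0 < x -> 0 < flat 0 x.
Proof.
  intros; rewrite flat_pos; auto.
  simpl; rewrite Rmult_1_r; apply exp_pos.
Qed.

Lemma step_denom x : flat 0 x + flat 0 (1 - x) <> 0.
Proof.
  pose proof (flat0_ge x); pose proof (flat0_ge (1 - x)).
  destruct (Rle_dec x 0).
  - pose proof (flat0_gt (1 - x)); lra.
  - pose proof (flat0_gt x); lra.
Qed.

Lemma step_0 x : x <= 0 -> step x = 0.
Proof. intros; unfold step; rewrite flat_neg; lra. Qed.

Lemma step_1 x : 1 <= x -> step x = 1.
Proof.
  intros; unfold step. pose proof (step_denom x) as Hd.
  rewrite (flat_neg 0 (1 - x)) in Hd |- *; try lra.
  field; lra.
Qed.

Lemma Dn_affine n D p q : Dn n D (fun x => p * x + q).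
Proof.
  apply Dn_plus; [apply Dn_mult; [apply Dn_const|apply Dn_id]|apply Dn_const].
Qed.

Lemma Cinf_step_affine p q : Cinf everywhere (fun x => step (p * x + q)).
Proof.
  intros n. apply Dn_comp with everywhere; [easy| |apply Dn_affine].
  apply Dn_mult; [apply Cinf_flat|].
  apply Dn_inv; [intros; apply step_denom|].
  apply Dn_plus; [apply Cinf_flat|].
  apply Dn_comp with everywhere; [easy|apply Cinf_flat|].
  apply Dn_ext with (fun x => -1 * x + 1); [apply open_everywhere| |apply Dn_affine].
  intros; lra.
Qed.

Lemma open_dist_lt t r : open (fun x => Rabs (x - t) < r).
Proof.
  intros x Hx. exists (mkposreal (r - Rabs (x - t)) ltac:(lra)).
  intros y Hy. change (Rabs (y - x) < r - Rabs (x - t)) in Hy.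
  pose proof (Rabs_triang (y - x) (x - t)).
  replace (y - x + (x - t)) with (y - t) in * by ring. lra.
Qed.

Lemma open_dist_gt t r : open (fun x => r < Rabs (x - t)).
Proof.
  intros x Hx. exists (mkposreal (Rabs (x - t) - r) ltac:(lra)).
  intros y Hy. change (Rabs (y - x) < Rabs (x - t) - r) in Hy.
  pose proof (Rabs_triang (x - y) (y - t)).
  rewrite (Rabs_minus_sym x y) in H.
  replace (x - y + (y - t)) with (x - t) in * by ring. lra.
Qed.

Lemma local_extension D f t : open D -> D t -> Cinf D f ->
  exists r G, 0 < r /\ Cinf everywhere G /\
    forall x, Rabs (x - t) < r -> G x = f x.
Proof.
  intros HD Ht Hf. destruct (HD t Ht) as [rho Hrho].
  assert (Hr := cond_pos rho).
  (* One factor cuts off on each side: [b] is 1 for |x - t| <= rho/2 and 0 for |x - t| >= 3 rho/4.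
     The sets |x - t| < rho and |x - t| > 3 rho/4 then cover the line, and [G] is smooth on each. *)
  set (b := fun x => step (- (4 / rho) * x + (3 + 4 / rho * t)) *
                     step (4 / rho * x + (3 - 4 / rho * t))).
  set (G := fun x => if Rlt_dec (Rabs (x - t)) rho then f x * b x else 0).
  exists (rho / 2), G; split; [lra|]. split.
  - intros n.
    apply Dn_subset with
      (fun x => Rabs (x - t) < rho \/ 3 / 4 * rho < Rabs (x - t)).
    { intros x _. lra. }
    apply Dn_union; [apply open_dist_lt|apply open_dist_gt| |].
    + apply Dn_ext with (fun x => f x * b x); [apply open_dist_lt| |].
      { intros x Hx; unfold G; destruct (Rlt_dec _ _); lra. }
      apply Dn_mult.
      * apply Dn_subset with D; [exact Hrho|apply Hf].
      * apply Dn_subset with everywhere; [easy|].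
        apply Dn_mult; apply Cinf_step_affine.
    + apply Dn_ext with (fun _ => 0); [apply open_dist_gt| |apply Dn_const].
      intros x Hx; unfold G; destruct (Rlt_dec _ _); auto.
      unfold b.
      assert (Hd : 4 / rho * (3 / 4 * rho) = 3) by (field; lra).
      assert (Hq : 0 < 4 / rho) by (apply Rdiv_lt_0_compat; lra).
      unfold Rabs in Hx; destruct (Rcase_abs (x - t)).
      * rewrite (step_0 (4 / rho * x + _)); [ring|].
        assert (4 / rho * (3 / 4 * rho) < 4 / rho * (- (x - t)))
          by (apply Rmult_lt_compat_l; lra). lra.
      * rewrite (step_0 (- (4 / rho) * x + _)); [ring|].
        assert (4 / rho * (3 / 4 * rho) < 4 / rho * (x - t))
          by (apply Rmult_lt_compat_l; lra). lra.
  - intros x Hx; unfold G; destruct (Rlt_dec _ _); [|lra].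
    unfold b. apply Rabs_def2 in Hx.
    assert (Hd : 4 / rho * (rho / 2) = 2) by (field; lra).
    assert (Hq : 0 < 4 / rho) by (apply Rdiv_lt_0_compat; lra).
    assert (4 / rho * (x - t) < 4 / rho * (rho / 2))
      by (apply Rmult_lt_compat_l; lra).
    assert (4 / rho * (- (x - t)) < 4 / rho * (rho / 2))
      by (apply Rmult_lt_compat_l; lra).
    rewrite !step_1; lra.
Qed.

(** A supremum argument in place of a partition of unity: t is the supremum of the y <= B such that
    f, on the part of K up to y, has a smooth extension. A local extension around t pushes past t,
    which forces t + r/2 > B, and then all of K is reached. Since t may lie outside K, closedness of
    K is used there to take 0 as local extension. *)
Lemma smooth_extension (K D : R -> Prop) f B : open D -> Cinf D f ->
  (forall x, K x -> D x) -> (forall x, K x -> Rabs x < B) ->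
  (forall x, ~ K x -> locally x (fun y => ~ K y)) ->
  exists F, Cinf everywhere F /\ forall x, K x -> F x = f x.
Proof.
  intros HD Hf HKD HKB HKc.
  assert (Hloc : forall t, exists r G, 0 < r /\ Cinf everywhere G /\
      forall x, K x -> Rabs (x - t) < r -> G x = f x).
  { intros t; destruct (classic (K t)) as [Ht|Ht].
    - destruct (local_extension D f t) as (r & G & Hr & HG & HGf); auto.
      exists r, G; auto.
    - destruct (HKc t Ht) as [r Hr]. exists r, (fun _ => 0).
      split; [apply cond_pos|]. split; [intros n; apply Dn_const|].
      intros x Hx Hxt; destruct (Hr x Hxt Hx). }
  set (S := fun y => exists F, Cinf everywhere F /\
      forall x, K x -> x <= y -> F x = f x).
  destruct (completeness (fun y => y <= B /\ S y)) as [t [Ht1 Ht2]].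
  { exists B; intros y [Hy _]; auto. }
  { exists (- Rabs B); split.
    - pose proof (Rle_abs (- B)); rewrite Rabs_Ropp in H; lra.
    - exists (fun _ => 0); split; [intros n; apply Dn_const|].
      intros x Hx Hxy. pose proof (HKB x Hx) as H.
      pose proof (Rle_abs (- x)); pose proof (Rle_abs B). rewrite Rabs_Ropp in H0; lra. }
  destruct (Hloc t) as (r & G & Hr & HG & HGf).
  assert (Hy : exists y, t - r < y /\ y <= B /\ S y).
  { apply NNPP; intros Hn. assert (t <= t - r); [|lra].
    apply Ht2; intros y [Hy1 Hy2].
    destruct (Rle_lt_dec y (t - r)); auto. destruct Hn; exists y; auto. }
  destruct Hy as (y & Hy1 & Hy2 & F & HF & HFf).
  assert (Hyt : y <= t) by (apply Ht1; split; [|exists F]; auto).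
  assert (HS : S (t + r / 2)).
  (* [s] climbs from 0 at t - r to 1 at y. In between, both [F] and [G] agree with [f] on [K], hence
     so does their convex combination. *)
  { set (p := / (y - (t - r))).
    assert (Hp : 0 < p) by (apply Rinv_0_lt_compat; lra).
    assert (Hp1 : p * (y - (t - r)) = 1) by (apply Rinv_l; lra).
    set (s := fun x => step (p * x + - (p * (t - r)))).
    exists (fun x => F x * (1 + - s x) + G x * s x); split.
    - intros n. assert (Dn n everywhere s) by (apply Cinf_step_affine).
      apply Dn_plus; apply Dn_mult; auto.
      apply Dn_plus; [apply Dn_const|]. now apply Dn_opp.
    - intros x Hx Hxt. destruct (Rle_lt_dec x (t - r)) as [Hc|Hc].
      + unfold s; rewrite step_0; [rewrite HFf; auto; lra|].
        assert (p * x <= p * (t - r)) by (apply Rmult_le_compat_l; lra). lra.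
      + assert (G x = f x) as -> by (apply HGf; auto; apply Rabs_def1; lra).
        destruct (Rle_lt_dec x y).
        * rewrite HFf; auto; lra.
        * unfold s; rewrite step_1; [lra|].
          assert (p * (y - (t - r)) <= p * (x - (t - r)))
            by (apply Rmult_le_compat_l; lra). lra. }
  destruct (Rle_lt_dec (t + r / 2) B) as [Hc|Hc].
  - assert (t + r / 2 <= t) by (apply Ht1; auto). lra.
  - destruct HS as (F' & HF' & HFf'). exists F'; split; auto.
    intros x Hx; apply HFf'; auto. apply HKB in Hx.
    pose proof (Rle_abs x); lra.
Qed.

(** * Fourier coefficients of smooth periodic functions *)

Definition cosz (z : Z) (x : R) : R := cos (2 * PI * IZR z * x).
Definition sinz (z : Z) (x : R) : R := sin (2 * PI * IZR z * x).

Lemma sinz_1 z : sinz z 1 = 0.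
Proof.
  apply sin_eq_0_1. exists (2 * z)%Z. rewrite mult_IZR; ring.
Qed.

Lemma cosz_1 z : cosz z 1 = 1.
Proof.
  unfold cosz. replace (2 * PI * IZR z * 1) with (2 * (IZR z * PI)) by ring.
  rewrite cos_2a_sin sin_eq_0_1; [ring|]. now exists z.
Qed.

Lemma sinz_0 z : sinz z 0 = 0.
Proof. unfold sinz; rewrite Rmult_0_r; apply sin_0. Qed.

Lemma cosz_0 z : cosz z 0 = 1.
Proof. unfold cosz; rewrite Rmult_0_r; apply cos_0. Qed.

Lemma is_derive_sinz z x : is_derive (sinz z) x (2 * PI * IZR z * cosz z x).
Proof. unfold sinz, cosz. auto_derive; auto. ring. Qed.

Lemma is_derive_cosz z x : is_derive (cosz z) x (- (2 * PI * IZR z) * sinz z x).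
Proof. unfold sinz, cosz. auto_derive; auto. ring. Qed.

Lemma continuous_sinz z x : continuous (sinz z) x.
Proof. apply: ex_derive_continuous; eexists; apply is_derive_sinz. Qed.

Lemma continuous_cosz z x : continuous (cosz z) x.
Proof. apply: ex_derive_continuous; eexists; apply is_derive_cosz. Qed.

Lemma ex_RInt_everywhere (u : R -> R) a b :
  (forall x, continuous u x) -> ex_RInt u a b.
Proof. intros; apply: ex_RInt_continuous; auto. Qed.

Lemma is_RInt_unique_R (f : R -> R) a b l : is_RInt f a b l -> RInt f a b = l.
Proof. apply: is_RInt_unique. Qed.

Lemma continuous_Rmult (u v : R -> R) x :
  continuous u x -> continuous v x -> continuous (fun t => u t * v t) x.
Proof. intros; apply: continuous_mult; auto. Qed.

Lemma is_RInt_mul_cosz u z : (forall x, continuous u x) ->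
  is_RInt (fun x => u x * cosz z x) 0 1 (RInt (fun x => u x * cosz z x) 0 1).
Proof.
  intros; apply: RInt_correct; apply ex_RInt_everywhere.
  intros; apply continuous_Rmult; auto. apply continuous_cosz.
Qed.

Lemma is_RInt_mul_sinz u z : (forall x, continuous u x) ->
  is_RInt (fun x => u x * sinz z x) 0 1 (RInt (fun x => u x * sinz z x) 0 1).
Proof.
  intros; apply: RInt_correct; apply ex_RInt_everywhere.
  intros; apply continuous_Rmult; auto. apply continuous_sinz.
Qed.

Lemma Derive_periodic u : Cinf everywhere u -> (forall x, u (x + 1) = u x) ->
  forall x, Derive u (x + 1) = Derive u x.
Proof.
  intros Hu Hp x. destruct (Cinf_Derive _ _ open_everywhere Hu) as [H _].
  symmetry; apply is_derive_unique.
  apply is_derive_ext with (fun t => u (t + 1)); [auto|].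
  evar_last. { apply: is_derive_comp; [apply H; easy|].
    apply: is_derive_plus; [apply: is_derive_id|apply: is_derive_const]. }
  rewrite /= /scal /= /mult /= /plus /one /zero /=; ring.
Qed.

(** The boundary terms vanish: the sine is 0 at both ends, and in the cosine case the two ends
    cancel by periodicity. *)
Lemma fourier_by_parts u z : Cinf everywhere u -> (forall x, u (x + 1) = u x) ->
  2 * PI * IZR z * RInt (fun x => u x * cosz z x) 0 1 =
    - RInt (fun x => Derive u x * sinz z x) 0 1 /\
  2 * PI * IZR z * RInt (fun x => u x * sinz z x) 0 1 =
    RInt (fun x => Derive u x * cosz z x) 0 1.
Proof.
  intros Hu Hp.
  destruct (Cinf_Derive _ _ open_everywhere Hu) as [Hd Hu'].
  pose proof (fun x => Cinf_continuous _ _ Hu x I) as Cu.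
  pose proof (fun x => Cinf_continuous _ _ Hu' x I) as Cu'.
  assert (H01 : u 1 = u 0) by (rewrite -(Hp 0); f_equal; ring).
  set (w := 2 * PI * IZR z). split.
  - assert (H1 : is_RInt (fun x => Derive u x * sinz z x + w * (u x * cosz z x))
        0 1 (minus (u 1 * sinz z 1) (u 0 * sinz z 0))).
    { apply: (is_RInt_derive (fun x => u x * sinz z x)).
      - intros x _. evar_last.
        { apply: is_derive_mult; [apply Hd; easy|apply is_derive_sinz|].
          intros; apply Rmult_comm. }
        rewrite /= /plus /mult /=. fold w. ring.
      - intros x _. apply: continuous_plus.
        + apply continuous_Rmult; auto. apply continuous_sinz.
        + apply continuous_Rmult; [apply: continuous_const|].
          apply continuous_Rmult; auto. apply continuous_cosz. }
    assert (H2 := is_RInt_plus _ _ _ _ _ _ (is_RInt_mul_sinz _ z Cu')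
      (is_RInt_scal _ _ _ w _ (is_RInt_mul_cosz _ z Cu))).
    apply is_RInt_unique_R in H1. apply is_RInt_unique_R in H2.
    rewrite /plus /scal /= /mult /= in H2. rewrite H1 in H2.
    rewrite sinz_0 sinz_1 /minus /plus /opp /= in H2. lra.
  - assert (H1 : is_RInt (fun x => Derive u x * cosz z x + (- w) * (u x * sinz z x))
        0 1 (minus (u 1 * cosz z 1) (u 0 * cosz z 0))).
    { apply: (is_RInt_derive (fun x => u x * cosz z x)).
      - intros x _. evar_last.
        { apply: is_derive_mult; [apply Hd; easy|apply is_derive_cosz|].
          intros; apply Rmult_comm. }
        rewrite /= /plus /mult /=. fold w. ring.
      - intros x _. apply: continuous_plus.
        + apply continuous_Rmult; auto. apply continuous_cosz.
        + apply continuous_Rmult; [apply: continuous_const|].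
          apply continuous_Rmult; auto. apply continuous_sinz. }
    assert (H2 := is_RInt_plus _ _ _ _ _ _ (is_RInt_mul_cosz _ z Cu')
      (is_RInt_scal _ _ _ (- w) _ (is_RInt_mul_sinz _ z Cu))).
    apply is_RInt_unique_R in H1. apply is_RInt_unique_R in H2.
    rewrite /plus /scal /= /mult /= in H2. rewrite H1 in H2.
    rewrite cosz_0 cosz_1 H01 /minus /plus /opp /= in H2. lra.
Qed.

Lemma Rabs_RInt_le u v a b : a <= b -> (forall x, continuous u x) ->
  (forall x, continuous v x) -> (forall x, Rabs (u x) <= v x) ->
  Rabs (RInt u a b) <= RInt v a b.
Proof.
  intros Hab Hu Hv Huv.
  apply (norm_RInt_le (V := R_NormedModule) u v a b _ _ Hab).
  - intros x _; apply Huv.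
  - apply: RInt_correct; now apply ex_RInt_everywhere.
  - apply: RInt_correct; now apply ex_RInt_everywhere.
Qed.

Lemma continuous_Rabs_comp (u : R -> R) x :
  continuous u x -> continuous (fun t => Rabs (u t)) x.
Proof. intros; apply: continuous_comp; auto. apply: continuous_abs. Qed.

(** Each integration by parts trades a factor z for a derivative of u, and the factor 2 pi >= 1 is
    dropped. At order 0 the integral of |u| bounds all coefficients. *)
Lemma fourier_decay M u : Cinf everywhere u -> (forall x, u (x + 1) = u x) ->
  exists B, forall z,
    Rabs (IZR z) ^ M * Rabs (RInt (fun x => u x * cosz z x) 0 1) <= B /\
    Rabs (IZR z) ^ M * Rabs (RInt (fun x => u x * sinz z x) 0 1) <= B.
Proof.
  revert u; induction M as [|M IH]; intros u Hu Hp.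
  - pose proof (fun x => Cinf_continuous _ _ Hu x I) as Cu.
    exists (RInt (fun x => Rabs (u x)) 0 1). intros z. rewrite /= !Rmult_1_l.
    split; apply Rabs_RInt_le; try lra;
      try (intros; apply continuous_Rmult; auto;
           apply continuous_cosz || apply continuous_sinz);
      try (intros; apply continuous_Rabs_comp; auto);
      intros x; rewrite Rabs_mult -{2}(Rmult_1_r (Rabs (u x)));
      apply Rmult_le_compat_l; try apply Rabs_pos;
      apply Rabs_le; [apply COS_bound|apply SIN_bound].
  - destruct (IH (Derive u)) as [B HB].
    { apply Cinf_Derive; auto. apply open_everywhere. }
    { now apply Derive_periodic. }
    exists B; intros z. destruct (HB z) as [B1 B2].
    destruct (fourier_by_parts u z Hu Hp) as [P1 P2].
    pose proof PI_RGT_0. pose proof PI2_1.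
    assert (Hw : forall p q, 2 * PI * IZR z * p = q ->
      Rabs (IZR z) ^ S M * Rabs p <= Rabs (IZR z) ^ M * Rabs q).
    { intros p q <-. rewrite Rmult_assoc (Rabs_mult (2 * PI)) (Rabs_mult (IZR z)).
      rewrite (Rabs_pos_eq (2 * PI)); [|lra].
      simpl. pose proof (pow_le (Rabs (IZR z)) M (Rabs_pos _)) as Hz.
      pose proof (Rmult_le_pos _ _ (Rmult_le_pos _ _ Hz (Rabs_pos (IZR z)))
        (Rabs_pos p)).
      assert (1 <= 2 * PI) by lra. nra. }
    split; (eapply Rle_trans; [apply Hw; eassumption|]); auto.
    rewrite Rabs_Ropp; auto.
Qed.

(** * Uniqueness of Fourier coefficients *)

Definition fourier_null (g : R -> R) : Prop := forall z,
  is_RInt (fun x => g x * cosz z x) 0 1 0 /\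
  is_RInt (fun x => g x * sinz z x) 0 1 0.

Lemma is_RInt_null_comb (f g : R -> R) p q :
  is_RInt f 0 1 0 -> is_RInt g 0 1 0 ->
  is_RInt (fun x => p * f x + q * g x) 0 1 0.
Proof.
  intros Hf Hg.
  assert (H := is_RInt_plus _ _ _ _ _ _ (is_RInt_scal _ _ _ p _ Hf)
    (is_RInt_scal _ _ _ q _ Hg)).
  rewrite !scal_zero_r plus_zero_r in H. exact H.
Qed.

Lemma trig_shift z x :
  cosz (z + 1) x = cosz z x * cos (2 * PI * x) - sinz z x * sin (2 * PI * x) /\
  cosz (z - 1) x = cosz z x * cos (2 * PI * x) + sinz z x * sin (2 * PI * x) /\
  sinz (z + 1) x = sinz z x * cos (2 * PI * x) + cosz z x * sin (2 * PI * x) /\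
  sinz (z - 1) x = sinz z x * cos (2 * PI * x) - cosz z x * sin (2 * PI * x).
Proof.
  unfold cosz, sinz. rewrite plus_IZR minus_IZR.
  replace (2 * PI * (IZR z + 1) * x) with (2 * PI * IZR z * x + 2 * PI * x) by ring.
  replace (2 * PI * (IZR z - 1) * x) with (2 * PI * IZR z * x - 2 * PI * x) by ring.
  rewrite cos_plus cos_minus sin_plus sin_minus. repeat split; ring.
Qed.

(** Multiplication by cos (2 pi (x - x0)) only moves frequencies by 1, so vanishing at all integers
    z is preserved. Allowing negative z avoids a special case at 0. *)
Lemma fourier_null_mul g c x0 : fourier_null g ->
  fourier_null (fun x => g x * (c + cos (2 * PI * (x - x0)))).
Proof.
  intros Hg z.
  destruct (Hg z) as [C0 S0], (Hg (z + 1)%Z) as [C1 S1], (Hg (z - 1)%Z) as [C2 S2].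
  set (a := cos (2 * PI * x0)). set (b := sin (2 * PI * x0)).
  split.
  - pose proof (is_RInt_null_comb _ _ 1 1 (is_RInt_null_comb _ _ c (b / 2) C0 S1)
      (is_RInt_null_comb _ _ 1 (- b / 2) (is_RInt_null_comb _ _ (a / 2) (a / 2) C1 C2) S2))
      as H.
    apply: is_RInt_ext H. intros x _.
    destruct (trig_shift z x) as (-> & -> & -> & ->).
    rewrite (Rmult_minus_distr_l (2 * PI) x x0) cos_minus. fold a b. lra.
  - pose proof (is_RInt_null_comb _ _ 1 1 (is_RInt_null_comb _ _ c (- b / 2) S0 C1)
      (is_RInt_null_comb _ _ 1 (b / 2) (is_RInt_null_comb _ _ (a / 2) (a / 2) S1 S2) C2))
      as H.
    apply: is_RInt_ext H. intros x _.
    destruct (trig_shift z x) as (-> & -> & -> & ->).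
    rewrite (Rmult_minus_distr_l (2 * PI) x x0) cos_minus. fold a b. lra.
Qed.

Lemma fourier_null_mul_pow h c x0 m : fourier_null h ->
  fourier_null (fun x => h x * (c + cos (2 * PI * (x - x0))) ^ m).
Proof.
  intros Hh; induction m as [|m IH].
  - intros z; destruct (Hh z) as [H1 H2]; split;
      [apply: is_RInt_ext H1|apply: is_RInt_ext H2]; intros x _; simpl; ring.
  - intros z; destruct (fourier_null_mul _ c x0 IH z) as [H1 H2]; split;
      [apply: is_RInt_ext H1|apply: is_RInt_ext H2]; intros x _; simpl; ring.
Qed.

Lemma cos_abs y : cos (Rabs y) = cos y.
Proof. unfold Rabs; destruct (Rcase_abs y); [apply cos_neg|easy]. Qed.

Lemma cos_ge_near d y : 0 <= d <= / 2 -> Rabs y <= d ->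
  cos (2 * PI * d) <= cos (2 * PI * y).
Proof.
  intros Hd Hy. pose proof PI_RGT_0. pose proof (Rabs_pos y).
  rewrite -(cos_abs (2 * PI * y)) Rabs_mult (Rabs_pos_eq (2 * PI)); [|lra].
  apply cos_decr_1; try nra.
Qed.

(** Past the half period, evenness and periodicity replace |y| by 1 - |y|. *)
Lemma cos_le_far d y : 0 <= d <= / 2 -> d <= Rabs y <= 1 - d ->
  cos (2 * PI * y) <= cos (2 * PI * d).
Proof.
  intros Hd Hy. pose proof PI_RGT_0.
  rewrite -(cos_abs (2 * PI * y)) Rabs_mult (Rabs_pos_eq (2 * PI)); [|lra].
  destruct (Rle_lt_dec (Rabs y) (/ 2)).
  - apply cos_decr_1; nra.
  - replace (2 * PI * Rabs y) with (- (2 * PI * (1 - Rabs y)) + 2 * PI) by ring.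
    replace (cos (- (2 * PI * (1 - Rabs y)) + 2 * PI)) with
      (cos (- (2 * PI * (1 - Rabs y)))).
    2:{ rewrite -(cos_period (- (2 * PI * (1 - Rabs y))) 1). f_equal. simpl. ring. }
    rewrite cos_neg. apply cos_decr_1; nra.
Qed.

(* Integrating [h] against the powers of a trigonometric polynomial peaking at
   [x0] isolates the sign of [h x0]. *)
Lemma fourier_null_nonpos h x0 : (forall x, continuous h x) -> fourier_null h ->
  0 < x0 < 1 -> h x0 <= 0.
Proof.
  intros Ch Hh Hx0. apply Rnot_lt_le; intros Hpos.
  assert (Hd : exists d, 0 < d < / 2 /\ d < x0 /\ d < 1 - x0 /\
    forall x, Rabs (x - x0) <= d -> h x0 / 2 <= h x).
  { destruct (proj1 (filterlim_locally _ _) (Ch x0)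
      (mkposreal (h x0 / 2) ltac:(lra))) as [r Hr].
    pose proof (cond_pos r).
    exists (Rmin (r / 2) (Rmin (/ 4) (Rmin (x0 / 2) ((1 - x0) / 2)))).
    set (m := Rmin _ _).
    assert (m <= r / 2) by apply Rmin_l.
    assert (m <= / 4 /\ m <= x0 / 2 /\ m <= (1 - x0) / 2).
    { unfold m. repeat split;
      (eapply Rle_trans; [apply Rmin_r|]); [apply Rmin_l|..];
      (eapply Rle_trans; [apply Rmin_r|]); [apply Rmin_l|apply Rmin_r]. }
    assert (0 < m) by (unfold m; repeat apply Rmin_glb_lt; lra).
    repeat split; try lra. intros x Hx.
    assert (Hb : Rabs (h x - h x0) < h x0 / 2).
    { apply: (Hr x). change (Rabs (x - x0) < r). lra. }
    apply Rabs_def2 in Hb. lra. }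
  destruct Hd as (d & Hd & Hd0 & Hd1 & Hhd).
  (* With this c, p >= 1 within d of x0, |p| <= 1 on the rest of [0, 1], and p >= r > 1 within d/2.
     The integral of h p^m over the inner interval grows at least like r^m, the remainder is bounded
     below independently of m, and yet the total is 0. *)
  set (c := 1 - cos (2 * PI * d)).
  set (p := fun x => c + cos (2 * PI * (x - x0))).
  set (r := c + cos (2 * PI * (d / 2))).
  pose proof PI_RGT_0.
  assert (Hr : 1 < r).
  { unfold r, c. assert (cos (2 * PI * d) < cos (2 * PI * (d / 2)));
      [apply cos_decreasing_1; nra|lra]. }
  assert (Hp1 : forall x, Rabs (x - x0) <= d -> 1 <= p x).
  { intros x Hx. pose proof (cos_ge_near d (x - x0) ltac:(lra) Hx).
    unfold p, c; lra. }
  assert (Hp2 : forall x, 0 <= x <= 1 -> d <= Rabs (x - x0) -> Rabs (p x) <= 1).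
  { intros x Hx Hxd.
    assert (Rabs (x - x0) <= 1 - d) by (apply Rabs_le; lra).
    pose proof (cos_le_far d (x - x0) ltac:(lra) ltac:(lra)).
    pose proof (COS_bound (2 * PI * (x - x0))). pose proof (COS_bound (2 * PI * d)).
    unfold p, c; apply Rabs_le; lra. }
  assert (Hlow : forall m x, 0 <= x <= 1 -> - Rabs (h x) <= h x * p x ^ m).
  { intros m x Hx. pose proof (Rabs_pos (h x)).
    destruct (Rle_lt_dec (Rabs (x - x0)) d) as [Hc|Hc].
    - pose proof (Hhd x Hc). pose proof (Hp1 x Hc).
      pose proof (pow_R1_Rle (p x) m ltac:(lra)). nra.
    - pose proof (Hp2 x Hx ltac:(lra)) as Hb.
      assert (Hm : Rabs (p x) ^ m <= 1).
      { rewrite -(pow1 m). apply pow_incr. split; auto. apply Rabs_pos. }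
      rewrite RPow_abs in Hm.
      assert (Rabs (h x * p x ^ m) <= Rabs (h x)).
      { rewrite Rabs_mult. pose proof (Rabs_pos (p x ^ m)). nra. }
      pose proof (Rle_abs (- (h x * p x ^ m))) as Hn. rewrite Rabs_Ropp in Hn. lra. }
  set (a := x0 - d / 2). set (b := x0 + d / 2).
  assert (Cp : forall m x, continuous (fun x => h x * p x ^ m) x).
  { intros m x. apply continuous_Rmult; auto.
    apply: ex_derive_continuous. unfold p. auto_derive; auto. }
  assert (Ca : forall x, continuous (fun x => - Rabs (h x)) x).
  { intros x. apply: continuous_opp. now apply continuous_Rabs_comp. }
  set (K := - RInt (fun x => - Rabs (h x)) 0 a - RInt (fun x => - Rabs (h x)) b 1).
  assert (Hm : forall m, d * (h x0 / 2 * r ^ m) <= K).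
  { intros m.
    assert (H0 : RInt (fun x => h x * p x ^ m) 0 1 = 0).
    { apply is_RInt_unique_R.
      apply: is_RInt_ext (proj1 (fourier_null_mul_pow h c x0 m Hh 0%Z)).
      intros x _. unfold cosz, p. rewrite Rmult_0_r Rmult_0_l cos_0.
      apply Rmult_1_r. }
    rewrite -(RInt_Chasles _ 0 a 1) -?(RInt_Chasles _ a b 1) in H0;
      try (now apply ex_RInt_everywhere).
    rewrite /plus /= in H0.
    assert (I1 : RInt (fun x => - Rabs (h x)) 0 a <= RInt (fun x => h x * p x ^ m) 0 a).
    { apply RInt_le; try (now apply ex_RInt_everywhere); [unfold a; lra|].
      unfold a; intros x Hx; apply Hlow; lra. }
    assert (I2 : RInt (fun x => - Rabs (h x)) b 1 <= RInt (fun x => h x * p x ^ m) b 1).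
    { apply RInt_le; try (now apply ex_RInt_everywhere); [unfold b; lra|].
      unfold b; intros x Hx; apply Hlow; lra. }
    assert (I3 : RInt (fun _ => h x0 / 2 * r ^ m) a b <= RInt (fun x => h x * p x ^ m) a b).
    { apply RInt_le; try (apply ex_RInt_everywhere; auto; intros; apply: continuous_const);
        [unfold a, b; lra|].
      unfold a, b; intros x Hx.
      assert (Hxd : Rabs (x - x0) <= d / 2) by (apply Rabs_le; lra).
      apply Rmult_le_compat; [lra|apply pow_le; lra|apply Hhd; lra|].
      apply pow_incr. split; [lra|].
      pose proof (cos_ge_near (d / 2) (x - x0) ltac:(lra) Hxd).
      unfold r, p; lra. }
    rewrite RInt_const /scal /= /mult /= in I3. unfold a at 1, b at 1 in I3.
    unfold K. replace (x0 + d / 2 - (x0 - d / 2)) with d in I3 by field. lra. }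
  set (A := d * (h x0 / 2)) in *.
  assert (HA : 0 < A) by (unfold A; apply Rmult_lt_0_compat; lra).
  destruct (Pow_x_infinity r ltac:(rewrite Rabs_pos_eq; lra) (K / A + 1)) as [N HN].
  specialize (HN N (le_n N)). specialize (Hm N).
  rewrite Rabs_pos_eq in HN; [|apply pow_le; lra].
  apply Rge_le in HN. apply (Rmult_le_compat_l A) in HN; [|lra].
  replace (A * (K / A + 1)) with (K + A) in HN by (field; lra).
  unfold A in *; lra.
Qed.

Lemma fourier_null_0 h x0 : (forall x, continuous h x) -> fourier_null h ->
  0 < x0 < 1 -> h x0 = 0.
Proof.
  intros Ch Hh Hx0. apply Rle_antisym; [now apply fourier_null_nonpos|].
  assert (- h x0 <= 0); [|lra].
  apply (fourier_null_nonpos (fun x => - h x)); auto.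
  - intros x; apply: continuous_opp; auto.
  - intros z; destruct (Hh z) as [H1 H2].
    split; [pose proof (is_RInt_null_comb _ _ (-1) 0 H1 H1) as H|
            pose proof (is_RInt_null_comb _ _ (-1) 0 H2 H2) as H];
      apply: is_RInt_ext H; intros x _; simpl; ring.
Qed.

(** * Series in normed modules *)

Lemma minus_plus_plus {G : AbelianGroup} (a b c d : G) :
  minus (plus a b) (plus c d) = plus (minus a c) (minus b d).
Proof.
  unfold minus. rewrite opp_plus -!plus_assoc. f_equal.
  rewrite !plus_assoc (plus_comm b) //.
Qed.

Lemma minus_plus_swap {G : AbelianGroup} (a b c : G) :
  plus (plus (minus a b) c) zero = minus (plus c a) b.
Proof.
  rewrite plus_zero_r plus_comm. unfold minus. apply plus_assoc.
Qed.

Lemma sum_n_minus {G : AbelianGroup} (f g : nat -> G) N :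
  sum_n (fun n => minus (f n) (g n)) N = minus (sum_n f N) (sum_n g N).
Proof.
  induction N as [|N IH]; [now rewrite !sum_O|].
  rewrite !sum_Sn minus_plus_plus IH //.
Qed.

Lemma filterlim_minus {T : Type} {K : AbsRing} {V : NormedModule K}
    {F : (T -> Prop) -> Prop} {FF : Filter F} (f g : T -> V) (l m : V) :
  filterlim f F (locally l) -> filterlim g F (locally m) ->
  filterlim (fun t => minus (f t) (g t)) F (locally (minus l m)).
Proof.
  intros Hf Hg. unfold minus.
  eapply filterlim_comp_2; [exact Hf| |apply (filterlim_plus (V := V))].
  eapply filterlim_comp; [exact Hg|apply (filterlim_opp (V := V))].
Qed.

Lemma partial_sum_le (c : nat -> R) m N : (forall n, 0 <= c n) ->
  is_series c m -> sum_n c N <= m.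
Proof.
  intros Hc Hm. apply (is_lim_seq_incr_compare (sum_n c) m); auto.
  intros n; rewrite sum_Sn /plus /=. specialize (Hc (S n)); lra.
Qed.

Lemma norm_sum_n_le {K : AbsRing} {V : NormedModule K} (f : nat -> V) (c : nat -> R) N :
  (forall n, norm (f n) <= c n) -> norm (sum_n f N) <= sum_n c N.
Proof.
  intros H; induction N as [|N IH]; [rewrite !sum_O; auto|].
  rewrite !sum_Sn. eapply Rle_trans; [apply norm_triangle|].
  apply Rplus_le_compat; auto.
Qed.

Lemma norm_series_tail {K : AbsRing} {V : NormedModule K} (f : nat -> V) (c : nat -> R) l m N :
  (forall n, norm (f n) <= c n) -> is_series f l -> is_series c m ->
  norm (minus l (sum_n f N)) <= m - sum_n c N.
Proof.
  intros Hfc Hf Hc.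
  assert (Hc0 : forall n, 0 <= c n).
  { intros n; apply Rle_trans with (norm (f n)); [apply norm_ge_0|apply Hfc]. }
  assert (H : forall k, norm (minus (sum_n f (N + k)) (sum_n f N)) <=
    sum_n c (N + k) - sum_n c N).
  { induction k as [|k IH].
    - rewrite Nat.add_0_r Rminus_diag minus_eq_zero norm_zero; lra.
    - rewrite Nat.add_succ_r !sum_Sn.
      replace (minus (plus (sum_n f (N + k)) (f (S (N + k)))) (sum_n f N)) with
        (plus (f (S (N + k))) (minus (sum_n f (N + k)) (sum_n f N))).
      2:{ unfold minus; rewrite plus_assoc (plus_comm (f _)) //. }
      eapply Rle_trans; [apply norm_triangle|]. specialize (Hfc (S (N + k))).
      rewrite /plus /=. lra. }
  apply le_epsilon; intros eps Heps.
  destruct (proj1 (filterlim_locally_ball_norm _ _) Hf (mkposreal eps Heps)) as [k Hk].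
  specialize (Hk (N + k)%nat ltac:(lia)). unfold ball_norm in Hk; simpl in Hk.
  rewrite -norm_opp opp_minus in Hk.
  rewrite (minus_trans (sum_n f (N + k))).
  eapply Rle_trans; [apply norm_triangle|].
  specialize (H k). pose proof (partial_sum_le c m (N + k) Hc0 Hc). lra.
Qed.

Lemma norm_series_le {K : AbsRing} {V : NormedModule K} (f : nat -> V) (c : nat -> R) l m :
  (forall n, norm (f n) <= c n) -> is_series f l -> is_series c m -> norm l <= m.
Proof.
  intros Hfc Hf Hc. pose proof (norm_series_tail f c l m 0 Hfc Hf Hc) as H.
  rewrite !sum_O in H. specialize (Hfc O).
  replace l with (plus (minus l (f O)) (f O)).
  - eapply Rle_trans; [apply norm_triangle|]. lra.
  - unfold minus. rewrite -plus_assoc plus_opp_l plus_zero_r //.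
Qed.

Lemma linear_sum_n {K : AbsRing} {V W : NormedModule K} (X : V -> W) (f : nat -> V) N :
  is_linear X -> X (sum_n f N) = sum_n (fun n => X (f n)) N.
Proof.
  intros HX; induction N as [|N IH]; [rewrite !sum_O; auto|].
  rewrite !sum_Sn -IH. now apply linear_plus.
Qed.

Lemma linear_series {K : AbsRing} {V W : NormedModule K} (X : V -> W) (f : nat -> V) l :
  is_linear X -> is_series f l -> is_series (fun n => X (f n)) (X l).
Proof.
  intros HX Hf. unfold is_series.
  apply filterlim_ext with (fun N => X (sum_n f N)).
  - intros; now apply linear_sum_n.
  - eapply filterlim_comp; [exact Hf|]. now apply linear_cont.
Qed.

Lemma is_series_unique' {K : AbsRing} {V : NormedModule K} (f : nat -> V) l m :
  is_series f l -> is_series f m -> l = m.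
Proof. apply filterlim_locally_unique. Qed.

Lemma sum_n_single {G : AbelianMonoid} (f : nat -> G) m N : (m <= N)%nat ->
  (forall n, n <> m -> f n = zero) -> sum_n f N = f m.
Proof.
  intros HmN Hf. assert (H0 : forall n, (n < m)%nat -> sum_n f n = zero).
  { induction n as [|n IH]; intros Hn; [rewrite sum_O; apply Hf; lia|].
    rewrite sum_Sn IH; [|lia]. rewrite plus_zero_l; apply Hf; lia. }
  induction N as [|N IH].
  - rewrite sum_O; f_equal; lia.
  - rewrite sum_Sn. destruct (Nat.eq_dec m (S N)) as [->|Hn].
    + rewrite H0; [|lia]. apply plus_zero_l.
    + rewrite IH; [|lia]. rewrite (Hf (S N)); [|lia]. apply plus_zero_r.
Qed.

Lemma is_series_single {K : AbsRing} {V : NormedModule K} (f : nat -> V) m :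
  (forall n, n <> m -> f n = zero) -> is_series f (f m).
Proof.
  intros Hf. apply filterlim_ext_loc with (fun _ => f m); [|apply filterlim_const].
  exists m; intros N HN; symmetry; now apply sum_n_single.
Qed.

Lemma is_linear_plus_op {K : AbsRing} {V W : NormedModule K} (X Y : V -> W) :
  is_linear X -> is_linear Y -> is_linear (fun v => plus (X v) (Y v)).
Proof.
  intros HX HY.
  apply (is_linear_comp (fun v => (X v, Y v)) (fun t => plus (fst t) (snd t))).
  - now apply is_linear_prod.
  - apply is_linear_plus.
Qed.

Lemma is_linear_opp_op {K : AbsRing} {V W : NormedModule K} (X : V -> W) :
  is_linear X -> is_linear (fun v => opp (X v)).
Proof. intros; apply is_linear_comp; auto. apply is_linear_opp. Qed.

Lemma is_linear_minus_op {K : AbsRing} {V W : NormedModule K} (X Y : V -> W) :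
  is_linear X -> is_linear Y -> is_linear (fun v => minus (X v) (Y v)).
Proof. intros; apply is_linear_plus_op; auto. now apply is_linear_opp_op. Qed.

Lemma is_linear_sum_n_op {K : AbsRing} {V W : NormedModule K} (X : nat -> V -> W) N :
  (forall n, is_linear (X n)) -> is_linear (fun v => sum_n (fun n => X n v) N).
Proof.
  intros HX; induction N as [|N IH].
  - apply is_linear_ext with (X O); auto. intros; now rewrite sum_O.
  - apply is_linear_ext with (fun v => plus (sum_n (fun n => X n v) N) (X (S N) v)).
    + intros; now rewrite sum_Sn.
    + now apply is_linear_plus_op.
Qed.

(** * Rapidly decaying sequences and trigonometric series *)

Definition rapid (s : nat -> R) : Prop :=
  forall M, exists B, forall n, (1 + INR n) ^ M * Rabs (s n) <= B.

Lemma one_plus_INR_pos n : 0 < 1 + INR n.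
Proof. pose proof (pos_INR n); lra. Qed.

Lemma one_plus_INR_ge1 n : 1 <= 1 + INR n.
Proof. pose proof (pos_INR n); lra. Qed.

(** Comparison with a telescoping series: 1/(n+1)^2 <= 2 (1/(n+1) - 1/(n+2)). *)
Lemma ex_series_inv_sq : ex_series (fun n => / (1 + INR n) ^ 2).
Proof.
  apply: (ex_series_le _ (fun n => 2 * (/ (1 + INR n) - / (1 + INR (S n))))).
  - intros n. pose proof (pos_INR n). rewrite S_INR.
    rewrite /norm /= /abs /= Rabs_pos_eq.
    2:{ left; apply Rinv_0_lt_compat; nra. }
    apply Rminus_le.
    replace (_ - _) with (- (INR n) * / (1 + INR n) ^ 2 * / (1 + (INR n + 1)))
      by (field; lra).
    assert (0 < / (1 + INR n) ^ 2) by (apply Rinv_0_lt_compat; nra).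
    assert (0 < / (1 + (INR n + 1))) by (apply Rinv_0_lt_compat; lra).
    assert (0 <= INR n * / (1 + INR n) ^ 2 * / (1 + (INR n + 1)))
      by (repeat apply Rmult_le_pos; lra).
    lra.
  - apply: (ex_series_scal_l 2). exists 1.
    change (is_lim_seq (sum_n (fun n => / (1 + INR n) - / (1 + INR (S n)))) 1).
    apply (is_lim_seq_ext (fun n => 1 - / (1 + INR (S n)))).
    { induction n as [|n IH].
      - rewrite sum_O /=. field.
      - rewrite sum_Sn -IH /plus /=. ring. }
    assert (H0 : is_lim_seq (fun n => / (1 + INR (S n))) 0).
    { apply: (is_lim_seq_inv _ p_infty); [|easy].
      apply: (is_lim_seq_plus _ _ 1 p_infty); [apply is_lim_seq_const| |easy].
      apply -> is_lim_seq_incr_1. apply is_lim_seq_INR. }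
    pose proof (is_lim_seq_minus' _ _ 1 0 (is_lim_seq_const 1) H0) as H1.
    rewrite Rminus_0_r in H1. exact H1.
Qed.

Lemma rapid_bound s M : rapid s ->
  exists B, 0 < B /\ forall n, (1 + INR n) ^ M * Rabs (s n) <= B.
Proof.
  intros Hs; destruct (Hs M) as [B HB]. exists (B + 1); split.
  - specialize (HB O). pose proof (Rabs_pos (s O)).
    pose proof (pow_lt _ M (one_plus_INR_pos 0)). nra.
  - intros n; specialize (HB n); lra.
Qed.

Lemma rapid_ext s t : (forall n, s n = t n) -> rapid s -> rapid t.
Proof.
  intros Hst Hs M; destruct (Hs M) as [B HB]; exists B; intros n.
  rewrite -Hst; auto.
Qed.

Lemma rapid_le s t K p : 0 <= K ->
  (forall n, Rabs (t n) <= K * (1 + INR n) ^ p * Rabs (s n)) ->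
  rapid s -> rapid t.
Proof.
  intros HK Hst Hs M; destruct (Hs (M + p)%nat) as [B HB].
  exists (K * B); intros n.
  pose proof (pow_lt _ M (one_plus_INR_pos n)).
  specialize (HB n); rewrite pow_add in HB.
  apply Rle_trans with (K * ((1 + INR n) ^ M * (1 + INR n) ^ p * Rabs (s n))).
  - specialize (Hst n).
    replace (K * ((1 + INR n) ^ M * (1 + INR n) ^ p * Rabs (s n))) with
      ((1 + INR n) ^ M * (K * (1 + INR n) ^ p * Rabs (s n))) by ring.
    apply Rmult_le_compat_l; lra.
  - apply Rmult_le_compat_l; auto.
Qed.

Lemma rapid_INR c s : rapid s -> rapid (fun n => c * INR n * s n).
Proof.
  apply (rapid_le _ _ (Rabs c) 1 (Rabs_pos c)). intros n.
  rewrite !Rabs_mult (Rabs_pos_eq (INR n)); [|apply pos_INR].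
  pose proof (Rabs_pos (s n)); pose proof (Rabs_pos c); pose proof (pos_INR n).
  rewrite pow_1. apply Rmult_le_compat_r; auto. apply Rmult_le_compat_l; lra.
Qed.

(** Two extra powers of decay turn a bound into a summable majorant. *)
Lemma rapid_inv_sq s p : rapid s -> exists B, 0 < B /\
  forall n, (1 + INR n) ^ p * Rabs (s n) <= B * / (1 + INR n) ^ 2.
Proof.
  intros Hs; destruct (rapid_bound s (2 + p) Hs) as [B [HB0 HB]].
  exists B; split; auto. intros n; specialize (HB n).
  assert (H2 : 0 < (1 + INR n) ^ 2) by (apply pow_lt, one_plus_INR_pos).
  apply Rmult_le_reg_l with ((1 + INR n) ^ 2); auto.
  rewrite -Rmult_assoc -pow_add. eapply Rle_trans; [exact HB|].
  right; pose proof (one_plus_INR_pos n); field; lra.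
Qed.

Lemma rapid_ex_series s p : rapid s ->
  ex_series (fun n => (1 + INR n) ^ p * Rabs (s n)).
Proof.
  intros Hs; destruct (rapid_inv_sq s p Hs) as [B [HB0 HB]].
  apply: (ex_series_le _ (fun n => B * / (1 + INR n) ^ 2)).
  - intros n. rewrite /norm /= /abs /= Rabs_pos_eq; [apply HB|].
    apply Rmult_le_pos; [apply pow_le; left; apply one_plus_INR_pos|apply Rabs_pos].
  - apply: (ex_series_scal_l B). apply ex_series_inv_sq.
Qed.

Lemma rapid_ex_series_Rabs s : rapid s -> ex_series (fun n => Rabs (s n)).
Proof.
  intros Hs. apply: (ex_series_ext (fun n => (1 + INR n) ^ 0 * Rabs (s n))).
  - intros n; simpl; ring.
  - now apply rapid_ex_series.
Qed.

Lemma ex_series_Rabs_le (f b : nat -> R) :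
  (forall k, Rabs (f k) <= b k) -> ex_series b -> ex_series f.
Proof. intros H1 H2; apply: ex_series_le H2; exact H1. Qed.

Lemma series_tail (b : nat -> R) : ex_series b -> forall eps : posreal,
  eventually (fun N => Rabs (Series b - sum_n b N) < eps).
Proof.
  intros Hb eps. apply Series_correct in Hb.
  destruct (proj1 (filterlim_locally _ _) Hb eps) as [N HN].
  exists N; intros n Hn. rewrite Rabs_minus_sym. apply (HN n Hn).
Qed.

Lemma is_series_le_bound (f b : nat -> R) l m N :
  (forall k, Rabs (f k) <= b k) -> is_series f l -> is_series b m ->
  Rabs (l - sum_n f N) <= m - sum_n b N.
Proof. exact (norm_series_tail (V := R_NormedModule) f b l m N). Qed.

Lemma CVU_weierstrass (f : nat -> R -> R) (b : nat -> R) :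
  (forall n x, Rabs (f n x) <= b n) -> ex_series b ->
  CVU_dom (fun N x => sum_n (fun n => f n x) N) everywhere.
Proof.
  intros Hfb Hb eps. destruct (series_tail b Hb eps) as [N HN].
  exists N; intros n Hn x _. specialize (HN n Hn).
  assert (Hf : ex_series (fun n => f n x)) by (apply: ex_series_Rabs_le Hb; auto).
  pose proof (is_series_le_bound (fun n => f n x) b _ _ n
    (fun k => Hfb k x) (Series_correct _ Hf) (Series_correct _ Hb)) as H.
  rewrite Rabs_minus_sym. unfold Series in H.
  eapply Rle_lt_trans; [exact H|]. apply Rabs_lt_between in HN. apply HN.
Qed.

Definition trig_term (al be : nat -> R) (n : nat) (x : R) : R :=
  al n * cosz (Z.of_nat n) x + be n * sinz (Z.of_nat n) x.

Definition trig (al be : nat -> R) (x : R) : R :=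
  Series (fun n => trig_term al be n x).

Lemma trig_term_bound al be n x :
  Rabs (trig_term al be n x) <= Rabs (al n) + Rabs (be n).
Proof.
  unfold trig_term. eapply Rle_trans; [apply Rabs_triang|].
  rewrite !Rabs_mult.
  assert (Rabs (cosz (Z.of_nat n) x) <= 1) by (apply Rabs_le, COS_bound).
  assert (Rabs (sinz (Z.of_nat n) x) <= 1) by (apply Rabs_le, SIN_bound).
  pose proof (Rabs_pos (al n)); pose proof (Rabs_pos (be n)). nra.
Qed.

Lemma ex_series_trig_bound al be : rapid al -> rapid be ->
  ex_series (fun n => Rabs (al n) + Rabs (be n)).
Proof. intros; apply: ex_series_plus; now apply rapid_ex_series_Rabs. Qed.

Lemma is_series_trig al be x : rapid al -> rapid be ->
  is_series (fun n => trig_term al be n x) (trig al be x).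
Proof.
  intros Ha Hb. apply Series_correct.
  apply: ex_series_Rabs_le (ex_series_trig_bound _ _ Ha Hb).
  intros; apply trig_term_bound.
Qed.

Lemma trig_uniform al be : rapid al -> rapid be -> forall eps : posreal,
  eventually (fun N => forall x,
    Rabs (trig al be x - sum_n (fun n => trig_term al be n x) N) < eps).
Proof.
  intros Ha Hb eps.
  destruct (CVU_weierstrass (trig_term al be) _ (trig_term_bound al be)
    (ex_series_trig_bound _ _ Ha Hb) eps) as [N HN].
  exists N; intros n Hn x. rewrite Rabs_minus_sym. exact (HN n Hn x I).
Qed.

Lemma is_derive_trig_term al be n x :
  is_derive (trig_term al be n) x
    (trig_term (fun n => 2 * PI * INR n * be n) (fun n => - (2 * PI) * INR n * al n) n x).
Proof.
  evar_last.
  { apply: is_derive_plus; apply: is_derive_scal; [apply is_derive_cosz|apply is_derive_sinz]. }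
  rewrite -INR_IZR_INZ /plus /= /trig_term. ring.
Qed.

Lemma is_derive_trig_sum al be N x :
  is_derive (fun x => sum_n (fun n => trig_term al be n x) N) x
    (sum_n (fun n => trig_term (fun n => 2 * PI * INR n * be n)
      (fun n => - (2 * PI) * INR n * al n) n x) N).
Proof. apply: is_derive_sum_n; intros; apply is_derive_trig_term. Qed.

(** Differentiation multiplies the coefficients by n, up to a constant, and exchanges sines with
    cosines. They stay rapid, so the differentiated series converges uniformly, and [Cinf_trig] is
    an induction on the order. *)
Lemma is_derive_trig al be x : rapid al -> rapid be ->
  is_derive (trig al be) x
    (trig (fun n => 2 * PI * INR n * be n) (fun n => - (2 * PI) * INR n * al n) x).
Proof.
  intros Ha Hb.
  set (al' := fun n => 2 * PI * INR n * be n).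
  set (be' := fun n => - (2 * PI) * INR n * al n).
  assert (Ha' : rapid al') by now apply rapid_INR.
  assert (Hb' : rapid be') by now apply rapid_INR.
  assert (HD : forall N x, Derive (fun x => sum_n (fun n => trig_term al be n x) N) x =
    sum_n (fun n => trig_term al' be' n x) N).
  { intros; apply is_derive_unique, is_derive_trig_sum. }
  pose proof (CVU_Derive (fun N x => sum_n (fun n => trig_term al be n x) N) everywhere)
    as H.
  evar_last; [apply H|]; try easy.
  - apply open_everywhere.
  - apply CVU_weierstrass with (fun n => Rabs (al n) + Rabs (be n)).
    + intros; apply trig_term_bound.
    + now apply ex_series_trig_bound.
  - intros n y _; eexists; apply is_derive_trig_sum.
  - intros n y _. apply continuity_pt_filterlim.
    apply: (continuous_ext (fun x => sum_n (fun k => trig_term al' be' k x) n)).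
    + intros; symmetry; apply HD.
    + apply: ex_derive_continuous. eexists; apply is_derive_trig_sum.
  - intros eps.
    destruct (CVU_weierstrass (trig_term al' be') _ (trig_term_bound al' be')
      (ex_series_trig_bound _ _ Ha' Hb') eps) as [N HN].
    exists N; intros n Hn y Hy. specialize (HN n Hn y Hy). simpl in HN.
    rewrite HD (Lim_seq_ext _ (fun N => sum_n (fun n => trig_term al' be' n y) N));
      auto.
  - unfold trig, Series. f_equal. now apply Lim_seq_ext.
Qed.

Lemma Cinf_trig al be : rapid al -> rapid be -> Cinf everywhere (trig al be).
Proof.
  intros Ha Hb n; revert al be Ha Hb; induction n as [|n IH]; intros; [easy|].
  eexists; split; [intros; apply is_derive_trig; auto|].
  apply IH; now apply rapid_INR.
Qed.

Lemma cosz_period z x : cosz z (x + 1) = cosz z x.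
Proof.
  pose proof (sinz_1 z) as HS; pose proof (cosz_1 z) as HC. unfold sinz, cosz in *.
  rewrite (Rmult_plus_distr_l (2 * PI * IZR z)) cos_plus HS HC. ring.
Qed.

Lemma sinz_period z x : sinz z (x + 1) = sinz z x.
Proof.
  pose proof (sinz_1 z) as HS; pose proof (cosz_1 z) as HC. unfold sinz, cosz in *.
  rewrite (Rmult_plus_distr_l (2 * PI * IZR z)) sin_plus HS HC. ring.
Qed.

Lemma trig_period al be x : trig al be (x + 1) = trig al be x.
Proof.
  unfold trig; apply Series_ext; intros n.
  unfold trig_term; now rewrite cosz_period sinz_period.
Qed.

Lemma is_RInt_cosz z : is_RInt (cosz z) 0 1 (if Z.eq_dec z 0 then 1 else 0).
Proof.
  destruct (Z.eq_dec z 0) as [->|Hz].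
  - apply: (is_RInt_ext (fun _ => 1)).
    { intros x _; unfold cosz; rewrite Rmult_0_r Rmult_0_l cos_0; auto. }
    evar_last; [apply: is_RInt_const|]. rewrite /scal /= /mult /=; ring.
  - pose proof PI_RGT_0. apply eq_IZR_contrapositive in Hz.
    evar_last.
    { apply: (is_RInt_derive (fun x => / (2 * PI * IZR z) * sinz z x)).
      - intros x _. evar_last; [apply: is_derive_scal; apply is_derive_sinz|].
        field; split; lra || auto.
      - intros; apply continuous_cosz. }
    cbv beta; rewrite sinz_1 sinz_0. apply: minus_eq_zero.
Qed.

Lemma is_RInt_sinz z : is_RInt (sinz z) 0 1 0.
Proof.
  destruct (Z.eq_dec z 0) as [->|Hz].
  - apply: (is_RInt_ext (fun _ => 0)).
    { intros x _; unfold sinz; rewrite Rmult_0_r Rmult_0_l sin_0; auto. }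
    evar_last; [apply: is_RInt_const|]. rewrite /scal /= /mult /=; ring.
  - pose proof PI_RGT_0. apply eq_IZR_contrapositive in Hz.
    evar_last.
    { apply: (is_RInt_derive (fun x => - / (2 * PI * IZR z) * cosz z x)).
      - intros x _. evar_last; [apply: is_derive_scal; apply is_derive_cosz|].
        field; split; lra || auto.
      - intros; apply continuous_sinz. }
    cbv beta; rewrite cosz_1 cosz_0. apply: minus_eq_zero.
Qed.

Lemma trig_products m n x :
  cosz m x * cosz n x = / 2 * cosz (m + n) x + / 2 * cosz (m - n) x /\
  sinz m x * sinz n x = / 2 * cosz (m - n) x + - / 2 * cosz (m + n) x /\
  sinz m x * cosz n x = / 2 * sinz (m + n) x + / 2 * sinz (m - n) x.
Proof.
  unfold cosz, sinz. rewrite plus_IZR minus_IZR.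
  replace (2 * PI * (IZR m + IZR n) * x) with
    (2 * PI * IZR m * x + 2 * PI * IZR n * x) by ring.
  replace (2 * PI * (IZR m - IZR n) * x) with
    (2 * PI * IZR m * x - 2 * PI * IZR n * x) by ring.
  rewrite cos_plus cos_minus sin_plus sin_minus. repeat split; field.
Qed.

Lemma is_RInt_comb (f g : R -> R) p q l m :
  is_RInt f 0 1 l -> is_RInt g 0 1 m ->
  is_RInt (fun x => p * f x + q * g x) 0 1 (p * l + q * m).
Proof.
  intros Hf Hg.
  exact (is_RInt_plus _ _ _ _ _ _ (is_RInt_scal _ _ _ p _ Hf)
    (is_RInt_scal _ _ _ q _ Hg)).
Qed.

(** The mean of cos (2 pi m x)^2 over a period; [1 - half_weight m] is that of sin (2 pi m x)^2.
    This absorbs the exceptional case m = 0. *)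
Definition half_weight (m : nat) : R := match m with O => 1 | S _ => / 2 end.

Lemma is_RInt_trig_term al be n m :
  is_RInt (fun x => trig_term al be n x * cosz (Z.of_nat m) x) 0 1
    (if Nat.eq_dec n m then half_weight m * al m else 0) /\
  is_RInt (fun x => trig_term al be n x * sinz (Z.of_nat m) x) 0 1
    (if Nat.eq_dec n m then (1 - half_weight m) * be m else 0).
Proof.
  set (N := Z.of_nat n); set (M := Z.of_nat m). split.
  - evar_last.
    { apply: is_RInt_ext.
      2:{ apply (is_RInt_comb _ _ (al n) (be n)
            _ _ (is_RInt_comb _ _ (/ 2) (/ 2) _ _ (is_RInt_cosz (N + M)) (is_RInt_cosz (N - M)))
            (is_RInt_comb _ _ (/ 2) (/ 2) _ _ (is_RInt_sinz (N + M)) (is_RInt_sinz (N - M)))). }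
      intros x _. simpl. destruct (trig_products N M x) as (<- & _ & <-).
      unfold trig_term; fold N; ring. }
    destruct (Nat.eq_dec n m) as [->|Hnm];
      destruct (Z.eq_dec (N + M) 0), (Z.eq_dec (N - M) 0); unfold N, M in *; try lia.
    + assert (m = 0)%nat as -> by lia. simpl; field.
    + destruct m; [lia|]. simpl; field.
    + ring.
  - evar_last.
    { apply: is_RInt_ext.
      2:{ apply (is_RInt_comb _ _ (be n) (al n)
            _ _ (is_RInt_comb _ _ (/ 2) (- / 2) _ _ (is_RInt_cosz (N - M)) (is_RInt_cosz (N + M)))
            (is_RInt_comb _ _ (/ 2) (/ 2) _ _ (is_RInt_sinz (M + N)) (is_RInt_sinz (M - N)))). }
      intros x _. simpl. destruct (trig_products N M x) as (_ & <- & _).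
      destruct (trig_products M N x) as (_ & _ & <-).
      unfold trig_term; fold N; ring. }
    destruct (Nat.eq_dec n m) as [->|Hnm];
      destruct (Z.eq_dec (N + M) 0), (Z.eq_dec (N - M) 0); unfold N, M in *; try lia.
    + assert (m = 0)%nat as -> by lia. simpl; field.
    + destruct m; [lia|]. simpl; field.
    + ring.
Qed.

Lemma sum_n_delta m (v : R) N :
  sum_n (fun n => if Nat.eq_dec n m then v else 0) N = if le_dec m N then v else 0.
Proof.
  induction N as [|N IH].
  - rewrite sum_O. destruct (Nat.eq_dec 0 m), (le_dec m 0); auto; lia.
  - rewrite sum_Sn IH.
    destruct (Nat.eq_dec (S N) m), (le_dec m N),
      (le_dec m (S N)); try lia; rewrite /plus /=; ring.
Qed.

Lemma is_RInt_sum_mul (t : nat -> R -> R) (c : R -> R) (l : nat -> R) N :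
  (forall n, is_RInt (fun x => t n x * c x) 0 1 (l n)) ->
  is_RInt (fun x => sum_n (fun n => t n x) N * c x) 0 1 (sum_n l N).
Proof.
  intros H; induction N as [|N IH].
  - rewrite sum_O. apply: is_RInt_ext (H O). intros x _; rewrite sum_O; auto.
  - rewrite sum_Sn.
    apply: is_RInt_ext (is_RInt_plus _ _ _ _ _ _ IH (H (S N))).
    intros x _; rewrite sum_Sn /plus /=. ring.
Qed.

(** By orthogonality the partial sums of a trigonometric series eventually have integral exactly l
    against a fixed mode. Uniform convergence is thus needed only to compare [u] with a single
    partial sum. *)
Lemma RInt_uniform_limit (u c : R -> R) (S : nat -> R -> R) (l : R) :
  (forall x, continuous u x) -> (forall x, continuous c x) ->
  (forall x, Rabs (c x) <= 1) ->
  (forall eps : posreal, eventually (fun N => forall x, Rabs (u x - S N x) < eps)) ->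
  eventually (fun N => (forall x, continuous (S N) x) /\
    is_RInt (fun x => S N x * c x) 0 1 l) ->
  RInt (fun x => u x * c x) 0 1 = l.
Proof.
  intros Cu Cc Hc Hu HS.
  assert (H : forall eps : posreal, Rabs (RInt (fun x => u x * c x) 0 1 - l) <= eps).
  { intros eps. destruct (Hu eps) as [N1 H1], HS as [N2 H2].
    set (N := (N1 + N2)%nat).
    specialize (H1 N ltac:(unfold N; lia)). specialize (H2 N ltac:(unfold N; lia)).
    destruct H2 as [CS H2].
    rewrite -(is_RInt_unique_R _ _ _ _ H2).
    assert (E : RInt (fun x => minus (u x * c x) (S N x * c x)) 0 1 =
      RInt (fun x => u x * c x) 0 1 - RInt (fun x => S N x * c x) 0 1).
    { apply: RInt_minus; apply ex_RInt_everywhere; intros; now apply continuous_Rmult. }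
    rewrite -E.
    replace (pos eps) with (RInt (fun _ => pos eps) 0 1)
      by (rewrite RInt_const /scal /= /mult /=; ring).
    apply Rabs_RInt_le; [lra| | |].
    - intros x; apply: continuous_minus; now apply continuous_Rmult.
    - intros x; apply: continuous_const.
    - intros x. rewrite /minus /plus /opp /=.
      replace (u x * c x + - (S N x * c x)) with ((u x - S N x) * c x) by ring.
      rewrite Rabs_mult. specialize (H1 x). specialize (Hc x).
      pose proof (Rabs_pos (u x - S N x)); pose proof (Rabs_pos (c x)).
      assert (Rabs (u x - S N x) * Rabs (c x) <= Rabs (u x - S N x) * 1)
        by (apply Rmult_le_compat_l; lra). lra. }
  apply Rminus_diag_uniq.
  destruct (Req_dec (RInt (fun x => u x * c x) 0 1 - l) 0) as [|Hn]; auto.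
  assert (Hp := Rabs_pos_lt _ Hn).
  specialize (H (mkposreal _ (is_pos_div_2 (mkposreal _ Hp)))). simpl in H. lra.
Qed.

Lemma trig_sum_continuous al be N x :
  continuous (fun x => sum_n (fun n => trig_term al be n x) N) x.
Proof. apply: ex_derive_continuous; eexists; apply is_derive_trig_sum. Qed.

Lemma trig_coef al be m : rapid al -> rapid be ->
  RInt (fun x => trig al be x * cosz (Z.of_nat m) x) 0 1 = half_weight m * al m /\
  RInt (fun x => trig al be x * sinz (Z.of_nat m) x) 0 1 = (1 - half_weight m) * be m.
Proof.
  intros Ha Hb.
  assert (Ct : forall x, continuous (trig al be) x).
  { intros x; apply (Cinf_continuous everywhere); [now apply Cinf_trig|easy]. }
  split; apply: (RInt_uniform_limit _ _
    (fun N x => sum_n (fun n => trig_term al be n x) N)); auto;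
    try (apply continuous_cosz || apply continuous_sinz);
    try (intros; apply Rabs_le; apply COS_bound || apply SIN_bound);
    try (now apply trig_uniform).
  - exists m; intros N HN; split; [intros; apply trig_sum_continuous|].
    evar_last; [apply: is_RInt_sum_mul; intros n; apply (is_RInt_trig_term al be n m)|].
    simpl. rewrite (sum_n_delta m). destruct (le_dec m N); [easy|lia].
  - exists m; intros N HN; split; [intros; apply trig_sum_continuous|].
    evar_last; [apply: is_RInt_sum_mul; intros n; apply (is_RInt_trig_term al be n m)|].
    simpl. rewrite (sum_n_delta m). destruct (le_dec m N); [easy|lia].
Qed.

Lemma rapid_of_decay (s : nat -> R) :
  (forall M, exists B, forall n, INR n ^ M * Rabs (s n) <= B) -> rapid s.
Proof.
  intros H M; destruct (H M) as [B HB].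
  exists (Rabs (s O) + 2 ^ M * Rabs B); intros n.
  pose proof (Rabs_pos (s O)). pose proof (pow_lt 2 M ltac:(lra)).
  pose proof (Rabs_pos B).
  destruct n as [|n].
  - simpl INR. rewrite Rplus_0_r pow1. nra.
  - specialize (HB (S n)). pose proof (Rle_abs B).
    pose proof (pos_INR n).
    assert ((1 + INR (S n)) ^ M <= 2 ^ M * INR (S n) ^ M).
    { rewrite -Rpow_mult_distr. apply pow_incr. rewrite S_INR. lra. }
    apply Rle_trans with (2 ^ M * INR (S n) ^ M * Rabs (s (S n))).
    + apply Rmult_le_compat_r; [apply Rabs_pos|auto].
    + rewrite Rmult_assoc.
      apply Rle_trans with (2 ^ M * Rabs B); [|lra].
      apply Rmult_le_compat_l; lra.
Qed.

Lemma cosz_opp z x : cosz (- z) x = cosz z x.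
Proof.
  unfold cosz. rewrite opp_IZR -(cos_neg (2 * PI * IZR z * x)). f_equal; ring.
Qed.

Lemma sinz_opp z x : sinz (- z) x = - sinz z x.
Proof.
  unfold sinz. rewrite opp_IZR -(sin_neg (2 * PI * IZR z * x)). f_equal; ring.
Qed.

(** The series built from the coefficients of u has those same coefficients. The difference is
    continuous with all coefficients zero, hence vanishes at interior points of the period. *)
Lemma fourier_expansion u : Cinf everywhere u -> (forall x, u (x + 1) = u x) ->
  exists al be, rapid al /\ rapid be /\
    forall x, 0 < x < 1 -> u x = trig al be x.
Proof.
  intros Hu Hp.
  set (al := fun n => / half_weight n * RInt (fun x => u x * cosz (Z.of_nat n) x) 0 1).
  set (be := fun n => 2 * RInt (fun x => u x * sinz (Z.of_nat n) x) 0 1).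
  assert (Hhw : forall n, 1 <= / half_weight n <= 2)
    by (intros [|n]; simpl; rewrite ?Rinv_inv ?Rinv_1; lra).
  assert (Ha : rapid al).
  { apply rapid_of_decay; intros M. destruct (fourier_decay M u Hu Hp) as [B HB].
    exists (2 * B); intros n. destruct (HB (Z.of_nat n)) as [H _].
    rewrite -INR_IZR_INZ (Rabs_pos_eq (INR n)) in H; [|apply pos_INR].
    unfold al. rewrite Rabs_mult (Rabs_pos_eq (/ _)); [|specialize (Hhw n); lra].
    specialize (Hhw n).
    set (q := Rabs (RInt _ 0 1)) in *.
    assert (0 <= INR n ^ M * q) by (apply Rmult_le_pos; [apply pow_le, pos_INR|apply Rabs_pos]).
    nra. }
  assert (Hb : rapid be).
  { apply rapid_of_decay; intros M. destruct (fourier_decay M u Hu Hp) as [B HB].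
    exists (2 * B); intros n. destruct (HB (Z.of_nat n)) as [_ H].
    rewrite -INR_IZR_INZ (Rabs_pos_eq (INR n)) in H; [|apply pos_INR].
    unfold be. rewrite Rabs_mult (Rabs_pos_eq 2); [|lra]. lra. }
  exists al, be; split; [auto|split; [auto|]].
  intros x Hx. apply Rminus_diag_uniq.
  pose proof (fun x => Cinf_continuous _ _ Hu x I) as Cu.
  assert (Ct : forall x, continuous (trig al be) x).
  { intros y; apply (Cinf_continuous everywhere); [now apply Cinf_trig|easy]. }
  apply (fourier_null_0 (fun x => u x - trig al be x)); auto.
  { intros y; apply: continuous_minus; auto. }
  assert (Hnat : forall n,
    is_RInt (fun x => (u x - trig al be x) * cosz (Z.of_nat n) x) 0 1 0 /\
    is_RInt (fun x => (u x - trig al be x) * sinz (Z.of_nat n) x) 0 1 0).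
  { intros n. destruct (trig_coef al be n Ha Hb) as [T1 T2]. split.
    - evar_last.
      { apply: is_RInt_ext.
        2:{ apply (is_RInt_comb _ _ 1 (-1) _ _ (is_RInt_mul_cosz u (Z.of_nat n) Cu)
              (is_RInt_mul_cosz (trig al be) (Z.of_nat n) Ct)). }
        intros y _; simpl; ring. }
      simpl. rewrite T1. unfold al. field. specialize (Hhw n).
      intros H0; rewrite H0 in Hhw. rewrite Rinv_0 in Hhw; lra.
    - evar_last.
      { apply: is_RInt_ext.
        2:{ apply (is_RInt_comb _ _ 1 (-1) _ _ (is_RInt_mul_sinz u (Z.of_nat n) Cu)
              (is_RInt_mul_sinz (trig al be) (Z.of_nat n) Ct)). }
        intros y _; simpl; ring. }
      simpl. rewrite T2. unfold be. destruct n as [|n]; [|simpl; field].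
      rewrite (RInt_ext _ (fun _ => 0)).
      + rewrite RInt_const /scal /= /mult /=; ring.
      + intros y _; unfold sinz; simpl. rewrite Rmult_0_r Rmult_0_l sin_0; ring. }
  intros z. destruct (Z_le_dec 0 z) as [Hz|Hz].
  - destruct (Hnat (Z.to_nat z)) as [H1 H2]. rewrite Z2Nat.id in H1 H2; auto.
  - destruct (Hnat (Z.to_nat (- z))) as [H1 H2]. rewrite Z2Nat.id in H1 H2; [|lia].
    split.
    + apply: is_RInt_ext H1. intros y _; now rewrite cosz_opp.
    + pose proof (is_RInt_null_comb _ _ (-1) 0 H2 H2) as H3.
      apply: is_RInt_ext H3. intros y _; rewrite sinz_opp; simpl; ring.
Qed.

(** * Complex moduli and rapidly decaying sequences on the integers *)

Lemma Cmod_le_Re_Im (z : C) : Cmod z <= Rabs (Re z) + Rabs (Im z).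
Proof.
  unfold Cmod. pose proof (Rabs_pos (Re z)); pose proof (Rabs_pos (Im z)).
  apply Rsqr_incr_0_var; [|lra].
  rewrite Rsqr_sqrt; [|nra]. unfold Rsqr. fold (Re z) (Im z).
  rewrite -(pow2_abs (Re z)) -(pow2_abs (Im z)). nra.
Qed.

Lemma Rabs_Re_le (z : C) : Rabs (Re z) <= Cmod z.
Proof.
  eapply Rle_trans; [|apply Rmax_Cmod]. apply Rmax_l.
Qed.

Lemma Rabs_Im_le (z : C) : Rabs (Im z) <= Cmod z.
Proof.
  eapply Rle_trans; [|apply Rmax_Cmod]. apply Rmax_r.
Qed.

Definition rapidZ (p : Z -> C) : Prop :=
  forall M, exists B, forall z, (1 + Rabs (IZR z)) ^ M * Cmod (p z) <= B.

Lemma rapidZ_of_nat p : rapidZ p -> rapid (fun n => Cmod (p (Z.of_nat n))).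
Proof.
  intros H M; destruct (H M) as [B HB]; exists B; intros n.
  specialize (HB (Z.of_nat n)). rewrite -INR_IZR_INZ Rabs_pos_eq in HB; [|apply pos_INR].
  rewrite Rabs_pos_eq; auto. apply Cmod_ge_0.
Qed.

Lemma rapidZ_opp p : rapidZ p -> rapidZ (fun z => p (- z)%Z).
Proof.
  intros H M; destruct (H M) as [B HB]; exists B; intros z.
  specialize (HB (- z)%Z). rewrite opp_IZR Rabs_Ropp in HB. auto.
Qed.

Lemma rapidZ_of_nats p : rapid (fun n => Cmod (p (Z.of_nat n))) ->
  rapid (fun n => Cmod (p (- Z.of_nat n)%Z)) -> rapidZ p.
Proof.
  intros H1 H2 M. destruct (H1 M) as [B1 HB1], (H2 M) as [B2 HB2].
  exists (Rmax B1 B2); intros z.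
  destruct (Z_le_dec 0 z) as [Hz|Hz].
  - eapply Rle_trans; [|apply Rmax_l]. specialize (HB1 (Z.to_nat z)).
    rewrite INR_IZR_INZ Z2Nat.id in HB1; auto.
    rewrite (Rabs_pos_eq (Cmod _)) in HB1; [|apply Cmod_ge_0].
    rewrite Rabs_pos_eq; [exact HB1|now apply IZR_le].
  - eapply Rle_trans; [|apply Rmax_r]. specialize (HB2 (Z.to_nat (- z))).
    rewrite INR_IZR_INZ Z2Nat.id in HB2; [|lia].
    rewrite (Rabs_pos_eq (Cmod _)) in HB2; [|apply Cmod_ge_0].
    rewrite Z.opp_involutive opp_IZR in HB2.
    rewrite Rabs_left; [exact HB2|]. apply IZR_lt; lia.
Qed.

(** * Fourier coefficients of complex-valued functions *)

Lemma fourier_coef_eq (f : R -> C) z :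
  (forall x, continuous (fun t => Re (f t)) x) ->
  (forall x, continuous (fun t => Im (f t)) x) ->
  fourier_coef f z =
    (RInt (fun x => Re (f x) * cosz z x) 0 1 + RInt (fun x => Im (f x) * sinz z x) 0 1,
     RInt (fun x => Im (f x) * cosz z x) 0 1 - RInt (fun x => Re (f x) * sinz z x) 0 1).
Proof.
  intros Hr Hi. unfold fourier_coef.
  apply (is_RInt_unique (V := C_R_CompleteNormedModule)).
  apply (is_RInt_fct_extend_pair (U := R_NormedModule) (V := R_NormedModule)).
  - pose proof (is_RInt_comb _ _ 1 1 _ _ (is_RInt_mul_cosz _ z Hr) (is_RInt_mul_sinz _ z Hi)) as H.
    rewrite !Rmult_1_l in H.
    apply: is_RInt_ext H. intros x _. unfold cosz, sinz, Re, Im; simpl; ring.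
  - pose proof (is_RInt_comb _ _ 1 (-1) _ _ (is_RInt_mul_cosz _ z Hi) (is_RInt_mul_sinz _ z Hr)) as H.
    rewrite Rmult_1_l in H. evar_last.
    + apply: is_RInt_ext H. intros x _. unfold cosz, sinz, Re, Im; simpl; ring.
    + simpl; ring.
Qed.

Lemma smooth_on_Cinf D f : open D ->
  smooth_on D f <-> Cinf D (fun t => Re (f t)) /\ Cinf D (fun t => Im (f t)).
Proof.
  intros HD. rewrite !Cinf_ex_derive_n; auto. split.
  - intros H; split; intros n x Hx; apply (H n x Hx).
  - intros [H1 H2] n x Hx; auto.
Qed.

Lemma smooth_circle_rapid f : smooth_circle f -> rapidZ (fourier_coef f).
Proof.
  intros [Hp Hs]. apply smooth_on_Cinf in Hs; [|apply open_everywhere].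
  destruct Hs as [Hr Hi].
  assert (Hrz : forall g M, Cinf everywhere g -> (forall x, g (x + 1) = g x) ->
    exists B, forall z,
      (1 + Rabs (IZR z)) ^ M * Rabs (RInt (fun x => g x * cosz z x) 0 1) <= B /\
      (1 + Rabs (IZR z)) ^ M * Rabs (RInt (fun x => g x * sinz z x) 0 1) <= B).
  { intros g M Hg Hgp.
    destruct (fourier_decay M g Hg Hgp) as [B HB], (fourier_decay 0 g Hg Hgp) as [B' HB'].
    exists (2 ^ M * (B + B')). intros z.
    destruct (HB z) as [C1 S1], (HB' z) as [C0 S0].
    rewrite Rmult_1_l in C0; rewrite Rmult_1_l in S0.
    (* As 1 + |z| <= 2 max(1, |z|), the bounds for the exponents 0 and M together control the weight
       (1 + |z|)^M. *)
    assert (Hgen : forall q, 0 <= q -> Rabs (IZR z) ^ M * q <= B -> q <= B' ->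
      (1 + Rabs (IZR z)) ^ M * q <= 2 ^ M * (B + B')).
    { intros q Hq H1 H0. pose proof (pow_lt 2 M ltac:(lra)).
      pose proof (Rabs_pos (IZR z)).
      assert (0 <= Rabs (IZR z) ^ M * q) by (apply Rmult_le_pos; [apply pow_le|]; auto).
      destruct (Rle_lt_dec (Rabs (IZR z)) 1) as [Hz|Hz].
      - apply Rle_trans with (2 ^ M * q); [|apply Rmult_le_compat_l; lra].
        apply Rmult_le_compat_r; auto. apply pow_incr; lra.
      - apply Rle_trans with (2 ^ M * (Rabs (IZR z) ^ M * q)).
        + rewrite -Rmult_assoc -Rpow_mult_distr. apply Rmult_le_compat_r; auto.
          apply pow_incr; lra.
        + apply Rmult_le_compat_l; lra. }
    split; apply Hgen; auto; apply Rabs_pos. }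
  intros M.
  destruct (Hrz (fun t => Re (f t)) M Hr) as [B HB]; [intros; now rewrite Hp|].
  destruct (Hrz (fun t => Im (f t)) M Hi) as [B' HB']; [intros; now rewrite Hp|].
  exists (2 * B + 2 * B'); intros z. destruct (HB z), (HB' z).
  rewrite fourier_coef_eq.
  2:{ intros; now apply (Cinf_continuous everywhere). }
  2:{ intros; now apply (Cinf_continuous everywhere). }
  eapply Rle_trans.
  { apply Rmult_le_compat_l; [apply pow_le; pose proof (Rabs_pos (IZR z)); lra|].
    apply Cmod_le_Re_Im. }
  cbv beta in *. set (w := (1 + Rabs (IZR z)) ^ M) in *.
  assert (0 <= w) by (apply pow_le; pose proof (Rabs_pos (IZR z)); lra).
  set (a := RInt (fun x => Re (f x) * cosz z x) 0 1) in *.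
  set (b := RInt (fun x => Im (f x) * sinz z x) 0 1) in *.
  set (c := RInt (fun x => Im (f x) * cosz z x) 0 1) in *.
  set (d := RInt (fun x => Re (f x) * sinz z x) 0 1) in *.
  change (Re (a + b, c - d)) with (a + b). change (Im (a + b, c - d)) with (c - d).
  pose proof (Rabs_triang a b). pose proof (Rabs_triang c (- d)).
  rewrite Rabs_Ropp in H5.
  apply Rle_trans with (w * (Rabs a + Rabs b + (Rabs c + Rabs d))); [|lra].
  apply Rmult_le_compat_l; auto. unfold Rminus. lra.
Qed.

Lemma rapid_lin_comb (s t u : nat -> R) p q :
  (forall n, Rabs (u n) <= Rabs p * Rabs (s n) + Rabs q * Rabs (t n)) ->
  rapid s -> rapid t -> rapid u.
Proof.
  intros Hu Hs Ht M; destruct (Hs M) as [B HB], (Ht M) as [B' HB'].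
  exists (Rabs p * B + Rabs q * B'); intros n.
  specialize (HB n); specialize (HB' n).
  assert (0 <= (1 + INR n) ^ M) by (apply pow_le; pose proof (pos_INR n); lra).
  eapply Rle_trans; [apply Rmult_le_compat_l; [auto|apply Hu]|].
  rewrite Rmult_plus_distr_l.
  replace ((1 + INR n) ^ M * (Rabs p * Rabs (s n))) with
    (Rabs p * ((1 + INR n) ^ M * Rabs (s n))) by ring.
  replace ((1 + INR n) ^ M * (Rabs q * Rabs (t n))) with
    (Rabs q * ((1 + INR n) ^ M * Rabs (t n))) by ring.
  apply Rplus_le_compat; apply Rmult_le_compat_l; auto; apply Rabs_pos.
Qed.

(** The function is sum_z p_z exp (2 pi i z x). Merging the modes n and -n makes its real and
    imaginary parts real trigonometric series with rapid coefficients. *)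
Lemma exists_smooth_circle p : rapidZ p ->
  exists g, smooth_circle g /\ forall z, fourier_coef g z = p z.
Proof.
  intros Hp.
  pose proof (rapidZ_of_nat p Hp) as Hpos.
  pose proof (rapidZ_of_nat _ (rapidZ_opp p Hp)) as Hneg.
  set (P := fun n => p (Z.of_nat n)) in *.
  set (N := fun n => p (- Z.of_nat n)%Z) in *.
  change (rapid (fun n => Cmod (P n))) in Hpos.
  change (rapid (fun n => Cmod (N n))) in Hneg.
  assert (P0 : N O = P O) by reflexivity.
  set (be := fun n => Im (N n) - Im (P n)).
  set (de := fun n => Re (P n) - Re (N n)).
  (* For n = 0 the modes n and -n coincide, so the sum of the two counts one coefficient twice. *)
  set (k := fun n => match n with O => / 2 | S _ => 1 end : R).
  assert (Hr : forall u : nat -> R, (forall n, Rabs (u n) <= 1 * Cmod (P n) + 1 * Cmod (N n)) ->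
    rapid u).
  { intros u Hu. apply (rapid_lin_comb _ _ u 1 1) with (2 := Hpos) (3 := Hneg).
    intros n. rewrite Rabs_R1 !(Rabs_pos_eq (Cmod _)); auto; apply Cmod_ge_0. }
  assert (Hbnd : forall n, Rabs (Re (P n)) <= Cmod (P n) /\ Rabs (Re (N n)) <= Cmod (N n) /\
    Rabs (Im (P n)) <= Cmod (P n) /\ Rabs (Im (N n)) <= Cmod (N n)).
  { intros n; repeat split; apply Rabs_Re_le || apply Rabs_Im_le. }
  set (al := fun n => k n * (Re (P n) + Re (N n))).
  set (ga := fun n => k n * (Im (P n) + Im (N n))).
  assert (Hk : forall n, 0 <= k n <= 1) by (intros [|n]; simpl; lra).
  assert (Hkm : forall n a b, Rabs (k n * (a + b)) <= Rabs a + Rabs b).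
  { intros n a b. rewrite Rabs_mult (Rabs_pos_eq (k n)); [|apply Hk].
    pose proof (Rabs_triang a b). specialize (Hk n). pose proof (Rabs_pos (a + b)). nra. }
  assert (Hal : rapid al).
  { apply Hr; intros n; destruct (Hbnd n) as (?&?&?&?).
    unfold al. pose proof (Hkm n (Re (P n)) (Re (N n))). lra. }
  assert (Hga : rapid ga).
  { apply Hr; intros n; destruct (Hbnd n) as (?&?&?&?).
    unfold ga. pose proof (Hkm n (Im (P n)) (Im (N n))). lra. }
  assert (Hbe : rapid be).
  { apply Hr; intros n; destruct (Hbnd n) as (?&?&?&?). unfold be.
    pose proof (Rabs_triang (Im (N n)) (- Im (P n))) as T. rewrite Rabs_Ropp in T.
    unfold Rminus; lra. }
  assert (Hde : rapid de).
  { apply Hr; intros n; destruct (Hbnd n) as (?&?&?&?). unfold de.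
    pose proof (Rabs_triang (Re (P n)) (- Re (N n))) as T. rewrite Rabs_Ropp in T.
    unfold Rminus; lra. }
  set (g := fun x => (trig al be x, trig ga de x) : C).
  assert (Hsm : smooth_circle g).
  { split.
    - intros x; unfold g; f_equal; apply trig_period.
    - apply smooth_on_Cinf; [apply open_everywhere|].
      split; apply Cinf_trig; auto. }
  exists g; split; auto.
  assert (Cr : forall x, continuous (fun t => Re (g t)) x).
  { intros; apply (Cinf_continuous everywhere); [now apply Cinf_trig|easy]. }
  assert (Ci : forall x, continuous (fun t => Im (g t)) x).
  { intros; apply (Cinf_continuous everywhere); [now apply Cinf_trig|easy]. }
  assert (Hn : forall n, RInt (fun x => Re (g x) * cosz (Z.of_nat n) x) 0 1 =
      / 2 * (Re (P n) + Re (N n)) /\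
    RInt (fun x => Re (g x) * sinz (Z.of_nat n) x) 0 1 = / 2 * (Im (N n) - Im (P n)) /\
    RInt (fun x => Im (g x) * cosz (Z.of_nat n) x) 0 1 = / 2 * (Im (P n) + Im (N n)) /\
    RInt (fun x => Im (g x) * sinz (Z.of_nat n) x) 0 1 = / 2 * (Re (P n) - Re (N n))).
  { intros n. destruct (trig_coef al be n Hal Hbe) as [T1 T2].
    destruct (trig_coef ga de n Hga Hde) as [T3 T4].
    split; [|split; [|split]].
    - transitivity (half_weight n * al n); [exact T1|].
      unfold al. destruct n; simpl; field.
    - transitivity ((1 - half_weight n) * be n); [exact T2|].
      unfold be. destruct n; simpl; rewrite ?P0; field.
    - transitivity (half_weight n * ga n); [exact T3|].
      unfold ga. destruct n; simpl; field.
    - transitivity ((1 - half_weight n) * de n); [exact T4|].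
      unfold de. destruct n; simpl; rewrite ?P0; field. }
  intros z. rewrite fourier_coef_eq; auto.
  destruct (Z_le_dec 0 z) as [Hz|Hz].
  - destruct (Hn (Z.to_nat z)) as (T1 & T2 & T3 & T4). unfold P, N in *.
    rewrite Z2Nat.id in T1 T2 T3 T4; auto.
    rewrite T1 T2 T3 T4. apply injective_projections; simpl; unfold Re, Im;
      match goal with |- ?u = ?v => change (@eq R u v) end; field.
  - destruct (Hn (Z.to_nat (- z))) as (T1 & T2 & T3 & T4). unfold P, N in *.
    rewrite Z2Nat.id in T1 T2 T3 T4; [|lia]. rewrite Z.opp_involutive in T1 T2 T3 T4.
    rewrite (RInt_ext _ (fun x => Re (g x) * cosz (- z) x));
      [|intros; now rewrite cosz_opp].
    rewrite (RInt_ext (fun x => Im (g x) * cosz z x) (fun x => Im (g x) * cosz (- z) x));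
      [|intros; now rewrite cosz_opp].
    assert (Hop : forall u : R -> R, (forall x, continuous u x) ->
      RInt (fun x => u x * sinz z x) 0 1 = - RInt (fun x => u x * sinz (- z) x) 0 1).
    { intros u Cu. apply is_RInt_unique_R.
      apply: is_RInt_ext (is_RInt_opp _ _ _ _ (is_RInt_mul_sinz u (- z) Cu)).
      intros x _; rewrite sinz_opp /opp /=; ring. }
    rewrite !Hop; auto. rewrite T1 T2 T3 T4.
    apply injective_projections; simpl; unfold Re, Im;
      match goal with |- ?u = ?v => change (@eq R u v) end; field.
Qed.

(** * Chebyshev expansions *)

(* Chebyshev polynomials of the second kind, with index shifted by one:
   [sin t * cheb n (cos t) = sin (n t)]. *)
Fixpoint cheb (n : nat) (x : R) : R :=
  match n with
  | O => 0
  | S m => match m with O => 1 | S k => 2 * x * cheb m x - cheb k x end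
  end.

Lemma cheb_SS n x : cheb (S (S n)) x = 2 * x * cheb (S n) x - cheb n x.
Proof. reflexivity. Qed.

Lemma pair_ind (P : nat -> Prop) :
  P O -> P 1%nat -> (forall n, P n -> P (S n) -> P (S (S n))) -> forall n, P n.
Proof.
  intros H0 H1 HS n. assert (P n /\ P (S n)) as [H _]; auto.
  induction n as [|n [IH1 IH2]]; auto.
Qed.

Lemma cheb_sin n t : sin t * cheb n (cos t) = sin (INR n * t).
Proof.
  induction n as [| |n IH1 IH2] using pair_ind.
  - simpl; rewrite Rmult_0_l sin_0; ring.
  - simpl; rewrite !Rmult_1_l Rmult_1_r; auto.
  - rewrite cheb_SS.
    replace (sin t * (2 * cos t * cheb (S n) (cos t) - cheb n (cos t))) with
      (2 * cos t * (sin t * cheb (S n) (cos t)) - sin t * cheb n (cos t)) by ring.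
    rewrite IH1 IH2 !S_INR.
    replace ((INR n + 1 + 1) * t) with ((INR n + 1) * t + t) by ring.
    replace (INR n * t) with ((INR n + 1) * t - t) by ring.
    rewrite sin_plus sin_minus. ring.
Qed.

Lemma Rabs_sin_mult_le n t : Rabs (sin (INR n * t)) <= INR n * Rabs (sin t).
Proof.
  induction n as [|n IH].
  - simpl; rewrite !Rmult_0_l sin_0 Rabs_R0; lra.
  - rewrite S_INR. replace ((INR n + 1) * t) with (INR n * t + t) by ring.
    rewrite sin_plus. eapply Rle_trans; [apply Rabs_triang|]. rewrite !Rabs_mult.
    assert (Rabs (cos t) <= 1) by (apply Rabs_le, COS_bound).
    assert (Rabs (cos (INR n * t)) <= 1) by (apply Rabs_le, COS_bound).
    pose proof (Rabs_pos (sin (INR n * t))); pose proof (Rabs_pos (sin t)). nra.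
Qed.

Lemma sin_acos_pos x : -1 < x < 1 -> 0 < sin (acos x).
Proof.
  intros Hx. pose proof (acos_bound_lt x Hx). apply sin_gt_0; lra.
Qed.

(** With x = cos t this is |sin (n t)| <= n |sin t|, divided by sin t, which is positive because the
    interval is open. *)
Lemma cheb_bound n x : -1 < x < 1 -> Rabs (cheb n x) <= INR n.
Proof.
  intros Hx. pose proof (sin_acos_pos x Hx) as Hs.
  pose proof (cheb_sin n (acos x)) as H. rewrite cos_acos in H; [|lra].
  apply Rmult_le_reg_l with (sin (acos x)); auto.
  rewrite -{1}(Rabs_pos_eq (sin (acos x))); [|lra]. rewrite -Rabs_mult H.
  eapply Rle_trans; [apply Rabs_sin_mult_le|].
  rewrite Rabs_pos_eq; lra.
Qed.

Lemma continuous_cheb n x : continuous (cheb n) x.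
Proof.
  assert (H : Cinf everywhere (cheb n)).
  { intros m. induction n as [| |n IH1 IH2] using pair_ind.
    - apply (Dn_const m everywhere 0).
    - apply (Dn_const m everywhere 1).
    - apply (Dn_plus m everywhere (fun x => 2 * x * cheb (S n) x) (fun x => - cheb n x)).
      + apply Dn_mult; auto. apply Dn_mult; [apply Dn_const|apply Dn_id].
      + now apply Dn_opp. }
  now apply (Cinf_continuous everywhere).
Qed.

Lemma cheb_expansion_R F r : 0 < r -> Cinf everywhere F ->
  exists s, rapid s /\ forall x, Rabs x < r ->
    is_series (fun n => s n * cheb n (x / r)) (F x).
Proof.
  intros Hr HF.
  set (g := fun t => F (r * cosz 1 t) * sinz 1 t).
  assert (Hg : Cinf everywhere g).
  { intros n.
    assert (Hlin : Dn n everywhere (fun t => 2 * PI * 1 * t))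
      by (apply Dn_mult; [apply Dn_const|apply Dn_id]).
    apply Dn_mult.
    - apply Dn_comp with everywhere; [easy|apply HF|].
      apply Dn_mult; [apply Dn_const|].
      apply (Dn_comp n everywhere everywhere cos (fun t => 2 * PI * 1 * t));
        [easy|apply Dn_sin_cos|exact Hlin].
    - apply (Dn_comp n everywhere everywhere sin (fun t => 2 * PI * 1 * t));
        [easy|apply Dn_sin_cos|exact Hlin]. }
  destruct (fourier_expansion g Hg) as (al & be & Ha & Hb & Hgx).
  { intros x; unfold g; now rewrite cosz_period sinz_period. }
  exists be; split; auto. intros x Hx.
  assert (Hy : -1 < x / r < 1).
  { apply Rabs_def2 in Hx. split.
    - apply Rmult_lt_reg_r with r; auto. field_simplify; lra.
    - apply Rmult_lt_reg_r with r; auto. field_simplify; lra. }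
  pose proof (acos_bound_lt _ Hy) as Hac. pose proof PI_RGT_0.
  set (th := acos (x / r)) in *. set (t := th / (2 * PI)).
  assert (Ht : 2 * PI * t = th) by (unfold t; field; lra).
  assert (Ht1 : 0 < t < 1) by (split; nra).
  assert (Hsin : 0 < sin th) by (apply sin_gt_0; lra).
  assert (Hc1 : cosz 1 t = x / r).
  { unfold cosz. rewrite Rmult_1_r Ht. unfold th; apply cos_acos; lra. }
  assert (Hs1 : sinz 1 t = sin th) by (unfold sinz; rewrite Rmult_1_r Ht; auto).
  assert (Hrefl : forall z, cosz z (1 - t) = cosz z t /\ sinz z (1 - t) = - sinz z t).
  { intros z. rewrite -(cosz_period z t) -(sinz_period z t) -{1}(cosz_opp z) .
    pose proof (cosz_period z (- t)) as H1. pose proof (sinz_period z (- t)) as H2.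
    rewrite cosz_opp. rewrite cosz_period sinz_period.
    replace (1 - t) with (- t + 1) by ring. rewrite H1 H2. unfold cosz, sinz.
    rewrite -cos_neg -sin_neg. split; f_equal; ring. }
  assert (Hg1 : g t = F x * sin th).
  { unfold g. rewrite Hc1 Hs1. f_equal; f_equal; field; lra. }
  assert (Hg2 : g (1 - t) = - (F x * sin th)).
  { unfold g. destruct (Hrefl 1%Z) as [-> ->]. rewrite Hc1 Hs1.
    replace (r * (x / r)) with x by (field; lra). ring. }
  (* [g] is odd under t -> 1 - t. Half the difference of the expansions at t and 1 - t loses its
     cosine terms, so the cosine coefficients need not be computed; the remaining sines divided by
     sin th are the Chebyshev values. *)
  assert (HS : is_series (fun n => / (2 * sin th) *
      (trig_term al be n t - trig_term al be n (1 - t)))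
      (/ (2 * sin th) * (g t - g (1 - t)))).
  { apply: (is_series_scal_l (/ (2 * sin th))).
    rewrite Hgx; auto. rewrite (Hgx (1 - t)); [|lra].
    apply: is_series_minus; now apply is_series_trig. }
  rewrite Hg1 Hg2 in HS.
  replace (/ (2 * sin th) * (F x * sin th - - (F x * sin th))) with (F x) in HS
    by (field; lra).
  apply: is_series_ext HS. intros n. unfold trig_term.
  destruct (Hrefl (Z.of_nat n)) as [-> ->].
  assert (Hsn : sinz (Z.of_nat n) t = sin th * cheb n (x / r)).
  { rewrite -{1}(cos_acos (x / r)); [|lra]. fold th. rewrite cheb_sin.
    unfold sinz. rewrite -INR_IZR_INZ. f_equal. rewrite -Ht. ring. }
  rewrite Hsn.
  match goal with |- ?u = ?v => change (@eq R u v) end; field; lra.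
Qed.

Lemma sum_n_Re_Im (z : nat -> C) N :
  Re (sum_n z N) = sum_n (fun n => Re (z n)) N /\
  Im (sum_n z N) = sum_n (fun n => Im (z n)) N.
Proof.
  induction N as [|N [IH1 IH2]]; [rewrite !sum_O; auto|].
  rewrite !sum_Sn -IH1 -IH2; auto.
Qed.

(** [K] will be the spectrum. Uniformity in x is what the norm bound of the functional calculus asks
    for; it holds because |V_n| <= n and the n |s_n| are summable. *)
Lemma cheb_expansion (K D : R -> Prop) (f : R -> C) r :
  0 < r -> open D -> smooth_on D f ->
  (forall x, K x -> D x) -> (forall x, K x -> Rabs x < r) ->
  (forall x, ~ K x -> locally x (fun y => ~ K y)) ->
  exists s : nat -> C, rapid (fun n => Cmod (s n)) /\
    forall eps : posreal, eventually (fun N => forall x, K x ->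
      Cmod (Cminus (f x) (sum_n (fun n => Cmult (s n) (RtoC (cheb n (x / r)))) N)) <= eps).
Proof.
  intros Hr HD Hf HKD HKr HKc. apply smooth_on_Cinf in Hf; auto. destruct Hf as [Hf1 Hf2].
  destruct (smooth_extension K D _ r HD Hf1 HKD HKr HKc) as (F1 & HF1 & HFf1).
  destruct (smooth_extension K D _ r HD Hf2 HKD HKr HKc) as (F2 & HF2 & HFf2).
  destruct (cheb_expansion_R F1 r Hr HF1) as (s1 & Hs1 & HE1).
  destruct (cheb_expansion_R F2 r Hr HF2) as (s2 & Hs2 & HE2).
  exists (fun n => (s1 n, s2 n)); split.
  { apply (rapid_lin_comb _ _ _ 1 1) with (2 := Hs1) (3 := Hs2). intros n.
    rewrite Rabs_R1 !Rmult_1_l Rabs_pos_eq; [|apply Cmod_ge_0]. apply Cmod_le_Re_Im. }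
  assert (Htail : forall s F (u : R -> R), rapid s ->
    (forall x, K x -> F x = u x) ->
    (forall x, Rabs x < r -> is_series (fun n => s n * cheb n (x / r)) (F x)) ->
    forall eps : posreal, eventually (fun N => forall x, K x ->
      Rabs (u x - sum_n (fun n => s n * cheb n (x / r)) N) < eps)).
  { intros s F u Hs HFu HE eps. pose proof (rapid_ex_series s 1 Hs) as Hex.
    destruct (series_tail _ Hex eps) as [N HN]. exists N; intros n Hn x Hx.
    specialize (HN n Hn). rewrite -HFu; auto.
    eapply Rle_lt_trans.
    { apply (is_series_le_bound _ _ _ _ n) with (2 := HE x (HKr x Hx))
        (3 := Series_correct _ Hex).
      intros k. rewrite Rabs_mult Rmult_comm.
      apply Rmult_le_compat_r; [apply Rabs_pos|].
      eapply Rle_trans; [apply cheb_bound|rewrite pow_1; lra].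
      apply HKr, Rabs_def2 in Hx. split.
      - apply Rmult_lt_reg_r with r; auto. field_simplify; lra.
      - apply Rmult_lt_reg_r with r; auto. field_simplify; lra. }
    apply Rabs_def2 in HN; lra. }
  intros eps.
  destruct (Htail s1 F1 _ Hs1 HFf1 HE1 (pos_div_2 eps)) as [N1 HN1].
  destruct (Htail s2 F2 _ Hs2 HFf2 HE2 (pos_div_2 eps)) as [N2 HN2].
  exists (N1 + N2)%nat; intros n Hn x Hx.
  specialize (HN1 n ltac:(lia) x Hx). specialize (HN2 n ltac:(lia) x Hx). simpl in HN1, HN2.
  eapply Rle_trans; [apply Cmod_le_Re_Im|].
  destruct (sum_n_Re_Im (fun n => Cmult (s1 n, s2 n) (RtoC (cheb n (x / r)))) n) as [E1 E2].
  set (Sm := sum_n (fun n => Cmult (s1 n, s2 n) (RtoC (cheb n (x / r)))) n) in *.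
  rewrite (sum_n_ext _ (fun n => s1 n * cheb n (x / r))) in E1.
  2:{ intros k; unfold Re; simpl; ring. }
  rewrite (sum_n_ext _ (fun n => s2 n * cheb n (x / r))) in E2.
  2:{ intros k; unfold Im; simpl; ring. }
  change (Re (Cminus (f x) Sm)) with (Re (f x) - Re Sm).
  change (Im (Cminus (f x) Sm)) with (Im (f x) - Im Sm).
  rewrite E1 E2. lra.
Qed.

(** * Operator series *)

Lemma op_lim_pointwise {H : CompleteNormedModule C_AbsRing} (S : nat -> H -> H) a :
  is_op_lim S a -> forall v, filterlim (fun n => S n v) eventually (locally (a v)).
Proof.
  intros HS v. refine (proj2 (filterlim_locally_ball_norm _ _) _); intros eps.
  pose proof (norm_ge_0 v). pose proof (cond_pos eps).
  assert (Hd : 0 < eps / (norm v + 1)) by (apply Rdiv_lt_0_compat; lra).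
  destruct (HS (mkposreal _ Hd)) as [N HN]. exists N; intros n Hn.
  unfold ball_norm. eapply Rle_lt_trans; [apply HN; auto|]. simpl.
  apply Rlt_le_trans with (eps / (norm v + 1) * (norm v + 1)); [|right; field; lra].
  apply Rmult_lt_compat_l; lra.
Qed.

(** Completeness gives the sum at each vector, and a choice assembles the sums into a map. The tails
    of the majorant bound the error in operator norm. *)
Lemma op_series_exists {H : CompleteNormedModule C_AbsRing} (A : nat -> H -> H) (b : nat -> R) :
  (forall n, is_linear (A n)) -> (forall n v, norm (A n v) <= b n * norm v) ->
  ex_series b -> exists a, is_linear a /\ is_op_series A a.
Proof.
  intros HA Hb [m Hm].
  assert (Hm' : forall v : H, is_series (fun n => b n * norm v) (m * norm v)).
  { intros v. apply: is_series_scal_r. exact Hm. }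
  destruct (functional_choice (fun v w => is_series (fun n => A n v) w)) as [a Ha].
  { intros v. apply (ex_series_le _ (fun n => b n * norm v)); [intros; apply Hb|].
    eexists; apply Hm'. }
  exists a; split; [split|].
  - intros u v. apply (is_series_unique' (fun n => A n (plus u v))); auto.
    apply is_series_ext with (fun n => plus (A n u) (A n v)).
    + intros n; symmetry; apply (linear_plus (A n)); auto.
    + now apply: is_series_plus.
  - intros z u. apply (is_series_unique' (fun n => A n (scal z u))); auto.
    apply is_series_ext with (fun n => scal z (A n u)).
    + intros n; symmetry; apply (linear_scal (A n)); auto.
    + apply (linear_series (fun w : H => scal z w) (fun n => A n u) (a u)); auto.
      apply (is_linear_scal_r (V := CompleteNormedModule.NormedModule _ H) z).
      apply Cmult_comm.
  - exists (Rabs m + 1); split; [pose proof (Rabs_pos m); lra|].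
    intros v. apply Rle_trans with (m * norm v).
    + apply (norm_series_le (fun n => A n v) (fun n => b n * norm v)); auto.
    + apply Rmult_le_compat_r; [apply norm_ge_0|]. pose proof (Rle_abs m); lra.
  - intros eps. destruct (series_tail b (ex_intro _ m Hm) eps) as [N HN].
    exists N; intros n Hn v. specialize (HN n Hn).
    rewrite (is_series_unique _ _ Hm) in HN.
    rewrite -norm_opp opp_minus.
    eapply Rle_trans; [apply (norm_series_tail (fun n => A n v) _ _ _ n (fun n => Hb n v)
      (Ha v) (Hm' v))|].
    replace (sum_n (fun n => b n * norm v) n) with (sum_n b n * norm v).
    2:{ symmetry; exact (sum_n_mult_r (norm v) b n). }
    apply Rabs_def2 in HN. pose proof (norm_ge_0 v). nra.
Qed.

Lemma iter_linear {H : CompleteNormedModule C_AbsRing} (X : H -> H) n :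
  is_linear X -> is_linear (fun v => Nat.iter n X v).
Proof.
  intros HX; induction n as [|n IH]; [apply is_linear_id|].
  now apply (is_linear_comp (fun v => Nat.iter n X v) X).
Qed.

Lemma iter_norm {H : CompleteNormedModule C_AbsRing} (X : H -> H) n :
  (forall v, norm (X v) <= norm v) -> forall v, norm (Nat.iter n X v) <= norm v.
Proof.
  intros HX v; induction n as [|n IH]; [apply Rle_refl|].
  eapply Rle_trans; [apply HX|auto].
Qed.

(** * The resolvent set *)

(** The inverse of 1 - B is the geometric series. [Htel] telescopes its partial sums, and [Hlim]
    yields both the left and the right inverse from it. *)
Lemma neumann {H : CompleteNormedModule C_AbsRing} (B : H -> H) q :
  is_linear B -> 0 <= q < 1 -> (forall v, norm (B v) <= q * norm v) ->
  exists G, is_linear G /\ (forall v, G (minus v (B v)) = v) /\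
    (forall v, minus (G v) (B (G v)) = v).
Proof.
  intros HB Hq Hbd.
  assert (Hn : forall n v, norm (Nat.iter n B v) <= q ^ n * norm v).
  { induction n as [|n IH]; intros v; simpl; [lra|].
    eapply Rle_trans; [apply Hbd|]. rewrite Rmult_assoc.
    apply Rmult_le_compat_l; [lra|apply IH]. }
  assert (Hex : ex_series (fun n => q ^ n)).
  { exists (/ (1 - q)). apply is_series_geom. rewrite Rabs_pos_eq; lra. }
  destruct (op_series_exists (fun n v => Nat.iter n B v) (fun n => q ^ n)) as (G & HG & HS);
    auto.
  { intros n; now apply iter_linear. }
  pose proof (op_lim_pointwise _ _ HS) as HP.
  assert (Hz : forall v, filterlim (fun n => Nat.iter n B v) eventually (locally (zero : H))).
  { intros v. refine (proj2 (filterlim_locally_ball_norm _ _) _); intros eps.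
    pose proof (is_lim_seq_geom q ltac:(rewrite Rabs_pos_eq; lra)) as Hg.
    pose proof (norm_ge_0 v). pose proof (cond_pos eps).
    assert (Hd : 0 < eps / (norm v + 1)) by (apply Rdiv_lt_0_compat; lra).
    destruct (proj1 (filterlim_locally _ _) Hg (mkposreal _ Hd)) as [N HN].
    exists N; intros n Hnn. specialize (HN n Hnn).
    change (Rabs (q ^ n - 0) < eps / (norm v + 1)) in HN.
    rewrite Rminus_0_r Rabs_pos_eq in HN; [|apply pow_le; lra].
    unfold ball_norm. rewrite minus_zero_r.
    eapply Rle_lt_trans; [apply Hn|].
    apply Rle_lt_trans with (eps / (norm v + 1) * norm v).
    - apply Rmult_le_compat_r; lra.
    - apply Rlt_le_trans with (eps / (norm v + 1) * (norm v + 1)); [|right; field; lra].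
      apply Rmult_lt_compat_l; lra. }
  assert (Htel : forall v N, minus (sum_n (fun n => Nat.iter n B v) N)
      (sum_n (fun n => Nat.iter (S n) B v) N) = minus v (Nat.iter (S N) B v)).
  { intros v N; induction N as [|N IH]; [now rewrite !sum_O|].
    rewrite !sum_Sn minus_plus_plus IH. symmetry; apply minus_trans. }
  assert (Hlim : forall v w, filterlim (fun N => minus (sum_n (fun n => Nat.iter n B v) N)
      (sum_n (fun n => Nat.iter (S n) B v) N)) eventually (locally w) -> w = v).
  { intros v w Hw. apply (filterlim_locally_unique (F := eventually)
      (fun N => minus v (Nat.iter (S N) B v))).
    - apply: filterlim_ext Hw. intros N; apply Htel.
    - rewrite -[X in locally X](minus_zero_r v).
      apply (filterlim_minus (V := CompleteNormedModule.NormedModule _ H));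
        [apply filterlim_const|].
      apply (filterlim_comp _ _ _ S (fun n => Nat.iter n B v) _ eventually _); [|apply Hz].
      apply eventually_subseq; intros; lia. }
  assert (Hiter : forall n v, Nat.iter n B (B v) = Nat.iter (S n) B v).
  { intros n v; induction n as [|n IH]; [reflexivity|]. simpl. now rewrite IH. }
  exists G; split; auto. split; intros v.
  - apply Hlim. rewrite (linear_minus G v (B v) HG).
    apply (filterlim_minus (V := CompleteNormedModule.NormedModule _ H)); [apply HP|].
    eapply filterlim_ext; [|apply (HP (B v))].
    intros N; apply sum_n_ext; intros n; apply Hiter.
  - apply Hlim.
    apply (filterlim_minus (V := CompleteNormedModule.NormedModule _ H)); [apply HP|].
    eapply filterlim_ext; [intros N; apply (linear_sum_n B); auto|].
    eapply filterlim_comp; [apply HP|exact (linear_cont B (G v) HB)].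
Qed.

Lemma is_linear_scal_H {H : CompleteNormedModule C_AbsRing} (z : C) :
  is_linear (fun v : H => scal z v).
Proof.
  apply (is_linear_scal_r (V := CompleteNormedModule.NormedModule _ H) z).
  apply Cmult_comm.
Qed.

Lemma is_linear_scal_comp {H : CompleteNormedModule C_AbsRing} (z : C) (X : H -> H) :
  is_linear X -> is_linear (fun v => scal z (X v)).
Proof. intros; apply (is_linear_comp X (fun v : H => scal z v)); auto. apply is_linear_scal_H. Qed.

Lemma norm_scal_le {H : CompleteNormedModule C_AbsRing} (z : C) (v : H) :
  norm (scal z v) <= Cmod z * norm v.
Proof. exact (norm_scal (z : C_AbsRing) v). Qed.

(** For |x| > M, the operator a - x = -x (1 - a/x) is invertible by [neumann]. *)
Lemma spectrum_bound {H : CompleteNormedModule C_AbsRing} (a : H -> H) M x :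
  is_linear a -> 0 <= M -> (forall v, norm (a v) <= M * norm v) ->
  real_spectrum a x -> Rabs x <= M.
Proof.
  intros Ha HM Hb Hx. apply Rnot_lt_le; intros HMx.
  assert (Hx0 : x <> 0) by (intros ->; rewrite Rabs_R0 in HMx; lra).
  assert (Hxc : RtoC x <> 0) by (intros E; apply Hx0; now apply RtoC_inj).
  set (B := fun v => scal (/ RtoC x)%C (a v)).
  assert (HB : is_linear B) by now apply is_linear_scal_comp.
  assert (Hq : 0 <= M / Rabs x < 1).
  { assert (0 < Rabs x) by lra. split; [apply Rdiv_le_0_compat; lra|].
    apply Rmult_lt_reg_r with (Rabs x); auto. field_simplify; lra. }
  destruct (neumann B _ HB Hq) as (G & HG & G1 & G2).
  { intros v. eapply Rle_trans; [apply norm_scal_le|].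
    rewrite Cmod_inv; auto. rewrite Cmod_R. unfold Rdiv.
    rewrite (Rmult_comm M) Rmult_assoc. apply Rmult_le_compat_l; auto.
    left; apply Rinv_0_lt_compat; lra. }
  apply Hx. exists (fun v => G (scal (- / RtoC x)%C v)).
  assert (E : forall v, minus (a v) (scal (RtoC x) v) =
    scal (- RtoC x)%C (minus v (B v))).
  { intros v. unfold B. rewrite (scal_minus_distr_l (- RtoC x)%C v) scal_assoc.
    replace (mult (- RtoC x)%C (/ RtoC x)%C) with (opp (one : C_AbsRing)).
    - rewrite scal_opp_one. unfold minus. rewrite opp_opp plus_comm. f_equal.
      symmetry. exact (scal_opp_l (RtoC x : C_AbsRing) v).
    - rewrite /mult /opp /one /=. now field. }
  assert (E1 : mult (- / RtoC x)%C (- RtoC x)%C = (one : C_AbsRing))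
    by (rewrite /mult /one /=; now field).
  assert (E2 : mult (- RtoC x)%C (- / RtoC x)%C = (one : C_AbsRing))
    by (rewrite /mult /one /=; now field).
  split; [|split].
  - apply (is_linear_comp (fun v : H => scal (- / RtoC x)%C v) G); auto.
    apply is_linear_scal_H.
  - intros v. rewrite E scal_assoc E1 scal_one. apply G1.
  - intros v. rewrite E G2 scal_assoc E2. apply: scal_one.
Qed.

(** If b inverts a - x and is bounded by M, then a - y = (a - x)(1 - (y - x) b), and the second
    factor is invertible for |y - x| < 1/(2 M). This is the closedness of the spectrum needed to
    extend f. *)
Lemma resolvent_open {H : CompleteNormedModule C_AbsRing} (a : H -> H) x :
  is_linear a -> ~ real_spectrum a x -> locally x (fun y => ~ real_spectrum a y).
Proof.
  intros Ha Hx. apply NNPP in Hx. destruct Hx as (b & Hb & b1 & b2).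
  destruct (linear_norm b Hb) as (M & HM & HbM).
  assert (Hd : 0 < / (2 * M)) by (apply Rinv_0_lt_compat; lra).
  exists (mkposreal _ Hd); intros y Hy Hn. apply Hn; clear Hn.
  change (Rabs (y - x) < / (2 * M)) in Hy.
  set (B := fun v => scal (RtoC (y - x)) (b v)).
  assert (HB : is_linear B) by now apply is_linear_scal_comp.
  destruct (neumann B (/ 2) HB ltac:(lra)) as (G & HG & G1 & G2).
  { intros v. eapply Rle_trans; [apply norm_scal_le|]. rewrite Cmod_R.
    apply Rle_trans with (/ (2 * M) * (M * norm v)).
    - apply Rmult_le_compat; [apply Rabs_pos|apply norm_ge_0|lra|apply HbM].
    - right; field; lra. }
  assert (E : forall v, minus (a v) (scal (RtoC y) v) =
    minus (minus (a v) (scal (RtoC x) v)) (scal (RtoC (y - x)) v)).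
  { intros v. unfold minus. rewrite -plus_assoc -opp_plus. f_equal. f_equal.
    rewrite -(scal_distr_r (RtoC x : C_AbsRing)). f_equal.
    change (RtoC y = Cplus (RtoC x) (RtoC (y - x))).
    rewrite -RtoC_plus Rplus_minus //. }
  exists (fun v => G (b v)). split; [|split].
  - now apply (is_linear_comp b G).
  - intros v. rewrite E (linear_minus b _ _ Hb) b1 (linear_scal b Hb). apply G1.
  - intros v. set (w := G (b v)).
    assert (Hw : scal (RtoC (y - x)) w = minus (a (B w)) (scal (RtoC x) (B w))).
    { unfold B. rewrite (linear_scal a Ha) -{1}(b2 w).
      rewrite (scal_minus_distr_l (RtoC (y - x)) (a (b w))). f_equal.
      rewrite !scal_assoc. f_equal. apply Cmult_comm. }
    rewrite E Hw.
    assert (Hwb : minus w (B w) = b v) by exact (G2 (b v)).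
    rewrite -(b2 v) -Hwb (linear_minus a w (B w) Ha) (scal_minus_distr_l (RtoC x) w).
    unfold minus. rewrite !opp_plus !opp_opp -!plus_assoc. f_equal.
    rewrite !plus_assoc. f_equal. apply plus_comm.
Qed.

(** * Coordinates and matrix entries in the orthonormal basis *)

Section Hilbert.

Context {H : CompleteNormedModule C_AbsRing} {ip : H -> H -> C}
  (hip : is_inner_product ip) {E : nat -> H} (hE : is_orthonormal_basis ip E).

Lemma ip_plus_r (w u v : H) : ip w (plus u v) = Cplus (ip w u) (ip w v).
Proof.
  rewrite (ip_conj _ hip) (ip_plus _ hip) Cplus_conj -!(ip_conj _ hip) //.
Qed.

Lemma ip_scal_r (w u : H) (z : C) : ip w (scal z u) = Cmult (Cconj z) (ip w u).
Proof.
  rewrite (ip_conj _ hip) (ip_scal _ hip) Cmult_conj -(ip_conj _ hip) //.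
Qed.

Lemma ip_opp_l (u w : H) : ip (opp u) w = Copp (ip u w).
Proof.
  rewrite -(scal_opp_one u).
  change (opp (one : C_AbsRing)) with (Copp (RtoC 1)).
  rewrite (ip_scal _ hip). ring.
Qed.

Lemma ip_opp_r (u w : H) : ip u (opp w) = Copp (ip u w).
Proof.
  rewrite (ip_conj _ hip) ip_opp_l Copp_conj -(ip_conj _ hip) //.
Qed.

Lemma ip_E k l : ip (E k) (E l) = if Nat.eq_dec k l then RtoC 1 else RtoC 0.
Proof.
  destruct (Nat.eq_dec k l) as [->|Hn]; [apply hE|now apply hE].
Qed.

Lemma norm_sq (u : H) : norm u ^ 2 = Re (ip u u).
Proof. rewrite (ip_norm _ hip) //. Qed.

Lemma norm_le_of_sq (u v : H) : norm u ^ 2 <= norm v ^ 2 -> norm u <= norm v.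
Proof.
  intros Huv. apply Rsqr_incr_0_var; [|apply norm_ge_0].
  rewrite !Rsqr_pow2. exact Huv.
Qed.

(** With c the k-th coordinate of v, the squared norm of v - c E_k is |v|^2 - |c|^2, and it is
    nonnegative. *)
Lemma coord_bound (v : H) k : Cmod (ip v (E k)) <= norm v.
Proof.
  set (c := ip v (E k)). set (w := plus v (scal (Copp c) (E k))).
  assert (Hw : ip w w = Cplus (ip v v) (Copp (Cmult c (Cconj c)))).
  { unfold w. rewrite !(ip_plus _ hip) !ip_plus_r !(ip_scal _ hip) !ip_scal_r
      (onb_unit _ _ hE) (ip_conj _ hip v (E k)). fold c. rewrite Copp_conj. ring. }
  rewrite !(ip_norm _ hip) in Hw. apply (f_equal Re) in Hw.
  assert (Hc : Re (Cmult c (Cconj c)) = Cmod c ^ 2).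
  { unfold Cmod. rewrite pow2_sqrt; [|nra].
    unfold Re; simpl; ring. }
  simpl in Hw. rewrite -> Rmult_1_r in Hw.
  unfold Re in Hc; simpl in Hc.
  apply Rsqr_incr_0_var; [|apply norm_ge_0]. unfold Rsqr.
  pose proof (Rle_0_sqr (norm w)) as Hp. unfold Rsqr in Hp.
  set (q := norm w) in *. set (n := norm v) in *. set (cc := Cmod c) in *. lra.
Qed.

Lemma norm_E k : norm (E k) = 1.
Proof.
  assert (Hk : norm (E k) ^ 2 = 1) by (rewrite norm_sq (onb_unit _ _ hE) //).
  pose proof (norm_ge_0 (E k)). nra.
Qed.

(** The codomain is a normed module so that the lemmas on bounded linear maps and series apply to
    coordinates. *)
Definition coord (k : nat) (v : H) : C_NormedModule := ip v (E k).

Lemma is_linear_coord k : is_linear (coord k).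
Proof.
  split.
  - intros; apply (ip_plus _ hip).
  - intros; apply (ip_scal _ hip).
  - exists 1; split; [lra|]. intros v. rewrite Rmult_1_l. apply coord_bound.
Qed.

Lemma coord_ext (u v : H) : (forall k, ip u (E k) = ip v (E k)) -> u = v.
Proof.
  intros Huv. apply (is_series_unique' (fun k => scal (ip u (E k)) (E k))).
  - apply hE.
  - apply is_series_ext with (fun k => scal (ip v (E k)) (E k)); [|apply hE].
    intros n; rewrite Huv //.
Qed.

Lemma linear_E_ext {V : NormedModule C_AbsRing} (X Y : H -> V) :
  is_linear X -> is_linear Y -> (forall k, X (E k) = Y (E k)) -> forall v, X v = Y v.
Proof.
  intros HX HY HXY v.
  pose proof (linear_series X _ _ HX (onb_expand _ _ hE v)) as SX.
  pose proof (linear_series Y _ _ HY (onb_expand _ _ hE v)) as SY.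
  apply (is_series_unique' _ _ _ SX).
  apply is_series_ext with (2 := SY). intros n.
  rewrite (linear_scal X HX) (linear_scal Y HY) HXY //.
Qed.

Definition ent (X : H -> H) (k l : nat) : C := ip (X (E l)) (E k).

Lemma op_ext (X Y : H -> H) : is_linear X -> is_linear Y ->
  (forall k l, ent X k l = ent Y k l) -> forall v, X v = Y v.
Proof.
  intros HX HY HXY. apply linear_E_ext; auto. intros l; apply coord_ext; intros k.
  apply HXY.
Qed.

Lemma ent_bound (X : H -> H) C k l : (forall v, norm (X v) <= C * norm v) ->
  Cmod (ent X k l) <= C.
Proof.
  intros HX. eapply Rle_trans; [apply coord_bound|].
  eapply Rle_trans; [apply HX|]. rewrite norm_E; lra.
Qed.

Lemma ent_op_lim (S : nat -> H -> H) a k l : is_op_lim S a ->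
  filterlim (fun n => (ent (S n) k l : C_NormedModule)) eventually (locally (ent a k l : C_NormedModule)).
Proof.
  intros HS. eapply (filterlim_comp _ _ _ (fun n => S n (E l)) (coord k)).
  - apply (op_lim_pointwise _ _ HS).
  - exact (linear_cont (coord k) (a (E l)) (is_linear_coord k)).
Qed.

Lemma ent_op_series (A : nat -> H -> H) a k l : is_op_series A a ->
  is_series (fun n => (ent (A n) k l : C_NormedModule)) (ent a k l).
Proof.
  intros HA. pose proof (ent_op_lim _ _ k l HA) as HL. unfold is_series.
  apply: filterlim_ext HL. intros N. unfold ent.
  exact (linear_sum_n (coord k) (fun n => A n (E l)) N (is_linear_coord k)).
Qed.

(** Being bounded, X may be applied term by term to the expansion of Y E_l. *)
Lemma ent_comp (X Y : H -> H) k l : is_linear X ->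
  is_series (fun j => (Cmult (ent X k j) (ent Y j l) : C_NormedModule))
    (ent (fun v => X (Y v)) k l).
Proof.
  intros HX.
  assert (HL : is_linear (fun v => coord k (X v)))
    by (apply (is_linear_comp X (coord k)); auto; apply is_linear_coord).
  pose proof (linear_series _ _ _ HL (onb_expand _ _ hE (Y (E l)))) as HS.
  apply is_series_ext with (2 := HS). intros j.
  rewrite (linear_scal _ HL). apply Cmult_comm.
Qed.

(** * Weighted entries *)

(* [Y] is the weighted matrix [(p k - q l) X_{kl}]: for [p = q] the commutator
   of [X] with a diagonal operator, for [q = 0] (resp. [p = 0]) a one-sided
   product with it. *)
Definition wrel (p q : nat -> R) (X Y : H -> H) : Prop :=
  forall k l, ent Y k l = Cmult (RtoC (p k - q l)) (ent X k l).

Lemma ent_plus (X Y : H -> H) k l :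
  ent (fun v => plus (X v) (Y v)) k l = Cplus (ent X k l) (ent Y k l).
Proof. apply (ip_plus _ hip). Qed.

Lemma ent_opp (X : H -> H) k l : ent (fun v => opp (X v)) k l = Copp (ent X k l).
Proof. apply ip_opp_l. Qed.

Lemma ent_scal z (X : H -> H) k l :
  ent (fun v => scal z (X v)) k l = Cmult z (ent X k l).
Proof. apply (ip_scal _ hip). Qed.

Lemma ent_zero k l : ent (fun _ => zero) k l = RtoC 0.
Proof. exact (linear_zero _ (is_linear_coord k)). Qed.

Lemma wrel_plus p q X Y X' Y' : wrel p q X X' -> wrel p q Y Y' ->
  wrel p q (fun v => plus (X v) (Y v)) (fun v => plus (X' v) (Y' v)).
Proof. intros HX HY k l. rewrite !ent_plus HX HY. ring. Qed.

Lemma wrel_opp p q X X' : wrel p q X X' ->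
  wrel p q (fun v => opp (X v)) (fun v => opp (X' v)).
Proof. intros HX k l. rewrite !ent_opp HX. ring. Qed.

(** Leibniz rule: p_k - q_l = (p_k - r_j) + (r_j - q_l) under the sum over j. The intermediate
    weight r is free, so a commutator on one factor can be combined with a one-sided weight on the
    other. *)
Lemma wrel_comp p r q X X' Y Y' : is_linear X -> is_linear X' ->
  wrel p r X X' -> wrel r q Y Y' ->
  wrel p q (fun v => X (Y v)) (fun v => plus (X' (Y v)) (X (Y' v))).
Proof.
  intros LX LX' HX HY k l. rewrite ent_plus.
  apply (is_series_unique' (K := C_AbsRing) (V := C_NormedModule) (fun j => Cplus
    (Cmult (ent X' k j) (ent Y j l)) (Cmult (ent X k j) (ent Y' j l)))).
  - exact (is_series_plus _ _ _ _ (ent_comp X' Y k l LX') (ent_comp X Y' k l LX)).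
  - pose proof (linear_series (fun z : C_NormedModule => scal (RtoC (p k - q l) : C_AbsRing) z)
      _ _ (is_linear_scal_r _ Cmult_comm) (ent_comp X Y k l LX)) as HS.
    apply is_series_ext with (2 := HS). intros j.
    rewrite HX HY. unfold scal; simpl. rewrite /mult /=.
    replace (p k - q l) with ((p k - r j) + (r j - q l)) by ring.
    rewrite RtoC_plus. ring.
Qed.

(** * The shift and its adjoint *)

Context {U Us : H -> H} (hU : is_unilateral_shift E U) (hUs : is_adjoint ip U Us).

Lemma coord_U v k :
  ip (U v) (E k) = match k with O => RtoC 0 | S j => ip v (E j) end.
Proof.
  destruct hU as [LU UE].
  assert (HL : is_linear (fun v => coord k (U v)))
    by (apply (is_linear_comp U (coord k)); auto; apply is_linear_coord).
  destruct k as [|k].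
  - apply (linear_E_ext (fun v => coord 0 (U v)) (fun _ => zero)); auto.
    + apply is_linear_zero.
    + intros l. unfold coord. rewrite UE ip_E. now destruct (Nat.eq_dec (S l) 0).
  - apply (linear_E_ext (fun v => coord (S k) (U v)) (coord k)); auto.
    + apply is_linear_coord.
    + intros l. unfold coord. rewrite UE !ip_E.
      destruct (Nat.eq_dec (S l) (S k)), (Nat.eq_dec l k); auto; lia.
Qed.

Lemma coord_Us v k : ip (Us v) (E k) = ip v (E (S k)).
Proof.
  rewrite (ip_conj _ hip) -hUs (proj2 hU) -(ip_conj _ hip) //.
Qed.

Lemma Us_U v : Us (U v) = v.
Proof. apply coord_ext; intros k. rewrite coord_Us coord_U //. Qed.

Lemma norm_U v : norm (U v) <= norm v.
Proof.
  apply norm_le_of_sq. rewrite !norm_sq hUs Us_U. apply Rle_refl.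
Qed.

(** Since [Us] inverts [U] on the left, the squared norm of v - U Us v is the difference of the
    squared norms of v and Us v. *)
Lemma norm_Us v : norm (Us v) <= norm v.
Proof.
  apply norm_le_of_sq.
  assert (Hw : ip (plus v (opp (U (Us v)))) (plus v (opp (U (Us v)))) =
    Cplus (ip v v) (Copp (ip (Us v) (Us v)))).
  { rewrite !(ip_plus _ hip) !ip_plus_r !ip_opp_l !ip_opp_r.
    rewrite (ip_conj _ hip (U (Us v)) v) !hUs Us_U.
    rewrite (ip_norm _ hip (Us v)).
    assert (Hc : Cconj (RtoC (norm (Us v) ^ 2)) = RtoC (norm (Us v) ^ 2)).
    { apply injective_projections; simpl; ring. }
    rewrite Hc. ring. }
  rewrite !(ip_norm _ hip) in Hw. apply (f_equal Re) in Hw. simpl in Hw.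
  pose proof (Rle_0_sqr (norm (plus v (opp (U (Us v)))))) as Hp. unfold Rsqr in Hp.
  simpl. lra.
Qed.

(** The adjoint is given as a mere map: linearity is read off from its coordinates, boundedness from
    [norm_Us]. *)
Lemma is_linear_Us : is_linear Us.
Proof.
  split.
  - intros x y; apply coord_ext; intros k.
    rewrite (ip_plus _ hip) !coord_Us (ip_plus _ hip) //.
  - intros z x; apply coord_ext; intros k.
    rewrite (ip_scal _ hip) !coord_Us (ip_scal _ hip) //.
  - exists 1; split; [lra|]. intros v; rewrite Rmult_1_l; apply norm_Us.
Qed.

Lemma ent_iter_U n k l :
  ent (fun v => Nat.iter n U v) k l = if Nat.eq_dec k (n + l) then RtoC 1 else RtoC 0.
Proof.
  unfold ent. revert k; induction n as [|n IH]; intros k; simpl.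
  - rewrite ip_E. destruct (Nat.eq_dec l k), (Nat.eq_dec k l); auto; lia.
  - rewrite coord_U. destruct k as [|k].
    + destruct (Nat.eq_dec 0 (S (n + l))); auto; lia.
    + rewrite IH. destruct (Nat.eq_dec k (n + l)), (Nat.eq_dec (S k) (S (n + l))); auto; lia.
Qed.

Lemma ent_iter_Us n k l :
  ent (fun v => Nat.iter n Us v) k l = if Nat.eq_dec l (n + k) then RtoC 1 else RtoC 0.
Proof.
  unfold ent. revert k; induction n as [|n IH]; intros k; simpl.
  - rewrite ip_E //.
  - rewrite coord_Us IH.
    destruct (Nat.eq_dec l (n + S k)), (Nat.eq_dec l (S (n + k))); auto; lia.
Qed.

Lemma ent_toeplitz_pos (p : nat -> C) A k l :
  is_op_series (fun n v => scal (p n) (Nat.iter n U v)) A ->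
  ent A k l = if le_dec l k then p (k - l)%nat else RtoC 0.
Proof.
  intros HA. pose proof (ent_op_series _ _ k l HA) as HS.
  assert (Ht : forall n, ent (fun v => scal (p n) (Nat.iter n U v)) k l =
    if Nat.eq_dec k (n + l) then p n else RtoC 0).
  { intros n. rewrite ent_scal ent_iter_U. destruct (Nat.eq_dec k (n + l)); ring. }
  apply (is_series_unique' _ _ _ HS).
  apply (is_series_ext (K := C_AbsRing) (V := C_NormedModule)
    (fun n => if Nat.eq_dec k (n + l) then p n else RtoC 0)).
  { intros n; symmetry; apply Ht. }
  (* Only the term n = k - l can survive. For k < l the truncated subtraction gives n = 0, whose
     term vanishes as well. *)
  pose proof (is_series_single (K := C_AbsRing) (V := C_NormedModule)
    (fun n => if Nat.eq_dec k (n + l) then p n else RtoC 0) (k - l)) as Hs.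
  simpl in Hs. destruct (le_dec l k) as [Hlk|Hlk].
  - destruct (Nat.eq_dec k (k - l + l)); [|lia]. apply Hs.
    intros j Hj; destruct (Nat.eq_dec k (j + l)); [lia|reflexivity].
  - destruct (Nat.eq_dec k (k - l + l)); [lia|]. apply Hs.
    intros j Hj; destruct (Nat.eq_dec k (j + l)); [lia|reflexivity].
Qed.

Lemma ent_toeplitz_neg (p : nat -> C) A k l :
  is_op_series (fun n v => scal (p n) (Nat.iter (S n) Us v)) A ->
  ent A k l = if le_dec l k then RtoC 0 else p (l - k - 1)%nat.
Proof.
  intros HA. pose proof (ent_op_series _ _ k l HA) as HS.
  set (d := fun n => if Nat.eq_dec l (S n + k) then p n else RtoC 0).
  assert (Ht : forall n, ent (fun v => scal (p n) (Nat.iter (S n) Us v)) k l = d n).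
  { intros n. rewrite ent_scal ent_iter_Us. unfold d.
    destruct (Nat.eq_dec l (S n + k)); ring. }
  apply (is_series_unique' _ _ _ HS).
  apply (is_series_ext (K := C_AbsRing) (V := C_NormedModule) d).
  { intros n; symmetry; apply Ht. }
  pose proof (is_series_single (K := C_AbsRing) (V := C_NormedModule) d (l - k - 1)) as Hs.
  unfold d in *. destruct (le_dec l k) as [Hlk|Hlk].
  - destruct (Nat.eq_dec l (S (l - k - 1) + k)); [lia|]. apply Hs.
    intros j Hj; destruct (Nat.eq_dec l (S j + k)); [lia|reflexivity].
  - destruct (Nat.eq_dec l (S (l - k - 1) + k)); [|lia]. apply Hs.
    intros j Hj; destruct (Nat.eq_dec l (S j + k)); [lia|reflexivity].
Qed.

Lemma ent_toeplitz f A k l : is_toeplitz U Us f A ->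
  ent A k l = fourier_coef f (Z.of_nat k - Z.of_nat l).
Proof.
  intros (Ap & Am & HAp & HAm & HA).
  assert (He : ent A k l = Cplus (ent Ap k l) (ent Am k l)).
  { unfold ent. rewrite HA. apply (ip_plus _ hip). }
  rewrite He (ent_toeplitz_pos (fun n => fourier_coef f (Z.of_nat n)) Ap k l HAp)
    (ent_toeplitz_neg (fun n => fourier_coef f (- Z.of_nat (S n))) Am k l HAm).
  destruct (le_dec l k) as [Hlk|Hlk].
  - rewrite Cplus_0_r. f_equal. lia.
  - rewrite Cplus_0_l. f_equal. lia.
Qed.

Lemma ent_matrix_unit i j k l :
  ent (matrix_unit ip E i j) k l =
    if Nat.eq_dec i k then if Nat.eq_dec j l then RtoC 1 else RtoC 0 else RtoC 0.
Proof.
  unfold ent, matrix_unit. rewrite (ip_scal _ hip) !ip_E.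
  destruct (Nat.eq_dec l j), (Nat.eq_dec i k), (Nat.eq_dec j l); try lia; ring.
Qed.

Lemma ent_sum_n (X : nat -> H -> H) N k l :
  ent (fun v => sum_n (fun n => X n v) N) k l = sum_n (fun n => ent (X n) k l) N.
Proof. exact (linear_sum_n (coord k) (fun n => X n (E l)) N (is_linear_coord k)). Qed.

Lemma ent_smooth_compact (c : nat -> nat -> C) a k l :
  is_op_lim (fun N v => sum_n (fun i => sum_n (fun j =>
    scal (c i j) (matrix_unit ip E i j v)) N) N) a -> ent a k l = c k l.
Proof.
  intros Ha. pose proof (ent_op_lim _ _ k l Ha) as HL.
  apply (filterlim_locally_unique (K := C_AbsRing) (V := C_NormedModule) _ _ _ HL).
  apply filterlim_ext_loc with (fun _ => c k l); [|apply filterlim_const].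
  exists (k + l)%nat; intros N HN. symmetry.
  rewrite (ent_sum_n (fun i v => sum_n (fun j => scal (c i j) (matrix_unit ip E i j v)) N)).
  assert (Ht : forall i j, ent (fun v => scal (c i j) (matrix_unit ip E i j v)) k l =
    if Nat.eq_dec i k then if Nat.eq_dec j l then c i j else RtoC 0 else RtoC 0).
  { intros i j. rewrite ent_scal ent_matrix_unit.
    destruct (Nat.eq_dec i k), (Nat.eq_dec j l); ring. }
  rewrite (sum_n_single _ k N ltac:(lia)).
  - rewrite (ent_sum_n (fun j v => scal (c k j) (matrix_unit ip E k j v))).
    rewrite (sum_n_single _ l N ltac:(lia)).
    + rewrite Ht. destruct (Nat.eq_dec k k), (Nat.eq_dec l l); auto; lia.
    + intros j Hj. rewrite Ht. destruct (Nat.eq_dec k k), (Nat.eq_dec j l); auto; lia.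
  - intros i Hi. rewrite (ent_sum_n (fun j v => scal (c i j) (matrix_unit ip E i j v))).
    rewrite (sum_n_ext _ (fun _ => zero)).
    + clear. induction N as [|N IH]; [rewrite sum_O //|]. rewrite sum_Sn IH plus_zero_l //.
    + intros j. rewrite Ht. destruct (Nat.eq_dec i k); auto; lia.
Qed.

End Hilbert.

Arguments ent {H} ip E X k l.
Arguments wrel {H} ip E p q X Y.

(** * Operators with prescribed matrix entries *)

Section Construction.

Context {H : CompleteNormedModule C_AbsRing} {ip : H -> H -> C}
  (hip : is_inner_product ip) {E : nat -> H} (hE : is_orthonormal_basis ip E).
Context {U Us : H -> H} (hU : is_unilateral_shift E U) (hUs : is_adjoint ip U Us).

Lemma is_linear_matrix_unit k l : is_linear (matrix_unit ip E k l).
Proof.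
  split.
  - intros u v. unfold matrix_unit. rewrite (ip_plus _ hip).
    exact (scal_distr_r (ip u (E l) : C_AbsRing) (ip v (E l)) (E k)).
  - intros z u. unfold matrix_unit. rewrite (ip_scal _ hip).
    symmetry; exact (scal_assoc (z : C_AbsRing) (ip u (E l)) (E k)).
  - exists 1; split; [lra|]. intros v. unfold matrix_unit.
    eapply Rle_trans; [apply norm_scal_le|].
    rewrite (norm_E hip hE) Rmult_1_r Rmult_1_l. apply (coord_bound hip hE).
Qed.

Lemma norm_matrix_unit k l v : norm (matrix_unit ip E k l v) <= norm v.
Proof.
  unfold matrix_unit. eapply Rle_trans; [apply norm_scal_le|].
  rewrite (norm_E hip hE) Rmult_1_r. apply (coord_bound hip hE).
Qed.

Lemma op_series_scal (s : nat -> C) (X : nat -> H -> H) :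
  rapid (fun n => Cmod (s n)) -> (forall n, is_linear (X n)) ->
  (forall n v, norm (X n v) <= norm v) ->
  exists a, is_linear a /\ is_op_series (fun n v => scal (s n) (X n v)) a.
Proof.
  intros Hs HX Hn. apply (op_series_exists _ (fun n => Cmod (s n))).
  - intros n; now apply is_linear_scal_comp.
  - intros n v. eapply Rle_trans; [apply norm_scal_le|].
    apply Rmult_le_compat_l; [apply Cmod_ge_0|auto].
  - apply ex_series_ext with (fun n => Rabs (Cmod (s n))).
    + intros n; apply Rabs_pos_eq, Cmod_ge_0.
    + now apply rapid_ex_series_Rabs.
Qed.

Lemma rapid_shift s : rapid s -> rapid (fun n => s (S n)).
Proof.
  intros Hs M; destruct (Hs M) as [B HB]; exists B; intros n.
  eapply Rle_trans; [|apply (HB (S n))]. apply Rmult_le_compat_r; [apply Rabs_pos|].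
  apply pow_incr. rewrite S_INR. pose proof (pos_INR n); lra.
Qed.

Lemma sum_n_inv_sq_le : exists Z, 0 <= Z /\
  forall N, sum_n (fun n => / (1 + INR n) ^ 2) N <= Z.
Proof.
  destruct ex_series_inv_sq as [Z HZ]. exists Z.
  assert (H0 : forall n, 0 <= / (1 + INR n) ^ 2).
  { intros n; left; apply Rinv_0_lt_compat, pow_lt, one_plus_INR_pos. }
  assert (HN : forall N, sum_n (fun n => / (1 + INR n) ^ 2) N <= Z)
    by (intros; now apply partial_sum_le).
  split; auto. eapply Rle_trans; [|apply (HN O)]. rewrite sum_O. apply H0.
Qed.

Lemma sum_n_const_mult (K : R) (f : nat -> R) N :
  sum_n (fun n => K * f n) N = K * sum_n f N.
Proof. exact (sum_n_mult_l K f N). Qed.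

Lemma compact_exists (c : nat -> nat -> C) : rapidly_decaying c ->
  exists a, is_linear a /\ is_op_lim (fun N v => sum_n (fun k => sum_n (fun l =>
    scal (c k l) (matrix_unit ip E k l v)) N) N) a.
Proof.
  intros Hc. destruct (Hc 2%nat 2%nat) as [B0 HB0]. set (B := Rabs B0).
  assert (HB : forall k l, Cmod (c k l) <= B * / (1 + INR k) ^ 2 * / (1 + INR l) ^ 2).
  { intros k l. specialize (HB0 k l).
    assert (Hk : 0 < (1 + INR k) ^ 2) by (apply pow_lt, one_plus_INR_pos).
    assert (Hl : 0 < (1 + INR l) ^ 2) by (apply pow_lt, one_plus_INR_pos).
    apply Rmult_le_reg_l with ((1 + INR k) ^ 2 * (1 + INR l) ^ 2).
    - apply Rmult_lt_0_compat; auto.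
    - eapply Rle_trans; [exact HB0|]. eapply Rle_trans; [apply Rle_abs|].
      fold B. right. field.
      pose proof (one_plus_INR_pos k); pose proof (one_plus_INR_pos l); lra. }
  destruct sum_n_inv_sq_le as (Z & HZ0 & HZ).
  (* The squares grow by one row and one column at a time. *)
  set (T := fun k l v => scal (c k l) (matrix_unit ip E k l v)).
  set (A := fun n v => match n with
    | O => T O O v
    | S m => plus (sum_n (fun k => T k n v) m) (sum_n (fun l => T n l v) n)
    end).
  assert (HT : forall k l, is_linear (T k l)).
  { intros k l. apply is_linear_scal_comp, is_linear_matrix_unit. }
  assert (HTn : forall k l v, norm (T k l v) <= Cmod (c k l) * norm v).
  { intros k l v. unfold T. eapply Rle_trans; [apply norm_scal_le|].
    apply Rmult_le_compat_l; [apply Cmod_ge_0|apply norm_matrix_unit]. }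
  assert (HB00 : 0 <= B) by apply Rabs_pos.
  assert (Hi : forall n, 0 <= / (1 + INR n) ^ 2).
  { intros n; left; apply Rinv_0_lt_compat, pow_lt, one_plus_INR_pos. }
  assert (Hline : forall (t : nat -> H) n N (v : H),
    (forall j, norm (t j) <= B * / (1 + INR n) ^ 2 * / (1 + INR j) ^ 2 * norm v) ->
    norm (sum_n t N) <= B * / (1 + INR n) ^ 2 * Z * norm v).
  { intros t n N v Ht. eapply Rle_trans.
    { apply (norm_sum_n_le t
        (fun j => B * / (1 + INR n) ^ 2 * norm v * / (1 + INR j) ^ 2)).
      intros j. specialize (Ht j). lra. }
    rewrite (sum_n_const_mult (B * / (1 + INR n) ^ 2 * norm v) (fun j => / (1 + INR j) ^ 2)).
    replace (B * / (1 + INR n) ^ 2 * Z * norm v) with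
      (B * / (1 + INR n) ^ 2 * norm v * Z) by ring.
    apply Rmult_le_compat_l; auto. apply Rmult_le_pos; [|apply norm_ge_0].
    apply Rmult_le_pos; auto. }
  assert (HTB : forall k l v,
    norm (T k l v) <= B * / (1 + INR k) ^ 2 * / (1 + INR l) ^ 2 * norm v).
  { intros k l v. eapply Rle_trans; [apply HTn|].
    apply Rmult_le_compat_r; [apply norm_ge_0|apply HB]. }
  assert (Hrow : forall n N v, norm (sum_n (fun l => T n l v) N) <=
      B * / (1 + INR n) ^ 2 * Z * norm v).
  { intros n N v; apply Hline; intros j; apply HTB. }
  assert (Hcol : forall n N v, norm (sum_n (fun k => T k n v) N) <=
      B * / (1 + INR n) ^ 2 * Z * norm v).
  { intros n N v; apply Hline; intros j.
    eapply Rle_trans; [apply HTB|right; ring]. }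
  (* A shell consists of a piece of a column and a piece of a row, each of norm at most B Z / (1 +
     n)^2. *)
  destruct (op_series_exists A (fun n => 2 * B * Z * / (1 + INR n) ^ 2)) as (a & Ha & HS).
  - intros [|n]; [apply HT|]. apply (is_linear_plus_op (fun v => sum_n (fun k => T k (S n) v) n)
      (fun v => sum_n (fun l => T (S n) l v) (S n))).
    + apply (is_linear_sum_n_op (fun k => T k (S n)) n); auto.
    + apply (is_linear_sum_n_op (T (S n)) (S n)); auto.
  - intros n v.
    assert (Hnn : norm (A n v) <= B * / (1 + INR n) ^ 2 * Z * norm v +
      B * / (1 + INR n) ^ 2 * Z * norm v).
    { destruct n as [|n].
      - specialize (Hrow O O v). rewrite sum_O in Hrow.
        pose proof (norm_ge_0 (T O O v)). change (A O v) with (T O O v). lra.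
      - eapply Rle_trans; [apply: norm_triangle|]. apply Rplus_le_compat; auto. }
    eapply Rle_trans; [exact Hnn|]. right; ring.
  - apply: (ex_series_scal_l (2 * B * Z)). apply ex_series_inv_sq.
  - exists a; split; auto.
    assert (Hsum : forall N v, sum_n (fun n => A n v) N =
      sum_n (fun k => sum_n (fun l => T k l v) N) N).
    { intros N v; induction N as [|N IH]; [now rewrite !sum_O|].
      rewrite sum_Sn IH (sum_Sn (fun k => sum_n (fun l => T k l v) (S N))).
      rewrite (sum_n_ext (fun k => sum_n (fun l => T k l v) (S N))
        (fun k => plus (sum_n (fun l => T k l v) N) (T k (S N) v))).
      - rewrite sum_n_plus -plus_assoc //.
      - intros k; apply sum_Sn. }
    intros eps. destruct (HS eps) as [N HN]. exists N; intros n Hn v.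
    rewrite -(Hsum n v). now apply HN.
Qed.

Lemma toeplitz_exists (p : Z -> C) : rapidZ p ->
  exists Ap Am, is_linear Ap /\ is_linear Am /\
    is_op_series (fun n v => scal (p (Z.of_nat n)) (Nat.iter n U v)) Ap /\
    is_op_series (fun n v => scal (p (- Z.of_nat (S n))%Z) (Nat.iter (S n) Us v)) Am.
Proof.
  intros Hp.
  destruct (op_series_scal (fun n => p (Z.of_nat n)) (fun n v => Nat.iter n U v))
    as (Ap & HAp & SAp).
  - now apply rapidZ_of_nat.
  - intros n; apply iter_linear, hU.
  - intros n; apply iter_norm, (norm_U hip hE hU hUs).
  - destruct (op_series_scal (fun n => p (- Z.of_nat (S n))%Z)
      (fun n v => Nat.iter (S n) Us v)) as (Am & HAm & SAm).
    + apply (rapid_shift (fun n => Cmod (p (- Z.of_nat n)%Z))).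
      apply (rapidZ_of_nat (fun z => p (- z)%Z)). now apply rapidZ_opp.
    + intros n; apply iter_linear, (is_linear_Us hip hE hU hUs).
    + intros n; apply iter_norm, (norm_Us hip hE hU hUs).
    + exists Ap, Am; auto.
Qed.

Lemma toeplitz_compact_exists (p : Z -> C) (c : nat -> nat -> C) :
  rapidZ p -> rapidly_decaying c -> exists Ap Am K X,
    is_op_series (fun n v => scal (p (Z.of_nat n)) (Nat.iter n U v)) Ap /\
    is_op_series (fun n v => scal (p (- Z.of_nat (S n))%Z) (Nat.iter (S n) Us v)) Am /\
    is_op_lim (fun N v => sum_n (fun k => sum_n (fun l =>
      scal (c k l) (matrix_unit ip E k l v)) N) N) K /\
    (forall v, X v = plus (plus (Ap v) (Am v)) (K v)) /\ is_linear X /\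
    forall k l, ent ip E X k l =
      Cplus (p (Z.of_nat k - Z.of_nat l)%Z) (c k l).
Proof.
  intros Hp Hc.
  destruct (toeplitz_exists p Hp) as (Ap & Am & LAp & LAm & SAp & SAm).
  destruct (compact_exists c Hc) as (K & LK & SK).
  exists Ap, Am, K, (fun v => plus (plus (Ap v) (Am v)) (K v)).
  split; [auto|split; [auto|split; [auto|split; [auto|split]]]].
  - apply is_linear_plus_op; auto. now apply is_linear_plus_op.
  - intros k l.
    rewrite (ent_plus hip (fun v => plus (Ap v) (Am v)) K) (ent_plus hip Ap Am).
    rewrite (ent_smooth_compact hip hE c K k l SK).
    rewrite (ent_toeplitz_pos hip hE hU (fun n => p (Z.of_nat n)) Ap k l SAp).
    rewrite (ent_toeplitz_neg hip hE hU hUs (fun n => p (- Z.of_nat (S n))%Z) Am k l SAm).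
    f_equal. destruct (le_dec l k) as [Hlk|Hlk].
    + rewrite Cplus_0_r. f_equal. lia.
    + rewrite Cplus_0_l. f_equal. lia.
Qed.

Lemma operator_exists (p : Z -> C) (c : nat -> nat -> C) :
  rapidZ p -> rapidly_decaying c -> exists X, is_linear X /\
    forall k l, ent ip E X k l =
      Cplus (p (Z.of_nat k - Z.of_nat l)%Z) (c k l).
Proof.
  intros Hp Hc.
  destruct (toeplitz_compact_exists p c Hp Hc) as (_ & _ & _ & X & _ & _ & _ & _ & HX).
  now exists X.
Qed.

(** Reduces membership to matrix entries: the operator built from p and c has the entries of b, and
    bounded operators with equal entries coincide. *)
Lemma smooth_toeplitz_of_entries (p : Z -> C) (c : nat -> nat -> C) b :
  rapidZ p -> rapidly_decaying c -> is_linear b ->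
  (forall k l, ent ip E b k l =
    Cplus (p (Z.of_nat k - Z.of_nat l)%Z) (c k l)) ->
  smooth_toeplitz ip E U Us b.
Proof.
  intros Hp Hc Hb He.
  destruct (exists_smooth_circle p Hp) as (g & Hg & Hgp).
  destruct (toeplitz_compact_exists p c Hp Hc)
    as (Ap & Am & K & X & SAp & SAm & SK & HX & LX & HeX).
  exists g, (fun v => plus (Ap v) (Am v)), K.
  split; [auto|split; [|split; [now exists c|]]].
  - exists Ap, Am. split; [|split; [|reflexivity]].
    + replace (fun n v => scal (fourier_coef g (Z.of_nat n)) (Nat.iter n U v)) with
        (fun n v => scal (p (Z.of_nat n)) (Nat.iter n U v)); auto.
      extensionality n; extensionality v; now rewrite Hgp.
    + replace (fun n v => scal (fourier_coef g (- Z.of_nat (S n))) (Nat.iter (S n) Us v)) with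
        (fun n v => scal (p (- Z.of_nat (S n))%Z) (Nat.iter (S n) Us v)); auto.
      extensionality n; extensionality v; now rewrite Hgp.
  - intros v. rewrite -HX. apply (op_ext hE b X); auto.
    intros k l. rewrite He HeX //.
Qed.

End Construction.

(** * Families of operators with polynomially bounded seminorms *)

Definition poly_bounded {H : CompleteNormedModule C_AbsRing} (X : nat -> H -> H) : Prop :=
  exists C M, 0 <= C /\ forall n v, norm (X n v) <= C * (1 + INR n) ^ M * norm v.

(* Compositions of two families, covering both [X n o Y n] and the convolution
   [sum_(k <= n) X (n - k) o Y k]; the [Nat.min] in [conv] is the identity on the
   range of summation. *)
Definition bil {H : CompleteNormedModule C_AbsRing} (i j : nat -> nat -> nat)
    (len : nat -> nat) (X Y : nat -> H -> H) (n : nat) (v : H) : H :=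
  sum_n (fun k => X (i n k) (Y (j n k) v)) (len n).

Definition mul {H : CompleteNormedModule C_AbsRing} := @bil H (fun n _ => n) (fun n _ => n) (fun _ => O).
Definition conv {H : CompleteNormedModule C_AbsRing} := @bil H (fun n k => (n - k)%nat) (fun n k => Nat.min k n) (fun n => n).

(** Both the indices of the factors and the number of summands are controlled by the outer index,
    which keeps growth polynomial under composition. *)
Definition index_le (i j : nat -> nat -> nat) (len : nat -> nat) : Prop :=
  forall n, (len n <= n)%nat /\ forall k, (i n k <= n)%nat /\ (j n k <= n)%nat.

(** These weights put commutators with L and one-sided products with 1 + L into one format. The
    added 1 cancels in [w1 k - w1 l], and it makes the one-sided weights, up to sign, those of
    [rapidly_decaying]. *)
Definition w0 : nat -> R := fun _ => 0.
Definition w1 : nat -> R := fun k => 1 + INR k.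

Definition two_sided (p q : nat -> R) : Prop := p = w1 /\ q = w1.
Definition one_sided (p q : nat -> R) : Prop := (p = w1 /\ q = w0) \/ (p = w0 /\ q = w1).

Section Families.

Context {H : CompleteNormedModule C_AbsRing} {ip : H -> H -> C}
  (hip : is_inner_product ip) {E : nat -> H} (hE : is_orthonormal_basis ip E).

Notation weighted := (wrel ip E).
Notation entry := (ent ip E).

(* All weighted matrices obtained from [X] by at most [N] weights from [W] are
   again families of bounded operators with norms polynomial in the index: for
   [two_sided] this is off-diagonal decay, for [one_sided] it is membership in
   K^oo, both uniformly up to a polynomial factor. *)
Fixpoint Fam (W : (nat -> R) -> (nat -> R) -> Prop) (N : nat) (X : nat -> H -> H) : Prop :=
  (forall n, is_linear (X n)) /\ poly_bounded X /\
  match N with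
  | O => True
  | S N' => forall p q, W p q ->
      exists Y, (forall n, weighted p q (X n) (Y n)) /\ Fam W N' Y
  end.

Lemma Fam_linear W N X : Fam W N X -> forall n, is_linear (X n).
Proof. destruct N; intros [HX _]; exact HX. Qed.

Lemma Fam_poly W N X : Fam W N X -> poly_bounded X.
Proof. destruct N; intros (_ & HX & _); exact HX. Qed.

Lemma Fam_pred W N X : Fam W (S N) X -> Fam W N X.
Proof.
  revert X; induction N as [|N IH]; intros X (H1 & H2 & H3); (split; [|split]); auto.
  intros p q Hpq. destruct (H3 p q Hpq) as (Y & HY & FY). exists Y; auto.
Qed.

Lemma is_linear_zero_H : is_linear (fun _ : H => (zero : H)).
Proof.
  exact (is_linear_zero (U := CompleteNormedModule.NormedModule _ H)
    (V := CompleteNormedModule.NormedModule _ H)).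
Qed.

Lemma pow_1_plus_le n M M' : (M <= M')%nat -> (1 + INR n) ^ M <= (1 + INR n) ^ M'.
Proof. intros; apply Rle_pow; auto. apply one_plus_INR_ge1. Qed.

Lemma pow_1_plus_mono k n M : (k <= n)%nat -> (1 + INR k) ^ M <= (1 + INR n) ^ M.
Proof.
  intros Hkn; apply pow_incr. apply le_INR in Hkn. pose proof (pos_INR k); lra.
Qed.

Lemma pow_1_plus_pos n M : 0 < (1 + INR n) ^ M.
Proof. apply pow_lt, one_plus_INR_pos. Qed.

Lemma poly_bounded_plus X Y : poly_bounded X -> poly_bounded Y ->
  poly_bounded (fun n (v : H) => plus (X n v) (Y n v)).
Proof.
  intros (C & M & HC & HX) (C' & M' & HC' & HY).
  exists (C + C'), (M + M')%nat; split; [lra|]. intros n v.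
  eapply Rle_trans; [apply: norm_triangle|].
  specialize (HX n v); specialize (HY n v).
  pose proof (norm_ge_0 v) as Hv.
  pose proof (pow_1_plus_le n M (M + M') ltac:(lia)) as P1.
  pose proof (pow_1_plus_le n M' (M + M') ltac:(lia)) as P2.
  apply (Rmult_le_compat_l C) in P1; auto. apply (Rmult_le_compat_l C') in P2; auto.
  apply (Rmult_le_compat_r (norm v)) in P1; auto. apply (Rmult_le_compat_r (norm v)) in P2; auto.
  lra.
Qed.

Lemma poly_bounded_const (X : H -> H) : is_linear X -> poly_bounded (fun _ => X).
Proof.
  intros HX; destruct (linear_norm X HX) as (M & HM & Hb).
  exists M, O; split; [lra|]. intros n v. rewrite /= Rmult_1_r. apply Hb.
Qed.

(** The growth exponents of the factors add up, and the at most n + 1 summands cost one more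
    power. *)
Lemma poly_bounded_bil i j len X Y : index_le i j len ->
  poly_bounded X -> poly_bounded Y -> poly_bounded (bil (H := H) i j len X Y).
Proof.
  intros Hix (C & M & HC & HX) (C' & M' & HC' & HY).
  exists (C * C'), (M + M' + 1)%nat; split; [now apply Rmult_le_pos|]. intros n v.
  destruct (Hix n) as [Hlen Hij]. unfold bil.
  pose proof (norm_ge_0 v) as Hv.
  set (K := C * C' * (1 + INR n) ^ (M + M') * norm v).
  assert (HK : 0 <= K).
  { unfold K. repeat apply Rmult_le_pos; auto. left; apply pow_1_plus_pos. }
  eapply Rle_trans.
  { apply (norm_sum_n_le (fun k => X (i n k) (Y (j n k) v)) (fun _ => K)). intros k. destruct (Hij k) as [Hi Hj].
    eapply Rle_trans; [apply HX|].
    eapply Rle_trans.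
    { apply Rmult_le_compat_l; [|apply HY].
      apply Rmult_le_pos; auto. left; apply pow_1_plus_pos. }
    unfold K. rewrite pow_add.
    replace (C * C' * ((1 + INR n) ^ M * (1 + INR n) ^ M') * norm v) with
      (C * (1 + INR n) ^ M * (C' * (1 + INR n) ^ M' * norm v)) by ring.
    apply Rmult_le_compat.
    - apply Rmult_le_pos; auto. left; apply pow_1_plus_pos.
    - repeat apply Rmult_le_pos; auto. left; apply pow_1_plus_pos.
    - apply Rmult_le_compat_l; auto. now apply pow_1_plus_mono.
    - apply Rmult_le_compat_r; auto. apply Rmult_le_compat_l; auto.
      now apply pow_1_plus_mono. }
  rewrite sum_n_const.
  replace (C * C' * (1 + INR n) ^ (M + M' + 1) * norm v) with ((1 + INR n) * K)
    by (unfold K; rewrite (pow_add _ (M + M') 1) pow_1; ring).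
  apply Rmult_le_compat_r; auto. apply le_INR in Hlen. rewrite S_INR; lra.
Qed.

Lemma Fam_zero W N : Fam W N (fun _ _ => zero).
Proof.
  induction N as [|N IH]; (split; [intros; apply is_linear_zero_H|split]); auto;
    try (apply poly_bounded_const, is_linear_zero_H).
  intros p q _; exists (fun _ _ => zero); split; auto.
  intros n k l. rewrite !(ent_zero hip hE). ring.
Qed.

Lemma Fam_plus W N X Y : Fam W N X -> Fam W N Y ->
  Fam W N (fun n v => plus (X n v) (Y n v)).
Proof.
  revert X Y; induction N as [|N IH]; intros X Y (LX & PX & DX) (LY & PY & DY);
    (split; [intros n; apply (is_linear_plus_op (X n) (Y n)); auto|
     split; [now apply poly_bounded_plus|]]); auto.
  intros p q Hpq. destruct (DX p q Hpq) as (X' & RX & FX), (DY p q Hpq) as (Y' & RY & FY).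
  exists (fun n v => plus (X' n v) (Y' n v)); split; auto.
  intros n; apply (wrel_plus hip); auto.
Qed.

Lemma is_linear_bil i j len X Y n :
  (forall n, is_linear (X n)) -> (forall n, is_linear (Y n)) ->
  is_linear (bil (H := H) i j len X Y n).
Proof.
  intros LX LY. apply (is_linear_sum_n_op (fun k v => X (i n k) (Y (j n k) v))).
  intros k; apply (is_linear_comp (Y (j n k)) (X (i n k))); auto.
Qed.

(** Diagonal matrices commute. The instances used are zero and the identity, the starting values of
    the Chebyshev recurrence. *)
Lemma wrel_self_zero p (X : H -> H) : (forall k l, k <> l -> entry X k l = RtoC 0) ->
  weighted p p X (fun _ => zero).
Proof.
  intros HX k l. rewrite (ent_zero hip hE). destruct (Nat.eq_dec k l) as [->|Hn].
  - rewrite Rminus_diag. ring.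
  - rewrite HX; auto. ring.
Qed.

Lemma wrel_sum_n p q (X X' : nat -> H -> H) N : (forall k, weighted p q (X k) (X' k)) ->
  weighted p q (fun v => sum_n (fun k => X k v) N) (fun v => sum_n (fun k => X' k v) N).
Proof.
  intros HX; induction N as [|N IH]; intros k l.
  - rewrite !(ent_sum_n hip hE) !sum_O. apply HX.
  - rewrite !(ent_sum_n hip hE) !sum_Sn. specialize (IH k l).
    rewrite !(ent_sum_n hip hE) in IH. rewrite IH HX. rewrite /plus /=. ring.
Qed.

(** [wrel_comp] splits a weight on the product at some r. Each factor then carries either a weight
    admissible for it or the weight pair (0, 0), whose weighted matrix is zero; in both cases the
    result is a family one level lower, and the induction closes. *)
Lemma Fam_bil (WX WY W : (nat -> R) -> (nat -> R) -> Prop) i j len N X Y :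
  index_le i j len ->
  (forall p q, W p q -> exists r,
    (WX p r \/ (p = w0 /\ r = w0)) /\ (WY r q \/ (r = w0 /\ q = w0))) ->
  Fam WX N X -> Fam WY N Y -> Fam W N (bil i j len X Y).
Proof.
  intros Hix HW. revert X Y; induction N as [|N IH]; intros X Y FX FY.
  - split; [|split; auto].
    + intros n; apply is_linear_bil; [apply (Fam_linear _ _ _ FX)|apply (Fam_linear _ _ _ FY)].
    + apply poly_bounded_bil; auto; [apply (Fam_poly _ _ _ FX)|apply (Fam_poly _ _ _ FY)].
  - pose proof (Fam_pred _ _ _ FX) as PX. pose proof (Fam_pred _ _ _ FY) as PY.
    pose proof (Fam_linear _ _ _ FX) as LX. pose proof (Fam_linear _ _ _ FY) as LY.
    split; [|split].
    + intros n; now apply is_linear_bil.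
    + apply poly_bounded_bil; auto; [apply (Fam_poly _ _ _ FX)|apply (Fam_poly _ _ _ FY)].
    + destruct FX as (_ & _ & DX), FY as (_ & _ & DY).
      intros p q Hpq. destruct (HW p q Hpq) as (r & H1 & H2).
      assert (H0 : forall (W' : (nat -> R) -> (nat -> R) -> Prop) Z p' q',
        (forall p q, W' p q -> exists Y, (forall n, weighted p q (Z n) (Y n)) /\ Fam W' N Y) ->
        W' p' q' \/ (p' = w0 /\ q' = w0) ->
        exists Z', (forall n, weighted p' q' (Z n) (Z' n)) /\ Fam W' N Z').
      { intros W' Z p' q' DZ [HZ|[-> ->]]; auto.
        exists (fun _ _ => zero); split; [|apply Fam_zero].
        intros n k l. rewrite (ent_zero hip hE) /w0 Rminus_diag. ring. }
      destruct (H0 _ _ _ _ DX H1) as (X' & RX & FX').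
      destruct (H0 _ _ _ _ DY H2) as (Y' & RY & FY').
      exists (fun n v => plus (bil i j len X' Y n v) (bil i j len X Y' n v)); split.
      * intros n.
        assert (Hb : (fun v => plus (bil i j len X' Y n v) (bil i j len X Y' n v)) =
          (fun v => sum_n (fun k => plus (X' (i n k) (Y (j n k) v))
            (X (i n k) (Y' (j n k) v))) (len n))).
        { extensionality v. unfold bil. symmetry. apply: sum_n_plus. }
        rewrite Hb. apply wrel_sum_n. intros k.
        apply (wrel_comp hip hE p r q); auto. apply (Fam_linear _ _ _ FX').
      * apply Fam_plus; apply IH; auto.
Qed.

Lemma index_le_mul : index_le (fun n _ => n) (fun n _ => n) (fun _ => O).
Proof. intros n; repeat split; lia. Qed.

Lemma index_le_conv : index_le (fun n k => (n - k)%nat) (fun n k => Nat.min k n) (fun n => n).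
Proof. intros n; repeat split; lia. Qed.

Lemma leibniz_two_two p q : two_sided p q -> exists r,
  (two_sided p r \/ (p = w0 /\ r = w0)) /\ (two_sided r q \/ (r = w0 /\ q = w0)).
Proof. intros [-> ->]. exists w1; split; left; now split. Qed.

(** A row weight cannot stay on the left factor, which decays only away from the diagonal: it is
    commuted through and lands on the right factor. A column weight falls on the right factor
    directly, leaving the weight pair (0, 0) on the left one. *)
Lemma leibniz_two_one p q : one_sided p q -> exists r,
  (two_sided p r \/ (p = w0 /\ r = w0)) /\ (one_sided r q \/ (r = w0 /\ q = w0)).
Proof.
  intros [[-> ->]|[-> ->]].
  - exists w1; split; left; [now split|now left].
  - exists w0; split; [now right|left; now right].
Qed.

Lemma leibniz_one_two p q : one_sided p q -> exists r,
  (one_sided p r \/ (p = w0 /\ r = w0)) /\ (two_sided r q \/ (r = w0 /\ q = w0)).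
Proof.
  intros [[-> ->]|[-> ->]].
  - exists w0; split; [left; now left|now right].
  - exists w1; split; left; [now right|now split].
Qed.

Lemma two_sided_decay N X : Fam two_sided N X -> exists C P, 0 <= C /\
  forall n k l, Rabs (INR k - INR l) ^ N * Cmod (entry (X n) k l) <= C * (1 + INR n) ^ P.
Proof.
  revert X; induction N as [|N IH]; intros X FX.
  - destruct (Fam_poly _ _ _ FX) as (C & P & HC & HX). exists C, P; split; auto.
    intros n k l. rewrite /= Rmult_1_l. apply (ent_bound hip hE); auto.
  - destruct FX as (_ & _ & DX). destruct (DX w1 w1) as (Y & RY & FY); [now split|].
    destruct (IH Y FY) as (C & P & HC & HY). exists C, P; split; auto.
    intros n k l. specialize (HY n k l). rewrite RY Cmod_mult Cmod_R /w1 in HY.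
    replace (1 + INR k - (1 + INR l)) with (INR k - INR l) in HY by ring.
    simpl. rewrite -> (Rmult_comm (Rabs _)). rewrite Rmult_assoc. exact HY.
Qed.

(** The outer induction spends M levels on row weights, the inner one the remaining M' levels on
    column weights. *)
Lemma one_sided_decay M M' X : Fam one_sided (M + M') X -> exists C P, 0 <= C /\
  forall n k l, (1 + INR k) ^ M * (1 + INR l) ^ M' * Cmod (entry (X n) k l) <=
    C * (1 + INR n) ^ P.
Proof.
  revert X; induction M as [|M IH]; intros X FX.
  - simpl in FX. revert X FX; induction M' as [|M' IH]; intros X FX.
    + destruct (Fam_poly _ _ _ FX) as (C & P & HC & HX). exists C, P; split; auto.
      intros n k l. rewrite /= !Rmult_1_l. apply (ent_bound hip hE); auto.
    + destruct FX as (_ & _ & DX). destruct (DX w0 w1) as (Y & RY & FY); [now right|].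
      destruct (IH Y FY) as (C & P & HC & HY). exists C, P; split; auto.
      intros n k l. specialize (HY n k l).
      rewrite RY Cmod_mult Cmod_R /w1 /w0 Rminus_0_l Rabs_Ropp Rabs_pos_eq in HY;
        [|pose proof (pos_INR l); lra].
      simpl in *. lra.
  - destruct FX as (_ & _ & DX). destruct (DX w1 w0) as (Y & RY & FY); [now left|].
    destruct (IH Y FY) as (C & P & HC & HY). exists C, P; split; auto.
    intros n k l. specialize (HY n k l).
    rewrite RY Cmod_mult Cmod_R /w1 /w0 Rminus_0_r Rabs_pos_eq in HY;
      [|pose proof (pos_INR k); lra].
    simpl in *. lra.
Qed.

(** * Derivations of Chebyshev polynomials *)

(** [Rel X X'] reads as X' being the derivation of X. It is a relation because commuting with the
    unbounded L need not give a bounded operator; the instances are [wrel] and the commutator with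
    U. Here [a] has the role of 2x and [B] that of its derivation. The convolution obeys the
    recurrence obtained by deriving that of [V]. *)
Lemma cheb_derivation (Rel : (H -> H) -> (H -> H) -> Prop) (V : nat -> H -> H) (a B : H -> H) :
  (forall n, is_linear (V n)) -> is_linear a -> is_linear B ->
  V O = (fun _ => zero) -> V 1%nat = (fun v => v) ->
  (forall n, V (S (S n)) = fun v => minus (a (V (S n) v)) (V n v)) ->
  Rel (fun _ => zero) (fun _ => zero) -> Rel (fun v => v) (fun _ => zero) ->
  (forall X X' Y Y', Rel X X' -> Rel Y Y' ->
    Rel (fun v => minus (X v) (Y v)) (fun v => minus (X' v) (Y' v))) ->
  (forall X X' Y Y', is_linear X -> is_linear X' -> Rel X X' -> Rel Y Y' ->
    Rel (fun v => X (Y v)) (fun v => plus (X' (Y v)) (X (Y' v)))) ->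
  Rel a B -> forall n, Rel (V n) (conv V (mul (fun _ => B) V) n).
Proof.
  intros LV La LB V0 V1 VS R0 R1 Rminus Rcomp RB.
  set (T := fun n v => sum_n (fun k => V (n - k)%nat (B (V k v))) n).
  assert (HT : conv V (mul (fun _ => B) V) = T).
  { extensionality n; extensionality v. unfold conv, mul, bil, T.
    apply sum_n_ext_loc. intros k Hk. rewrite sum_O Nat.min_l; auto. }
  rewrite HT. clear HT.
  assert (T0 : T O = fun _ => zero).
  { extensionality v. unfold T. rewrite sum_O /= V0 //. }
  assert (T1 : T 1%nat = fun _ => zero).
  { extensionality v. unfold T. rewrite sum_Sn sum_O /= V0 V1.
    rewrite (linear_zero B LB). apply: plus_zero_l. }
  (* In the sum for n + 2, the last term vanishes by V_0 = 0 and the one before is B V_(n+1) by V_1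
     = 1. In all others the recurrence applies to the left factor. *)
  assert (TS : forall n, T (S (S n)) = fun v =>
    minus (plus (B (V (S n) v)) (a (T (S n) v))) (T n v)).
  { intros n; extensionality v. unfold T at 1.
    rewrite !sum_Sn Nat.sub_diag.
    replace (S (S n) - S n)%nat with 1%nat by lia.
    rewrite (sum_n_ext_loc _ (fun k => minus (a (V (S n - k)%nat (B (V k v))))
      (V (n - k)%nat (B (V k v))))).
    2:{ intros k Hk. replace (S (S n) - k)%nat with (S (S (n - k))) by lia.
        rewrite VS. replace (S n - k)%nat with (S (n - k)) by lia. reflexivity. }
    assert (Ha : a (T (S n) v) = sum_n (fun k => a (V (S n - k)%nat (B (V k v)))) n).
    { unfold T. rewrite sum_Sn Nat.sub_diag V0.
      rewrite (linear_plus a La) (linear_zero a La) plus_zero_r.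
      exact (linear_sum_n a _ n La). }
    rewrite Ha. unfold T. rewrite V0 V1.
    set (f := fun k => a (V (S n - k)%nat (B (V k v)))).
    set (g := fun k => V (n - k)%nat (B (V k v))).
    assert (Hm : sum_n (fun k => minus (f k) (g k)) n = minus (sum_n f n) (sum_n g n)) by exact (sum_n_minus (G := CompleteNormedModule.AbelianGroup _ H) f g n).
    change (plus (plus (sum_n (fun k => minus (f k) (g k)) n) (B (V (S n) v))) zero =
      minus (plus (B (V (S n) v)) (sum_n f n)) (sum_n g n)).
    rewrite Hm.
    exact (minus_plus_swap (G := CompleteNormedModule.AbelianGroup _ H) _ _ _). }
  intros n; induction n as [| |n IH1 IH2] using pair_ind.
  - rewrite V0 T0 //.
  - rewrite V1 T1 //.
  - rewrite VS TS. apply Rminus; auto.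
Qed.

End Families.

Arguments Fam {H} ip E W N X.

(** * Rapidly decaying matrices *)

Lemma rapidly_decaying_le (c c' : nat -> nat -> C) K i j : 0 <= K ->
  (forall k l, Cmod (c' k l) <= K * ((1 + INR k) ^ i * (1 + INR l) ^ j) * Cmod (c k l)) ->
  rapidly_decaying c -> rapidly_decaying c'.
Proof.
  intros HK Hcc Hc M N. destruct (Hc (M + i)%nat (N + j)%nat) as [B HB].
  exists (K * B); intros k l. specialize (HB k l). rewrite !pow_add in HB.
  pose proof (pow_1_plus_pos k M) as Pk. pose proof (pow_1_plus_pos l N) as Pl.
  eapply Rle_trans.
  { apply Rmult_le_compat_l; [|apply Hcc]. left; now apply Rmult_lt_0_compat. }
  replace ((1 + INR k) ^ M * (1 + INR l) ^ N *
    (K * ((1 + INR k) ^ i * (1 + INR l) ^ j) * Cmod (c k l))) with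
    (K * ((1 + INR k) ^ M * (1 + INR k) ^ i * ((1 + INR l) ^ N * (1 + INR l) ^ j) *
      Cmod (c k l))) by ring.
  now apply Rmult_le_compat_l.
Qed.

Lemma rapidly_decaying_minus (c c' : nat -> nat -> C) :
  rapidly_decaying c -> rapidly_decaying c' ->
  rapidly_decaying (fun k l => Cminus (c k l) (c' k l)).
Proof.
  intros Hc Hc' M N. destruct (Hc M N) as [B HB], (Hc' M N) as [B' HB'].
  exists (B + B'); intros k l. specialize (HB k l); specialize (HB' k l).
  assert (0 < (1 + INR k) ^ M * (1 + INR l) ^ N)
    by (apply Rmult_lt_0_compat; apply pow_1_plus_pos).
  assert (Cmod (Cminus (c k l) (c' k l)) <= Cmod (c k l) + Cmod (c' k l)).
  { unfold Cminus. eapply Rle_trans; [apply Cmod_triangle|]. rewrite Cmod_opp; lra. }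
  eapply Rle_trans; [apply Rmult_le_compat_l; [lra|eassumption]|]. lra.
Qed.

Lemma rapidZ_0 : rapidZ (fun _ => RtoC 0).
Proof. intros M; exists 0; intros z. rewrite Cmod_0; lra. Qed.

Lemma rapidZ_scal w p : rapidZ p -> rapidZ (fun z => Cmult w (p z)).
Proof.
  intros Hp M; destruct (Hp M) as [B HB]; exists (Cmod w * B); intros z.
  rewrite Cmod_mult.
  replace ((1 + Rabs (IZR z)) ^ M * (Cmod w * Cmod (p z))) with
    (Cmod w * ((1 + Rabs (IZR z)) ^ M * Cmod (p z))) by ring.
  apply Rmult_le_compat_l; [apply Cmod_ge_0|auto].
Qed.

Lemma rapidZ_IZR p : rapidZ p -> rapidZ (fun z => Cmult (RtoC (IZR z)) (p z)).
Proof.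
  intros Hp M; destruct (Hp (M + 1)%nat) as [B HB]; exists B; intros z.
  specialize (HB z). rewrite pow_add pow_1 in HB. rewrite Cmod_mult Cmod_R.
  pose proof (Rabs_pos (IZR z)). pose proof (Cmod_ge_0 (p z)).
  assert (0 <= (1 + Rabs (IZR z)) ^ M) by (apply pow_le; lra).
  eapply Rle_trans; [|exact HB]. rewrite -Rmult_assoc.
  apply Rmult_le_compat_r; auto. apply Rmult_le_compat_l; lra.
Qed.

Lemma rapid_cons s : rapid (fun n => s (S n)) -> rapid s.
Proof.
  intros Hs M; destruct (Hs M) as [B HB].
  exists (Rabs (s O) + 2 ^ M * B); intros n.
  pose proof (pow_lt 2 M ltac:(lra)) as P2. pose proof (Rabs_pos (s O)).
  assert (HB0 : 0 <= B).
  { eapply Rle_trans; [|apply (HB O)]. apply Rmult_le_pos; [|apply Rabs_pos].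
    left; apply pow_1_plus_pos. }
  destruct n as [|n].
  - simpl INR. rewrite Rplus_0_r pow1. nra.
  - specialize (HB n). pose proof (pos_INR n).
    assert (Hp : (1 + INR (S n)) ^ M <= 2 ^ M * (1 + INR n) ^ M).
    { rewrite -Rpow_mult_distr. apply pow_incr. rewrite S_INR. lra. }
    apply Rle_trans with (2 ^ M * (1 + INR n) ^ M * Rabs (s (S n))).
    + apply Rmult_le_compat_r; [apply Rabs_pos|auto].
    + rewrite Rmult_assoc. pose proof (Rmult_le_compat_l (2 ^ M) _ _ ltac:(lra) HB). lra.
Qed.

(** * Smooth Toeplitz operators and commutators with the shift *)

Section Toeplitz.

Context {H : CompleteNormedModule C_AbsRing} {ip : H -> H -> C}
  (hip : is_inner_product ip) {E : nat -> H} (hE : is_orthonormal_basis ip E).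
Context {U Us : H -> H} (hU : is_unilateral_shift E U) (hUs : is_adjoint ip U Us).

Notation weighted := (wrel ip E).
Notation entry := (ent ip E).
Notation family := (Fam ip E).

(** Commuting with L stays in the class: p_z is multiplied by z and the entry c k l by k - l. Both
    remain rapidly decaying, and [operator_exists] provides the bounded operator with these
    entries. *)
Lemma Fam_two_sided_const p c X N : rapidZ p -> rapidly_decaying c -> is_linear X ->
  (forall k l, entry X k l = Cplus (p (Z.of_nat k - Z.of_nat l)%Z) (c k l)) ->
  family two_sided N (fun _ => X).
Proof.
  revert p c X; induction N as [|N IH]; intros p c X Hp Hc HX He;
    (split; [auto|split; [now apply poly_bounded_const|]]); auto.
  intros p' q' [-> ->].
  set (c' := fun k l => Cmult (RtoC (INR k - INR l)) (c k l)).
  assert (Hc' : rapidly_decaying c').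
  { apply (rapidly_decaying_le c c' 1 1 1); [lra| |auto]. intros k l. unfold c'.
    rewrite Cmod_mult Cmod_R. apply Rmult_le_compat_r; [apply Cmod_ge_0|].
    rewrite Rmult_1_l !pow_1. pose proof (pos_INR k); pose proof (pos_INR l).
    apply Rabs_le; nra. }
  destruct (operator_exists hip hE hU hUs _ c' (rapidZ_IZR p Hp) Hc') as (Y & LY & HY).
  exists (fun _ => Y); split.
  - intros _ k l. rewrite HY He. unfold c', w1. rewrite minus_IZR -!INR_IZR_INZ.
    replace (1 + INR k - (1 + INR l)) with (INR k - INR l) by ring. ring.
  - exact (IH _ c' Y (rapidZ_IZR p Hp) Hc' LY HY).
Qed.

(** Row and column weights preserve rapid decay, so the weighted matrices belong to bounded
    operators at every level. *)
Lemma Fam_one_sided_const c X N : rapidly_decaying c -> is_linear X ->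
  (forall k l, entry X k l = c k l) -> family one_sided N (fun _ => X).
Proof.
  revert c X; induction N as [|N IH]; intros c X Hc HX He;
    (split; [auto|split; [now apply poly_bounded_const|]]); auto.
  assert (Hex : forall c', rapidly_decaying c' ->
    exists Y, is_linear Y /\ forall k l, entry Y k l = c' k l).
  { intros c' Hc'. destruct (operator_exists hip hE hU hUs _ c' rapidZ_0 Hc')
      as (Y & LY & HY).
    exists Y; split; auto. intros k l; rewrite HY; ring. }
  intros p' q' [[-> ->]|[-> ->]].
  - set (c' := fun k l => Cmult (RtoC (1 + INR k)) (c k l)).
    assert (Hc' : rapidly_decaying c').
    { apply (rapidly_decaying_le c c' 1 1 0); [lra| |auto]. intros k l. unfold c'.
      rewrite Cmod_mult Cmod_R Rabs_pos_eq; [|pose proof (pos_INR k); lra].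
      simpl; lra. }
    destruct (Hex c' Hc') as (Y & LY & HY). exists (fun _ => Y); split.
    + intros _ k l. rewrite HY He. unfold c', w1, w0. rewrite Rminus_0_r //.
    + exact (IH c' Y Hc' LY HY).
  - set (c' := fun k l => Cmult (RtoC (- (1 + INR l))) (c k l)).
    assert (Hc' : rapidly_decaying c').
    { apply (rapidly_decaying_le c c' 1 0 1); [lra| |auto]. intros k l. unfold c'.
      rewrite Cmod_mult Cmod_R Rabs_Ropp Rabs_pos_eq; [|pose proof (pos_INR l); lra].
      simpl; lra. }
    destruct (Hex c' Hc') as (Y & LY & HY). exists (fun _ => Y); split.
    + intros _ k l. rewrite HY He. unfold c', w1, w0. rewrite Rminus_0_l //.
    + exact (IH c' Y Hc' LY HY).
Qed.

Lemma ent_commutator X k l :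
  entry (fun v => minus (U (X v)) (X (U v))) k l =
    Cminus (match k with O => RtoC 0 | S j => entry X j l end) (entry X k (S l)).
Proof.
  unfold Cminus. rewrite (ent_plus hip (fun v => U (X v)) (fun v => opp (X (U v)))).
  rewrite (ent_opp hip (fun v => X (U v))). f_equal.
  - unfold ent. now rewrite (coord_U hip hE hU).
  - unfold ent. now rewrite (proj2 hU).
Qed.

(* The entries of [b] are constant along diagonals up to the commutator with
   the shift, so they converge along diagonals; the limits are the symbol. *)
Lemma smooth_toeplitz_of_commutator b : is_linear b ->
  rapidly_decaying (entry (fun v => minus (U (b v)) (b (U v)))) ->
  rapid (fun n => Cmod (entry b n 0)) -> smooth_toeplitz ip E U Us b.
Proof.
  intros Lb HD Hb0. set (D := entry (fun v => minus (U (b v)) (b (U v)))) in *.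
  (* The first index k + 1 + i dominates both k and i, so the exponent M + 2 pays for (1 + k)^M and
     for a summable factor in i. *)
  assert (HDb : forall M N, exists B, 0 <= B /\ forall k l i,
    (1 + INR k) ^ M * (1 + INR l) ^ N * Cmod (D (S k + i)%nat (l + i)%nat) <=
      B * / (1 + INR i) ^ 2).
  { intros M N. destruct (HD (M + 2)%nat N) as [B HB]. exists (Rabs B).
    split; [apply Rabs_pos|]. intros k l i.
    specialize (HB (S k + i)%nat (l + i)%nat).
    pose proof (pow_1_plus_pos i 2) as Pi.
    apply Rmult_le_reg_l with ((1 + INR i) ^ 2); auto.
    replace ((1 + INR i) ^ 2 * (Rabs B * / (1 + INR i) ^ 2)) with (Rabs B)
      by (field; pose proof (one_plus_INR_pos i); lra).
    eapply Rle_trans; [|eapply Rle_trans; [exact HB|apply Rle_abs]].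
    rewrite -!Rmult_assoc. apply Rmult_le_compat_r; [apply Cmod_ge_0|].
    apply Rmult_le_compat.
    - left; apply Rmult_lt_0_compat; auto. apply pow_1_plus_pos.
    - left; apply pow_1_plus_pos.
    - rewrite Rmult_comm pow_add.
      apply Rmult_le_compat; try (left; apply pow_1_plus_pos);
        apply pow_1_plus_mono; lia.
    - apply pow_1_plus_mono; lia. }
  destruct (HDb O O) as (B0 & HB0 & HD0).
  destruct (functional_choice (fun (kl : nat * nat) z =>
    is_series (fun i => (D (S (fst kl) + i)%nat (snd kl + i)%nat : C_NormedModule)) z))
    as [cc Hcc].
  { intros [k l]. simpl fst; simpl snd.
    apply (ex_series_le (V := C_CompleteNormedModule) _ (fun i => B0 * / (1 + INR i) ^ 2)).
    - intros i. specialize (HD0 k l i). rewrite /= !Rmult_1_l in HD0. exact HD0.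
    - apply: (ex_series_scal_l B0). apply ex_series_inv_sq. }
  (* The series telescopes: its terms are the differences of successive entries of [b] down the
     diagonal through (k, l). Thus [c] is the deviation of the entry from its diagonal limit, and it
     will be the compact part. *)
  set (c := fun k l => cc (k, l) : C).
  assert (Hc : forall k l,
    is_series (fun i => (D (S k + i)%nat (l + i)%nat : C_NormedModule)) (c k l)).
  { intros k l; exact (Hcc (k, l)). }
  assert (Rc : rapidly_decaying c).
  { intros M N. destruct (HDb M N) as (B & HB & HDB).
    destruct ex_series_inv_sq as [Z HZ].
    exists (B * Z); intros k l.
    set (w := (1 + INR k) ^ M * (1 + INR l) ^ N).
    assert (Pw : 0 < w) by (apply Rmult_lt_0_compat; apply pow_1_plus_pos).
    assert (Hn : Cmod (c k l) <= / w * B * Z).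
    { apply (norm_series_le (K := C_AbsRing) (V := C_NormedModule) _
        (fun i => / w * B * / (1 + INR i) ^ 2) (c k l) (/ w * B * Z)) with (2 := Hc k l).
      - intros i. apply Rmult_le_reg_l with w; auto.
        replace (w * (/ w * B * / (1 + INR i) ^ 2)) with (B * / (1 + INR i) ^ 2)
          by (field; pose proof (one_plus_INR_pos i); lra).
        apply HDB.
      - apply: (is_series_scal_l (/ w * B)). exact HZ. }
    apply (Rmult_le_compat_l w) in Hn; [|lra].
    replace (w * (/ w * B * Z)) with (B * Z) in Hn by (field; lra). exact Hn. }
  assert (HDe : forall k l, D (S k) l = Cminus (entry b k l) (entry b (S k) (S l))).
  { intros k l. unfold D. now rewrite ent_commutator. }
  assert (Hstep : forall k l, c k l = Cplus (D (S k) l) (c (S k) (S l))).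
  { intros k l.
    apply (is_series_unique' (K := C_AbsRing) (V := C_NormedModule) _ _ _ (Hc k l)).
    apply (is_series_decr_1 (K := C_AbsRing) (V := C_NormedModule)).
    evar_last.
    - apply (is_series_ext (K := C_AbsRing) (V := C_NormedModule)) with (2 := Hc (S k) (S l)).
      intros i. f_equal; lia.
    - rewrite !Nat.add_0_r. change (c (S k) (S l) =
        Cplus (Cplus (D (S k) l) (c (S k) (S l))) (Copp (D (S k) l))). ring. }
  set (e := fun k l => Cminus (entry b k l) (c k l)).
  assert (He : forall k l, e (S k) (S l) = e k l).
  { intros k l. unfold e. rewrite (Hstep k l) HDe. ring. }
  set (p := fun z => if Z_le_dec 0 z then e (Z.to_nat z) O else e O (Z.to_nat (- z))).
  assert (Hep : forall k l, e k l = p (Z.of_nat k - Z.of_nat l)%Z).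
  { assert (H1 : forall l k, e (l + k)%nat l = e k O).
    { induction l as [|l IH]; intros k; auto. rewrite -IH. apply He. }
    assert (H2 : forall k l, e k (k + l)%nat = e O l).
    { induction k as [|k IH]; intros l; auto. rewrite -IH. apply He. }
    intros k l. unfold p. destruct (Z_le_dec 0 (Z.of_nat k - Z.of_nat l)).
    - rewrite -(H1 l). f_equal; lia.
    - rewrite -(H2 k). f_equal; lia. }
  (* The modes n >= 0 sit in column 0, where decay of [b] is a hypothesis. *)
  assert (Rpos : rapid (fun n => Cmod (e n O))).
  { intros M. destruct (Hb0 M) as [B HB], (Rc M O) as [B' HB'].
    exists (B + B'); intros n. specialize (HB n); specialize (HB' n O).
    rewrite (Rabs_pos_eq (Cmod _)) in HB |- *; try apply Cmod_ge_0.
    rewrite Rabs_pos_eq; [|apply Cmod_ge_0]. simpl in HB'. rewrite Rmult_1_r in HB'.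
    pose proof (pow_1_plus_pos n M).
    assert (Cmod (e n O) <= Cmod (entry b n O) + Cmod (c n O)).
    { unfold e, Cminus. eapply Rle_trans; [apply Cmod_triangle|]. rewrite Cmod_opp; lra. }
    eapply Rle_trans; [apply Rmult_le_compat_l; [lra|eassumption]|]. lra. }
  (* The negative modes sit in row 0. There U b contributes nothing, so D 0 n is minus the entry (0,
     n + 1) of [b]. This misses the entry (0, 0), hence [rapid_cons]. *)
  assert (Rneg : rapid (fun n => Cmod (e O n))).
  { apply rapid_cons. intros M.
    destruct (HD O M) as [B HB].
    assert (Rc0 : rapid (fun n => Cmod (c O (S n)))).
    { apply (rapid_shift (fun n => Cmod (c O n))). intros N.
      destruct (Rc O N) as [B' HB']. exists B'; intros n. specialize (HB' O n).
      rewrite /= Rmult_1_l in HB'. rewrite Rabs_pos_eq; [auto|apply Cmod_ge_0]. }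
    destruct (Rc0 M) as [B' HB'].
    exists (B + B'); intros n. specialize (HB O n); specialize (HB' n).
    rewrite (Rabs_pos_eq (Cmod _)) in HB' |- *; try apply Cmod_ge_0.
    rewrite Rabs_pos_eq; [|apply Cmod_ge_0]. rewrite /= Rmult_1_l in HB.
    pose proof (pow_1_plus_pos n M).
    assert (HD0n : D O n = Copp (entry b O (S n))).
    { unfold D. rewrite ent_commutator. ring. }
    rewrite HD0n Cmod_opp in HB.
    assert (Cmod (e O (S n)) <= Cmod (entry b O (S n)) + Cmod (c O (S n))).
    { unfold e, Cminus. eapply Rle_trans; [apply Cmod_triangle|]. rewrite Cmod_opp; lra. }
    eapply Rle_trans; [apply Rmult_le_compat_l; [lra|eassumption]|]. lra. }
  apply (smooth_toeplitz_of_entries hip hE hU hUs p c); auto.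
  - apply rapidZ_of_nats.
    + apply rapid_ext with (2 := Rpos). intros n. f_equal. rewrite (Hep n O).
      f_equal; lia.
    + apply rapid_ext with (2 := Rneg). intros n. f_equal. rewrite (Hep O n).
      f_equal; lia.
  - intros k l. rewrite -Hep. unfold e. ring.
Qed.

(** * Chebyshev family of [a], which stands for 2/r times the operator of the theorem *)

Section ChebyshevFamily.

Context {a : H -> H} {V : nat -> H -> H} (La : is_linear a)
  (LV : forall n, is_linear (V n)) (PV : poly_bounded V)
  (V0 : V O = fun _ => zero) (V1 : V 1%nat = fun v => v)
  (VS : forall n, V (S (S n)) = fun v => minus (a (V (S n) v)) (V n v)).
Context {p : Z -> C} {c : nat -> nat -> C} (Hp : rapidZ p) (Hc : rapidly_decaying c)
  (Ha : forall k l, entry a k l = Cplus (p (Z.of_nat k - Z.of_nat l)%Z) (c k l)).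

(** Induction on N: the weighted matrix of [V] is a convolution of [V], [B] and [V], to which the
    lower level applies. *)
Lemma cheb_family_two_sided N : family two_sided N V.
Proof.
  destruct (Fam_two_sided_const p c a 1 Hp Hc La Ha) as (_ & _ & DB).
  destruct (DB w1 w1) as (B' & RB & FB0); [now split|].
  set (B := B' O).
  assert (LB : is_linear B) by apply (proj1 FB0).
  (* Each level supplies its own witness for the weighted matrix of [a]. All have the same entries,
     hence equal [B]. *)
  assert (FB : forall N, family two_sided N (fun _ => B)).
  { intros M. destruct (Fam_two_sided_const p c a (S M) Hp Hc La Ha) as (_ & _ & DM).
    destruct (DM w1 w1) as (B1 & RB1 & FB1); [now split|].
    replace (fun _ : nat => B) with B1; auto.
    extensionality n; extensionality v. apply (op_ext hE); auto.
    - apply (Fam_linear _ _ _ FB1).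
    - intros k l. rewrite (RB1 n k l) (RB O k l) //. }
  induction N as [|N IH]; (split; [auto|split; auto]).
  intros q q' [-> ->].
  exists (conv V (mul (fun _ => B) V)); split.
  - apply (cheb_derivation (weighted w1 w1)) with a; auto.
    + apply (wrel_self_zero hip hE). intros; apply (ent_zero hip hE).
    + apply (wrel_self_zero hip hE). intros k l Hkl.
      unfold ent. rewrite (ip_E hE). destruct (Nat.eq_dec l k); auto; lia.
    + intros X X' Y Y' HX HY. apply (wrel_plus hip); auto. now apply (wrel_opp hip).
    + intros X X' Y Y' LX LX' HX HY. now apply (wrel_comp hip hE w1 w1 w1).
    + apply (RB O).
  - apply (Fam_bil hip hE two_sided two_sided two_sided); auto.
    + apply index_le_conv.
    + apply leibniz_two_two.
    + apply (Fam_bil hip hE two_sided two_sided two_sided); auto.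
      * apply index_le_mul.
      * apply leibniz_two_two.
Qed.

(** The Toeplitz part, constant along diagonals, cancels except in row 0, where U a contributes
    nothing and minus the mode -(l+1) of p is left. The rest consists of shifted copies of c. *)
Lemma commutator_rapidly_decaying :
  rapidly_decaying (entry (fun v => minus (U (a v)) (a (U v)))).
Proof.
  set (c1 := fun k l => match k with
    | O => Copp (p (- Z.of_nat (S l))%Z) | S j => c j l end).
  set (c2 := fun k l => c k (S l)).
  assert (H2 : rapidly_decaying c2).
  { intros M N. destruct (Hc M N) as [B HB]; exists B; intros k l.
    eapply Rle_trans; [|apply (HB k (S l))]. apply Rmult_le_compat_r; [apply Cmod_ge_0|].
    apply Rmult_le_compat_l; [left; apply pow_1_plus_pos|]. apply pow_1_plus_mono; lia. }
  assert (H1 : rapidly_decaying c1).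
  { intros M N.
    assert (Hs : rapid (fun n => Cmod (p (- Z.of_nat (S n))%Z))).
    { apply (rapid_shift (fun n => Cmod (p (- Z.of_nat n)%Z))).
      apply (rapidZ_of_nat (fun z => p (- z)%Z)). now apply rapidZ_opp. }
    destruct (Hs N) as [B HB], (Hc M N) as [B' HB'].
    exists (Rabs B + 2 ^ M * Rabs B'); intros [|j] l.
    - specialize (HB l). rewrite Rabs_pos_eq in HB; [|apply Cmod_ge_0].
      unfold c1. rewrite Cmod_opp. simpl INR. rewrite Rplus_0_r pow1 Rmult_1_l.
      pose proof (Rle_abs B). pose proof (pow_lt 2 M ltac:(lra)) as P2.
      pose proof (Rmult_le_pos _ _ (Rlt_le _ _ P2) (Rabs_pos B')). lra.
    - specialize (HB' j l). unfold c1. pose proof (pos_INR j).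
      assert (Hq : (1 + INR (S j)) ^ M <= 2 ^ M * (1 + INR j) ^ M).
      { rewrite -Rpow_mult_distr. apply pow_incr. rewrite S_INR. lra. }
      apply Rle_trans with (2 ^ M * ((1 + INR j) ^ M * (1 + INR l) ^ N * Cmod (c j l))).
      + rewrite -!Rmult_assoc. apply Rmult_le_compat_r; [apply Cmod_ge_0|].
        apply Rmult_le_compat_r; auto. left; apply pow_1_plus_pos.
      + pose proof (Rabs_pos B). pose proof (Rle_abs B').
        pose proof (pow_lt 2 M ltac:(lra)).
        apply Rle_trans with (2 ^ M * Rabs B'); [|lra].
        apply Rmult_le_compat_l; lra. }
  replace (entry (fun v => minus (U (a v)) (a (U v)))) with
    (fun k l => Cminus (c1 k l) (c2 k l)); [now apply rapidly_decaying_minus|].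
  extensionality k; extensionality l. rewrite ent_commutator.
  unfold c1, c2. destruct k as [|j]; rewrite !Ha.
  - replace (Z.of_nat 0 - Z.of_nat (S l))%Z with (- Z.of_nat (S l))%Z by lia. ring.
  - replace (Z.of_nat (S j) - Z.of_nat (S l))%Z with (Z.of_nat j - Z.of_nat l)%Z by lia.
    ring.
Qed.

(** Multiplying a one-sided family on either side by a two-sided one leaves it one-sided, so the
    single factor [U, a] passes its decay to the whole convolution. *)
Lemma cheb_family_one_sided N :
  family one_sided N (fun n v => minus (U (V n v)) (V n (U v))).
Proof.
  destruct hU as [LU _].
  set (B := fun v => minus (U (a v)) (a (U v))).
  assert (LB : is_linear B).
  { apply (is_linear_minus_op (fun v => U (a v)) (fun v => a (U v)));
      [now apply (is_linear_comp a U)|now apply (is_linear_comp U a)]. }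
  assert (FB : family one_sided N (fun _ => B)).
  { apply (Fam_one_sided_const (entry B)); auto. apply commutator_rapidly_decaying. }
  replace (fun n v => minus (U (V n v)) (V n (U v))) with (conv V (mul (fun _ => B) V)).
  - apply (Fam_bil hip hE two_sided one_sided one_sided).
    + apply index_le_conv.
    + apply leibniz_two_one.
    + apply cheb_family_two_sided.
    + apply (Fam_bil hip hE one_sided two_sided one_sided).
      * apply index_le_mul.
      * apply leibniz_one_two.
      * auto.
      * apply cheb_family_two_sided.
  - extensionality n; extensionality v.
    apply (cheb_derivation (fun X Y => forall v, Y v = minus (U (X v)) (X (U v))) V a B); auto.
    + intros u. rewrite (linear_zero U LU). symmetry; apply: minus_zero_r.
    + intros u. symmetry; apply: minus_eq_zero.
    + intros X X' Y Y' HX HY u. rewrite HX HY (linear_minus U _ _ LU).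
      unfold minus. rewrite !opp_plus -!plus_assoc. f_equal.
      rewrite !plus_assoc. f_equal. apply plus_comm.
    + intros X X' Y Y' LX LX' HX HY u. rewrite HX HY (linear_minus X _ _ LX).
      symmetry; apply: minus_trans.
Qed.

Lemma cheb_series_smooth_toeplitz (s : nat -> C) b :
  rapid (fun n => Cmod (s n)) -> is_linear b ->
  is_op_series (fun n v => scal (s n) (V n v)) b -> smooth_toeplitz ip E U Us b.
Proof.
  intros Hs Lb Hb.
  assert (Sb : forall k l, is_series (fun n => (Cmult (s n) (entry (V n) k l) : C_NormedModule))
    (entry b k l)).
  { intros k l. apply is_series_ext with (2 := ent_op_series hip hE _ _ k l Hb).
    intros n. apply (ent_scal hip). }
  (* A weighted bound growing polynomially in n survives summation against [s]; the resulting
     constant depends only on C, P and [s], hence not on the entry considered. *)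
  assert (Sbound : forall (x : nat -> C) (z : C) w C P, 0 < w -> 0 <= C ->
    (forall n, w * Cmod (x n) <= C * (1 + INR n) ^ P) ->
    is_series (fun n => (Cmult (s n) (x n) : C_NormedModule)) z ->
    w * Cmod z <= C * Series (fun n => (1 + INR n) ^ P * Rabs (Cmod (s n)))).
  { intros x z w C P Hw HC Hx Hz.
    pose proof (Series_correct _ (rapid_ex_series _ P Hs)) as HS.
    set (T := Series _) in *.
    assert (Hn : Cmod z <= / w * C * T).
    { apply (norm_series_le (K := C_AbsRing) (V := C_NormedModule) _
        (fun n => / w * C * ((1 + INR n) ^ P * Rabs (Cmod (s n)))) z (/ w * C * T))
        with (2 := Hz).
      - intros n. change (Cmod (Cmult (s n) (x n)) <=
          / w * C * ((1 + INR n) ^ P * Rabs (Cmod (s n)))).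
        rewrite Cmod_mult (Rabs_pos_eq (Cmod _)); [|apply Cmod_ge_0].
        apply Rmult_le_reg_l with w; auto.
        replace (w * (/ w * C * ((1 + INR n) ^ P * Cmod (s n)))) with
          (Cmod (s n) * (C * (1 + INR n) ^ P)) by (field; lra).
        replace (w * (Cmod (s n) * Cmod (x n))) with (Cmod (s n) * (w * Cmod (x n))) by ring.
        apply Rmult_le_compat_l; [apply Cmod_ge_0|auto].
      - apply: (is_series_scal_l (/ w * C)). exact HS. }
    apply (Rmult_le_compat_l w) in Hn; [|lra].
    replace (w * (/ w * C * T)) with (C * T) in Hn by (field; lra). exact Hn. }
  apply smooth_toeplitz_of_commutator; auto.
  - set (W := fun n v => minus (U (V n v)) (V n (U v))).
    assert (SD : forall k l, is_series (fun n => (Cmult (s n) (entry (W n) k l) : C_NormedModule))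
      (entry (fun v => minus (U (b v)) (b (U v))) k l)).
    { intros k l. rewrite ent_commutator.
      assert (S1 : is_series (fun n => (Cmult (s n)
          (match k with O => RtoC 0 | S j => entry (V n) j l end) : C_NormedModule))
          (match k with O => RtoC 0 | S j => entry b j l end)).
      { destruct k as [|j]; [|apply Sb].
        apply (is_series_ext (K := C_AbsRing) (V := C_NormedModule) (fun _ => RtoC 0)).
        - intros n; symmetry; apply Cmult_0_r.
        - exact (is_series_single (K := C_AbsRing) (V := C_NormedModule)
            (fun _ => RtoC 0) 0 (fun _ _ => eq_refl)). }
      apply (is_series_ext (K := C_AbsRing) (V := C_NormedModule))
        with (2 := is_series_minus _ _ _ _ S1 (Sb k (S l))).
      intros n. unfold W. rewrite ent_commutator.
      change (Cminus (Cmult (s n) (match k with O => RtoC 0 | S j => entry (V n) j l end))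
        (Cmult (s n) (entry (V n) k (S l))) =
        Cmult (s n) (Cminus (match k with O => RtoC 0 | S j => entry (V n) j l end)
          (entry (V n) k (S l)))). ring. }
    intros M N.
    destruct (one_sided_decay hip hE M N W) as (C & P & HC & HW).
    { apply cheb_family_one_sided. }
    exists (C * Series (fun n => (1 + INR n) ^ P * Rabs (Cmod (s n)))); intros k l.
    apply (Sbound (fun n => entry (W n) k l)); auto.
    apply Rmult_lt_0_compat; apply pow_1_plus_pos.
  (* In column 0 the distance to the diagonal is the row index itself, so off-diagonal decay is
     decay of the column. *)
  - apply rapid_of_decay. intros M.
    destruct (two_sided_decay hip hE M V) as (C & P & HC & HW).
    { apply cheb_family_two_sided. }
    set (T := C * Series (fun n => (1 + INR n) ^ P * Rabs (Cmod (s n)))).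
    assert (Hb0 : forall n, INR (S n) ^ M * Rabs (Cmod (entry b (S n) O)) <= T).
    { intros n. rewrite (Rabs_pos_eq (Cmod _)); [|apply Cmod_ge_0].
      apply (Sbound (fun i => entry (V i) (S n) O)); auto.
      - apply pow_lt, lt_0_INR; lia.
      - intros i. specialize (HW i (S n) O). rewrite Rminus_0_r Rabs_pos_eq in HW;
          [exact HW|apply pos_INR]. }
    exists (INR 0 ^ M * Rabs (Cmod (entry b O O)) + T); intros [|n].
    + assert (0 <= T); [|lra]. eapply Rle_trans; [|apply (Hb0 O)].
      apply Rmult_le_pos; [apply pow_le, pos_INR|apply Rabs_pos].
    + assert (0 <= INR 0 ^ M * Rabs (Cmod (entry b O O)))
        by (apply Rmult_le_pos; [apply pow_le; simpl; lra|apply Rabs_pos]).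
      specialize (Hb0 n). lra.
Qed.

End ChebyshevFamily.

End Toeplitz.

(** * Functional calculus of the Chebyshev polynomials on the spectrum *)

Lemma continuous_within_Re_Im (D : R -> Prop) (g : R -> C) :
  (forall x, D x -> continuous (fun t => Re (g t)) x /\ continuous (fun t => Im (g t)) x) ->
  continuous_within D g.
Proof.
  intros Hg x Hx. destruct (Hg x Hx) as [H1 H2].
  apply filterlim_locally; intros eps.
  pose proof (proj1 (filterlim_locally _ _) H1 eps) as L1.
  pose proof (proj1 (filterlim_locally _ _) H2 eps) as L2.
  unfold within. generalize (filter_and _ _ L1 L2). apply: filter_imp.
  intros y [B1 B2] _. split; [exact B1|exact B2].
Qed.

Lemma continuous_within_real (D : R -> Prop) (g : R -> R) :
  (forall x, continuous g x) -> continuous_within D (fun x => RtoC (g x)).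
Proof.
  intros Hg; apply continuous_within_Re_Im; intros x _; split; [apply Hg|].
  apply: continuous_const.
Qed.

Theorem theorem3p6
    (H : CompleteNormedModule C_AbsRing) (ip : H -> H -> C)
    (hip : is_inner_product ip)
    (E : nat -> H) (hE : is_orthonormal_basis ip E)
    (U Us : H -> H) (hU : is_unilateral_shift E U) (hUs : is_adjoint ip U Us)
    (a : H -> H) (ha : smooth_toeplitz ip E U Us a) (hsa : self_adjoint ip a)
    (D : R -> Prop) (hD : open D)
    (hspec : forall x : R, real_spectrum a x -> D x)
    (f : R -> C) (hf : smooth_on D f)
    (Phi : (R -> C) -> H -> H)
    (hPhi : is_continuous_functional_calculus ip a Phi) :
  smooth_toeplitz ip E U Us (Phi f).
Proof.
  assert (La : is_linear a).
  { apply is_linear_ext with (Phi (fun x => RtoC x)); [apply (cfc_id _ _ _ hPhi)|].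
    apply (cfc_linear _ _ _ hPhi). apply continuous_within_real.
    intros; apply continuous_id. }
  destruct (linear_norm a La) as (M & HM & HaM).
  (* The slack 1 puts the spectrum inside the open interval (-r, r), as [cheb_bound] requires. *)
  set (r := M + 1). set (K := real_spectrum a) in *.
  assert (HKr : forall x, K x -> Rabs x < r).
  { intros x Hx. pose proof (spectrum_bound a M x La (Rlt_le _ _ HM) HaM Hx).
    unfold r; lra. }
  assert (Hr : 0 < r) by (unfold r; lra).
  destruct (cheb_expansion K D f r Hr hD hf hspec HKr (fun x => resolvent_open a x La))
    as (s & Hs & Happ).
  assert (Kf : continuous_within K f).
  { apply continuous_within_Re_Im. intros x Hx. apply hspec in Hx.
    destruct (proj1 (smooth_on_Cinf D f hD) hf) as [H1 H2].
    split; [apply (Cinf_continuous D _ H1)|apply (Cinf_continuous D _ H2)]; auto. }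
  set (g := fun n x => cheb n (x / r)).
  assert (Cg : forall n x, continuous (g n) x).
  { intros n x. apply (continuous_comp (fun x => x / r) (cheb n)); [|apply continuous_cheb].
    apply: continuous_mult; [apply: continuous_id|apply: continuous_const]. }
  assert (Kg : forall n, continuous_within K (fun x => RtoC (g n x)))
    by (intros; now apply continuous_within_real).
  set (V := fun n => Phi (fun x => RtoC (g n x))).
  assert (Hunit : forall x, K x -> -1 < x / r < 1).
  { intros x Hx. apply HKr, Rabs_def2 in Hx. split.
    - apply Rmult_lt_reg_r with r; auto. field_simplify; lra.
    - apply Rmult_lt_reg_r with r; auto. field_simplify; lra. }
  assert (LV : forall n, is_linear (V n)) by (intros; apply (cfc_linear _ _ _ hPhi); auto).
  assert (PV : poly_bounded V).
  { exists 1, 1%nat; split; [lra|]. intros n v.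
    apply (cfc_norm _ _ _ hPhi); auto. intros x Hx.
    rewrite Cmod_R pow_1. pose proof (cheb_bound n (x / r) (Hunit x Hx)).
    unfold g. lra. }
  (* The Chebyshev recurrence at x/r multiplies by 2x/r, hence this rescaling. The symbol and the
     compact part are scaled by the same factor below. *)
  set (a1 := fun v => scal (RtoC (2 / r)) (a v)).
  assert (La1 : is_linear a1) by now apply is_linear_scal_comp.
  assert (V0 : V O = fun _ => zero).
  { extensionality v. apply: norm_eq_zero. apply Rle_antisym; [|apply norm_ge_0].
    rewrite -(Rmult_0_l (norm v)). apply (cfc_norm _ _ _ hPhi); auto.
    intros x _. unfold g; simpl. rewrite Cmod_0; lra. }
  assert (V1 : V 1%nat = fun v => v).
  { extensionality v. apply (cfc_one _ _ _ hPhi). }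
  assert (Kx : continuous_within K (fun x => RtoC x))
    by (apply continuous_within_real; intros; apply continuous_id).
  assert (VS : forall n, V (S (S n)) = fun v => minus (a1 (V (S n) v)) (V n v)).
  { intros n; extensionality v. unfold V.
    assert (Hfun : (fun x => RtoC (g (S (S n)) x)) = (fun x =>
      Cplus (Cmult (RtoC (2 / r)) (Cmult (RtoC x) (RtoC (g (S n) x))))
        (Cmult (RtoC (-1)) (RtoC (g n x))))).
    { extensionality x. unfold g. rewrite cheb_SS.
      rewrite -!RtoC_mult -RtoC_plus. f_equal. field. lra. }
    rewrite Hfun.
    assert (Km : continuous_within K (fun x => Cmult (RtoC x) (RtoC (g (S n) x)))).
    { replace (fun x => Cmult (RtoC x) (RtoC (g (S n) x))) with
        (fun x => RtoC (x * g (S n) x)) by (extensionality x; apply RtoC_mult).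
      apply continuous_within_real. intros x.
      apply continuous_Rmult; [apply continuous_id|apply Cg]. }
    rewrite (cfc_plus _ _ _ hPhi).
    - rewrite (cfc_scal _ _ _ hPhi); auto. rewrite (cfc_scal _ _ _ hPhi); auto.
      rewrite (cfc_mult _ _ _ hPhi); auto. rewrite (cfc_id _ _ _ hPhi).
      unfold a1, minus. f_equal.
      replace (RtoC (-1)) with (opp (one : C_AbsRing)).
      + apply: scal_opp_one.
      + change (Copp (RtoC 1) = RtoC (-1)). rewrite -RtoC_opp //.
    - replace (fun x => Cmult (RtoC (2 / r)) (Cmult (RtoC x) (RtoC (g (S n) x)))) with
        (fun x => RtoC (2 / r * (x * g (S n) x)))
        by (extensionality x; now rewrite !RtoC_mult).
      apply continuous_within_real. intros x. apply continuous_Rmult; [apply: continuous_const|].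
      apply continuous_Rmult; [apply continuous_id|apply Cg].
    - replace (fun x => Cmult (RtoC (-1)) (RtoC (g n x))) with
        (fun x => RtoC (-1 * g n x)) by (extensionality x; now rewrite !RtoC_mult).
      apply continuous_within_real. intros x.
      apply continuous_Rmult; [apply: continuous_const|apply Cg]. }
  destruct ha as (phi & A & c0 & Hphi & HA & (c & Hc & Hc0) & Ha).
  set (w := RtoC (2 / r)).
  assert (Hp1 : rapidZ (fun z => Cmult w (fourier_coef phi z)))
    by (apply rapidZ_scal; now apply smooth_circle_rapid).
  assert (Hc1 : rapidly_decaying (fun k l => Cmult w (c k l))).
  { apply (rapidly_decaying_le c _ (Cmod w) 0 0); auto; [apply Cmod_ge_0|].
    intros k l. rewrite Cmod_mult /=. right; ring. }
  assert (Ha1 : forall k l, ent ip E a1 k l =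
    Cplus (Cmult w (fourier_coef phi (Z.of_nat k - Z.of_nat l))) (Cmult w (c k l))).
  { intros k l. unfold a1. rewrite (ent_scal hip).
    assert (Hak : ent ip E a k l = Cplus (ent ip E A k l)
      (ent ip E c0 k l)).
    { unfold ent. rewrite Ha. apply (ip_plus _ hip). }
    rewrite Hak (ent_toeplitz hip hE hU hUs _ _ _ _ HA)
      (ent_smooth_compact hip hE c c0 k l Hc0). fold w. ring. }
  apply (cheb_series_smooth_toeplitz hip hE hU hUs La1 LV PV V0 V1 VS Hp1 Hc1 Ha1 s); auto.
  { now apply (cfc_linear _ _ _ hPhi). }
  (* What remains is convergence in operator norm. The partial sums of operators are the functional
     calculus of [q N], and a uniform bound for f - q N on the spectrum becomes an operator bound by
     [cfc_norm]. *)
  set (q := fun N x => sum_n (fun n => Cmult (s n) (RtoC (g n x))) N).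
  assert (Kq : forall N, continuous_within K (q N)).
  { intros N; apply continuous_within_Re_Im; intros x _.
    assert (HR : forall (z : nat -> R), continuous (fun t => sum_n (fun n => z n * g n t) N) x).
    { intros z. induction N as [|N IH].
      - apply (continuous_ext (fun t => z O * g O t)); [intros; now rewrite sum_O|].
        apply continuous_Rmult; [apply: continuous_const|apply Cg].
      - apply (continuous_ext (fun t => sum_n (fun n => z n * g n t) N + z (S N) * g (S N) t)).
        + intros; now rewrite sum_Sn.
        + apply: continuous_plus; auto.
          apply continuous_Rmult; [apply: continuous_const|apply Cg]. }
    split.
    - apply (continuous_ext (fun t => sum_n (fun n => Re (s n) * g n t) N)); auto.
      intros t. unfold q. rewrite (proj1 (sum_n_Re_Im _ N)). apply sum_n_ext.
      intros n. unfold Re; simpl; ring.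
    - apply (continuous_ext (fun t => sum_n (fun n => Im (s n) * g n t) N)); auto.
      intros t. unfold q. rewrite (proj2 (sum_n_Re_Im _ N)). apply sum_n_ext.
      intros n. unfold Im; simpl; ring. }
  assert (Hq : forall N v, Phi (q N) v = sum_n (fun n => scal (s n) (V n v)) N).
  { intros N v; induction N as [|N IH].
    - rewrite sum_O. replace (q O) with (fun x => Cmult (s O) (RtoC (g O x))).
      + now apply (cfc_scal _ _ _ hPhi).
      + extensionality x; unfold q; now rewrite sum_O.
    - rewrite sum_Sn -IH.
      assert (KS : continuous_within K (fun x => Cmult (s (S N)) (RtoC (g (S N) x)))).
      { apply continuous_within_Re_Im; intros x _; split.
        - apply (continuous_ext (fun t => Re (s (S N)) * g (S N) t)).
          + intros t; unfold Re; simpl; ring.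
          + apply continuous_Rmult; [apply: continuous_const|apply Cg].
        - apply (continuous_ext (fun t => Im (s (S N)) * g (S N) t)).
          + intros t; unfold Im; simpl; ring.
          + apply continuous_Rmult; [apply: continuous_const|apply Cg]. }
      replace (q (S N)) with (fun x => Cplus (q N x) (Cmult (s (S N)) (RtoC (g (S N) x)))).
      + rewrite (cfc_plus _ _ _ hPhi); auto. f_equal. now apply (cfc_scal _ _ _ hPhi).
      + extensionality x; unfold q; now rewrite sum_Sn. }
  intros eps. destruct (Happ eps) as [N HN]. exists N; intros n Hn v.
  rewrite -norm_opp opp_minus -(Hq n v).
  (* The difference is written with the scalar -1 because the functional calculus is specified
     through sums and scalar multiples. *)
  assert (Kmq : continuous_within K (fun x => Cmult (RtoC (-1)) (q n x))).
  { replace (fun x => Cmult (RtoC (-1)) (q n x)) with (fun x => Copp (q n x)).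
    - intros x Hx. eapply filterlim_comp; [apply (Kq n x Hx)|].
      apply (filterlim_opp (V := C_NormedModule)).
    - extensionality x. ring. }
  assert (Hdiff : minus (Phi f v) (Phi (q n) v) =
    Phi (fun x => Cplus (f x) (Cmult (RtoC (-1)) (q n x))) v).
  { rewrite (cfc_plus _ _ _ hPhi); auto. rewrite (cfc_scal _ _ _ hPhi); auto.
    unfold minus; f_equal. symmetry.
    replace (RtoC (-1)) with (opp (one : C_AbsRing)).
    - apply: scal_opp_one.
    - change (Copp (RtoC 1) = RtoC (-1)). rewrite -RtoC_opp //. }
  rewrite Hdiff. apply (cfc_norm _ _ _ hPhi).
  - intros x Hx.
    eapply filterlim_comp_2; [apply (Kf x Hx)|apply (Kmq x Hx)|].
    apply (filterlim_plus (V := C_NormedModule)).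
  - intros x Hx. specialize (HN n Hn x Hx).
    replace (Cplus (f x) (Cmult (RtoC (-1)) (q n x))) with (Cminus (f x) (q n x)) by ring.
    exact HN.
Qed.
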